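(* For $n\ge5$, $R/I_{n,n-2}$ is Cohen--Macaulay if and only if $\operatorname{char}(K)\ne2$. Hence, for $n\ge6$, $R/I_{(n-3,3)}^{\mathrm{Sp}}$ is Cohen--Macaulay if and only if $\operatorname{char}(K)\neq2$. The same is true for $R/I_{(2,2,1)}^{\mathrm{Sp}}$: for $n=5$, $R/I_{(2,2,1)}^{\mathrm{Sp}}$ is Cohen--Macaulay if and only if $\operatorname{char}(K)\ne 2$.
   Context: Let $K$ be a field, $[n]=\{1,\ldots,n\}$, and $R=K[x_1,\ldots,x_n]$. For $2\le k\le n$, $I_{n,k}=\bigcap_{F\subset[n],\,\#F=k}P_F$, where $P_F=(x_i-x_j\mid i,j\in F)\subset R$. For a partition $\lambda=(\lambda_1\ge\cdots\ge\lambda_l\ge1)$ of $n$, a tableau of shape $\lambda$ is a bijection from $[n]$ to the set of boxes of the (left-justified) Young diagram of $\lambda$, which has $\lambda_i$ boxes in row $i$. For a tableau $T$ of shape $\lambda$, if the $j$-th column of $T$ consists of $j_1,\ldots,j_m$ from top to bottom, set $f_T(j)=\prod_{1\le s<t\le m}(x_{j_s}-x_{j_t})$ (equal to $1$ if $m=1$), and let the Specht polynomial of $T$ be $f_T=\prod_{j=1}^{\lambda_1}f_T(j)$. The Specht ideal is $I_\lambda^{\mathrm{Sp}}=(f_T\mid T\text{ a tableau of shape }\lambda)\subset R$. *)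

(* Defs.v *)
From HB Require Import structures.
From mathcomp Require Import all_boot all_algebra ring_quotient.
From mathcomp Require Import boolp.
From mathcomp Require Import mpoly.

Set Implicit Arguments.
Unset Strict Implicit.
Unset Printing Implicit Defensive.

Import GRing.Theory.
Local Open Scope ring_scope.

(* Ideals are boolean predicates, as in [ring_quotient]; no ideal is excluded
   by this, since [`[< _ >]] turns any Prop-valued predicate into a boolean one.
   Pitfall: the library's [idealr_closed] includes [1 \notin I], so it means
   "proper ideal". *)

Section CohenMacaulay.
Variable A : comNzRingType.
Implicit Types (I J P : {pred A}) (s : seq A).

Definition ideal_gen (S : A -> Prop) : {pred A} :=
  [pred p | `[< exists2 cs : seq (A * A),
                  (forall t, t \in cs -> S t.2)
                & p = \sum_(t <- cs) t.1 * t.2 >]].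

Definition span_ideal s : {pred A} := ideal_gen (fun a => a \in s).

(* The unit ideal, not covered by [idealr_closed], is generated by 1. *)
Definition noetherian : Prop :=
  forall I, idealr_closed I -> exists s, I =i span_ideal s.

Definition prime_ideal P : Prop := idealr_closed P /\ prime_idealr_closed P.

Definition maximal_ideal P : Prop :=
  idealr_closed P /\
  forall J, idealr_closed J -> {subset P <= J} -> {subset J <= P}.

Definition prime_chain P (d : nat) (c : nat -> {pred A}) : Prop :=
  [/\ forall i, (i <= d)%N -> prime_ideal (c i),
      forall i, (i < d)%N ->
        {subset c i <= c i.+1} /\ ~ {subset c i.+1 <= c i}
    & c d =i P].

Definition has_height P (d : nat) : Prop :=
  (exists c, prime_chain P d c) /\
  (forall e c, prime_chain P e c -> (e <= d)%N).

Definition regular_sequence s : Prop :=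
  1 \notin span_ideal s /\
  forall i, (i < size s)%N ->
    forall a, a * s`_i \in span_ideal (take i s) -> a \in span_ideal (take i s).

(* depth(I, A): the maximal length of an A-regular sequence contained in I *)
Definition has_depth I (d : nat) : Prop :=
  (exists s, [/\ regular_sequence s, {subset s <= I} & size s = d]) /\
  (forall s, regular_sequence s -> {subset s <= I} -> (size s <= d)%N).

(* Eisenbud, Commutative Algebra, Section 18.2: a (Noetherian) ring is
   Cohen-Macaulay if depth(P, A) = codim P for every maximal ideal P. *)
Definition cohen_macaulay : Prop :=
  noetherian /\
  forall P, maximal_ideal P -> exists2 d, has_height P d & has_depth P d.

Definition idealr_of I (hI : idealr_closed I) : idealr A :=
  HB.pack (I : A -> bool) (isIdealr.Build A I hI).

Definition quotient_ring I (hI : idealr_closed I) : comNzRingType :=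
  {ideal_quot (idealr_of hI)}.

Lemma ideal_gen_proper (S : A -> Prop) (B : nzRingType) (f : {rmorphism A -> B}) :
  (forall a, S a -> f a = 0) -> idealr_closed (ideal_gen S).
Proof.
move=> fS; split.
- by apply/asboolP; exists [::] => //; rewrite big_nil.
- apply/negP => /asboolP [cs hcs /(congr1 f)].
  rewrite rmorph1 rmorph_sum big_seq big1 => [/eqP|t /hcs/fS ft].
    by rewrite oner_eq0.
  by rewrite rmorphM ft mulr0.
- move=> a u v /asboolP [cu hu ->] /asboolP [cv hv ->].
  apply/asboolP; exists ([seq (a * t.1, t.2) | t <- cu] ++ cv).
    move=> t; rewrite mem_cat => /orP[/mapP[t1 ht ->]|]; last exact: hv.
    exact: (hu _ ht).
  rewrite big_cat big_map mulr_sumr; congr (_ + _).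
  by apply: eq_bigr => t _; rewrite mulrA.
Qed.

End CohenMacaulay.

Section Ideals.
Variables (K : fieldType) (n : nat).
Local Notation R := {mpoly K[n]}.

Definition P_ideal (F : {set 'I_n}) : {pred R} :=
  ideal_gen (fun p => exists i j, [/\ i \in F, j \in F & p = 'X_i - 'X_j]).

Definition I_ideal (k : nat) : {pred R} :=
  [pred p | [forall F : {set 'I_n}, (#|F| == k) ==> (p \in P_ideal F)]].

Local Notation ev0 := (meval (fun=> 0 : K) : R -> K).

Lemma P_ideal_proper F : idealr_closed (P_ideal F).
Proof.
apply: (ideal_gen_proper (f := ev0)) => p [i [j [_ _ ->]]].
by rewrite rmorphB /= !mevalXU subrr.
Qed.

Lemma I_ideal_proper k : (2 <= k <= n)%N -> idealr_closed (I_ideal k).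
Proof.
case/andP=> _ kn; split.
- by apply/forallP => F; apply/implyP => _; case: (P_ideal_proper F).
- have: (0 < #|[set F : {set 'I_n} | #|F| == k]|)%N.
    by rewrite card_draws card_ord bin_gt0.
  case/card_gt0P => F; rewrite inE => hF.
  apply/negP => /forallP/(_ F); rewrite hF /=.
  by case: (P_ideal_proper F) => _ /negP.
- move=> a u v /forallP hu /forallP hv; apply/forallP => F; apply/implyP => hF.
  case: (P_ideal_proper F) => _ _ cl.
  by apply: cl; [exact: (implyP (hu F))|exact: (implyP (hv F))].
Qed.

(* The boxes of the Young diagram of [la], listed as row lengths, with rows and
   columns numbered from 0.  A tableau [T] sends an entry to its box; a bijective
   one exists only if the row lengths add up to [n]. *)
Definition box (la : seq nat) : finType :=
  {i : 'I_(size la) & 'I_(nth 0%N la i)}.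
Definition row_of la (b : box la) : nat := tag b.
Definition col_of la (b : box la) : nat := tagged b.

Definition specht_col la (T : 'I_n -> box la) (j : nat) : R :=
  \prod_(a < n | col_of (T a) == j)
    \prod_(b < n | (col_of (T b) == j) && (row_of (T a) < row_of (T b))%N)
      ('X_a - 'X_b).

Definition specht_poly la (T : 'I_n -> box la) : R :=
  \prod_(j < nth 0%N la 0) specht_col T j.

Definition specht_ideal (la : seq nat) : {pred R} :=
  ideal_gen (fun p => exists2 T : 'I_n -> box la, bijective T & p = specht_poly T).

Lemma specht_ideal_proper la :
  (0 < nth 0 la 0)%N -> (0 < nth 0 la 1)%N -> idealr_closed (specht_ideal la).
Proof.
move=> la0 la1.
have s1 : (1 < size la)%N by case: (leqP (size la) 1) la1 => // h; rewrite nth_default.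
have s0 : (0 < size la)%N by exact: ltnW.
apply: (ideal_gen_proper (f := ev0)) => _ [T [T' _ T'K] ->].
pose b0 : box la := @Tagged _ (Ordinal s0) (fun i => 'I_(nth 0%N la i)) (Ordinal la0).
pose b1 : box la := @Tagged _ (Ordinal s1) (fun i => 'I_(nth 0%N la i)) (Ordinal la1).
rewrite /specht_poly (bigD1 (Ordinal la0)) //= /specht_col.
rewrite (bigD1 (T' b0)) /= ?T'K // (bigD1 (T' b1)) /= ?T'K //.
by rewrite !rmorphM rmorphB /= !mevalXU subrr !mul0r.
Qed.

End Ideals.

Arguments I_ideal : clear implicits.
Arguments specht_ideal : clear implicits.

Lemma I_sub2_proper (K : fieldType) (n : nat) :
  (5 <= n)%N -> idealr_closed (I_ideal K n (n - 2)).
Proof.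
move=> n5; apply: I_ideal_proper; rewrite leq_subr andbT.
by rewrite leq_subRL ?(leq_trans _ n5).
Qed.

Lemma specht_sub3_3_proper (K : fieldType) (n : nat) :
  (6 <= n)%N -> idealr_closed (specht_ideal K n [:: (n - 3)%N; 3%N]).
Proof. by move=> n6; apply: specht_ideal_proper => //=; rewrite subn_gt0 (leq_trans _ n6). Qed.

Lemma specht_221_proper (K : fieldType) :
  idealr_closed (specht_ideal K 5 [:: 2%N; 2%N; 1%N]).
Proof. exact: specht_ideal_proper. Qed.

Arguments I_sub2_proper : clear implicits.
Arguments specht_sub3_3_proper : clear implicits.

(* Main.v *)
From HB Require Import structures.
Require Import Defs.
From mathcomp Require Import all_boot all_algebra ring_quotient polyXY.
From mathcomp Require Import boolp.
From mathcomp Require Import mpoly ring zify.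

(** The zero set of [I_ideal K n (n - 2)] is the union of the three-dimensional
    linear spaces V_ij of the points whose coordinates other than x_i and x_j are
    all equal.  The coordinate ring A therefore embeds into the product over the
    pairs {i, j} of the polynomial rings in z = x_o, alpha and beta, where
    (alpha, beta) are the differences of x_i and x_j with the common value t of
    the other coordinates.

    Every maximal ideal of A has height 3: it is an algebraic point of some V_ij
    ([maximal_point]), the three coordinates there give a chain of primes
    ([point_chain]), and since any four elements of A are algebraically dependent
    ([algebraic_dependence]) neither chains of primes nor regular sequences can be
    longer ([no_chain4]).  So A is Cohen-Macaulay if and only if every maximal
    ideal contains a regular sequence of length 3.

    If 2 is invertible, the elements of A are exactly the polynomials in z whose
    coefficients are compatible families ([compat_realized]): polynomials
    f_ij(alpha, beta) that agree on the axes where the V_ij meet and whose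
    derivative along (1, ..., 1) vanishes there.  These conditions are inherited by
    exact quotients ([compat_div]), so that to be a regular sequence can be tested
    on each V_ij.  Suitable symmetric polynomials in (alpha, beta) together
    with a monic polynomial in z do it ([regular_sequence_at_point]).

    If 2 = 0, the function s = t^2 on the union of the V_ij multiplies the ideal of
    the diagonal into A, because x y + x z + y z = t^2 + 2 t u as soon as two of
    x, y, z are equal to t and the third is u ([square_mul_gen]).  But s does not
    belong to A: the sum of all second-order Taylor coefficients, which is the
    second derivative along (1, ..., 1), vanishes on A and not on s.  From a regular
    sequence of length 3 at the origin one would recover s as an element of A
    ([regular_triple_false]).

    The two Specht ideals are equal to the ideals I_{n,n-2}.  Their generators
    vanish on each V_ij because some column of a tableau has two entries outside
    {i, j}.  Conversely a member of I is pushed down a filtration of the maximal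
    ideal of the diagonal: at each step the generators of one layer are separated by
    substitutions onto the spaces V_ij, where the member of I vanishes, so that its
    coefficients on that layer are zero ([span_mod_step], [I_sub_of_exchange]). *)

Set Implicit Arguments.
Unset Strict Implicit.
Unset Printing Implicit Defensive.
Import GRing.Theory.
Local Open Scope ring_scope.

(** * Ideals and substitutions *)

Lemma exists_fresh (m n : nat) (s : seq 'I_n) : (m < n)%N -> (size s <= m)%N ->
  exists x, x \notin s.
Proof.
move=> mn sm; apply/existsP; apply: contraT => /existsPn sall.
have : (n <= size s)%N; last by rewrite leqNgt (leq_ltn_trans sm).
rewrite -[n in (n <= _)%N]size_enum_ord; apply: uniq_leq_size; first exact: enum_uniq.
by move=> x _; have := sall x; rewrite negbK.
Qed.

(** Closes goals saying that indices are pairwise distinct, from hypotheses of the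
    same kind, up to the symmetry of [!=]. *)
Ltac distinct :=
  repeat match goal with
  | H : is_true (uniq _) |- _ => move: H; rewrite /= ?inE ?negb_or => H
  | H : is_true (_ \notin _) |- _ => move: H; rewrite ?inE ?negb_or => H
  | H : is_true (_ && _) |- _ =>
      let H1 := fresh in let H2 := fresh in case/andP: H => H1 H2
  end;
  rewrite /= ?inE ?negb_or; repeat (apply/andP; split);
  solve [done | assumption | rewrite eq_sym; assumption].

Section IdealBasics.
Variable A : comNzRingType.
Implicit Types (J H : {pred A}) (S : A -> Prop).

(** In contrast with [idealr_closed], the unit ideal is included. *)
Definition is_ideal J : Prop :=
  [/\ 0 \in J, forall u v, u \in J -> v \in J -> u + v \in J
    & forall a u, u \in J -> a * u \in J].

Lemma is_ideal_closed J : idealr_closed J -> is_ideal J.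
Proof.
case=> J0 _ Jl; split=> // [u v uJ vJ|a u uJ].
  by rewrite -[u]mul1r; apply: Jl.
by rewrite -[_ * _]addr0; apply: Jl.
Qed.

Lemma ideal_closed_of J : is_ideal J -> 1 \notin J -> idealr_closed J.
Proof. by case=> J0 JD JM J1; split=> // a u v uJ vJ; apply: JD => //; apply: JM. Qed.

Section IdealTheory.
Variables (J : {pred A}) (idJ : is_ideal J).

Lemma ideal0 : 0 \in J. Proof. by case: idJ. Qed.
Lemma idealD u v : u \in J -> v \in J -> u + v \in J. Proof. by case: idJ => _ + _; apply. Qed.
Lemma idealM a u : u \in J -> a * u \in J. Proof. by case: idJ => _ _; apply. Qed.
Lemma idealN u : u \in J -> - u \in J. Proof. by rewrite -mulN1r; apply: idealM. Qed.
Lemma idealB u v : u \in J -> v \in J -> u - v \in J.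
Proof. by move=> uJ /idealN; apply: idealD. Qed.
Lemma ideal_sum (T : Type) (r : seq T) (P : pred T) (F : T -> A) :
  (forall i, P i -> F i \in J) -> \sum_(i <- r | P i) F i \in J.
Proof. by move=> FJ; elim/big_ind: _ => //; [exact: ideal0|exact: idealD]. Qed.
End IdealTheory.

Lemma ideal_gen_in S a : S a -> a \in ideal_gen S.
Proof.
move=> Sa; apply/asboolP; exists [:: (1, a)]; last by rewrite big_seq1 mul1r.
by move=> t; rewrite inE => /eqP ->.
Qed.

Lemma ideal_gen_sub S J :
  is_ideal J -> (forall a, S a -> a \in J) -> {subset ideal_gen S <= J}.
Proof.
move=> idJ SJ p /asboolP[cs csS ->]; rewrite big_seq; apply: ideal_sum => // t.
by move/csS/SJ; apply: idealM.
Qed.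

Lemma ideal_gen_ideal S : is_ideal (ideal_gen S).
Proof.
split; first by apply/asboolP; exists [::] => //; rewrite big_nil.
  move=> u v /asboolP[cu Su ->] /asboolP[cv Sv ->]; apply/asboolP.
  exists (cu ++ cv); last by rewrite big_cat.
  by move=> t; rewrite mem_cat => /orP[/Su|/Sv].
move=> a u /asboolP[cu Su ->]; apply/asboolP.
exists [seq (a * t.1, t.2) | t <- cu].
  by move=> t /mapP[t' t'cu ->]; apply: (Su t').
by rewrite big_map mulr_sumr; apply: eq_bigr => t _; rewrite mulrA.
Qed.

Lemma is_ideal0 : is_ideal (pred1 (0 : A)).
Proof.
split=> [|u v|a u]; rewrite ?inE //; first by move=> /eqP-> /eqP->; rewrite addr0.
by move=> /eqP->; rewrite mulr0.
Qed.

Lemma span_ideal_ideal (s : seq A) : is_ideal (span_ideal s).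
Proof. exact: ideal_gen_ideal. Qed.

Lemma span_ideal_in (a : A) s : a \in s -> a \in span_ideal s.
Proof. by move=> a_s; apply: (ideal_gen_in (S := fun b => b \in s)). Qed.

Lemma span_ideal_nil (x : A) : (x \in span_ideal [::]) = (x == 0).
Proof.
apply/idP/eqP => [|->]; last exact: (ideal0 (span_ideal_ideal _)).
by move/(ideal_gen_sub is_ideal0) => H; apply/eqP/H => a; rewrite in_nil.
Qed.

Lemma span_idealP J (s : seq A) : is_ideal J ->
  (forall a, a \in s -> a \in J) -> {subset span_ideal s <= J}.
Proof. by move=> idJ; apply: ideal_gen_sub. Qed.

Lemma span_ideal_cons (a : A) s x :
  x \in span_ideal (a :: s) <-> exists p, x - p * a \in span_ideal s.
Proof.
have idS := span_ideal_ideal s; have idS' := span_ideal_ideal (a :: s).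
split=> [/asboolP[cs csS ->]|[p xp]].
  elim: cs csS => [|t cs IH] csS.
    by exists 0; rewrite big_nil mul0r subrr ideal0.
  have [|p IHp] := IH; first by move=> u ucs; apply: csS; rewrite inE ucs orbT.
  have: t.2 \in a :: s by apply: csS; rewrite inE eqxx.
  rewrite inE big_cons => /orP[/eqP ->|ts].
    by exists (t.1 + p); rewrite mulrDl opprD addrACA subrr add0r.
  exists p; rewrite -addrA; apply: idealD => //; apply: idealM => //.
  exact: span_ideal_in.
rewrite -(subrK (p * a) x) addrC; apply: idealD => //.
  by apply: idealM => //; apply: span_ideal_in; rewrite inE eqxx.
by apply: span_idealP xp => // b bs; apply: span_ideal_in; rewrite inE bs orbT.
Qed.

Lemma span_ideal1 (a x : A) : x \in span_ideal [:: a] <-> exists p, x = p * a.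
Proof.
rewrite span_ideal_cons; split=> -[p]; first by rewrite span_ideal_nil subr_eq0 => /eqP; exists p.
by move=> ->; exists p; rewrite subrr (ideal0 (span_ideal_ideal _)).
Qed.

Lemma span_ideal2 (a b x : A) :
  x \in span_ideal [:: a; b] <-> exists p q, x = p * a + q * b.
Proof.
rewrite span_ideal_cons; split=> [[p /span_ideal1[q xE]]|[p [q ->]]].
  by exists p, q; rewrite -xE addrC subrK.
by exists p; apply/span_ideal1; exists q; rewrite addrC addKr.
Qed.

End IdealBasics.

Section Substitution.
Variables (K : fieldType) (n : nat).
Local Notation R := {mpoly K[n]}.

Lemma mpoly_alg_ind (Q : R -> Prop) :
  (forall c, Q c%:MP) -> (forall i, Q 'X_i) ->
  (forall p q, Q p -> Q q -> Q (p + q)) -> (forall p q, Q p -> Q q -> Q (p * q)) ->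
  forall p, Q p.
Proof.
move=> QC QX QD QM; have Q0 : Q 0 by rewrite -mpolyC0.
have Qm m : Q 'X_[m].
  rewrite mpolyXE_id; elim/big_ind: _ => //; first by rewrite -mpolyC1.
  move=> i _; elim: (m i) => [|k IH]; first by rewrite expr0 -mpolyC1.
  by rewrite exprS; apply: QM.
elim/mpolyind => // c m p _ _ Qp; apply: QD => //.
by rewrite -mul_mpolyC; apply: QM.
Qed.

Lemma mpoly_rmorph_eq (S : nzRingType) (f g : {rmorphism R -> S}) :
  (forall c, f c%:MP = g c%:MP) -> (forall i, f 'X_i = g 'X_i) -> f =1 g.
Proof.
move=> fgC fgX; elim/mpoly_alg_ind => // p q fp fq.
  by rewrite !rmorphD fp fq.
by rewrite !rmorphM fp fq.
Qed.

Section Points.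
Variables (S : comNzRingType) (f : {rmorphism K -> S}).

Lemma mmapXU (v : 'I_n -> S) i : mmap f v 'X_i = v i.
Proof. by rewrite mmapX mmap1U. Qed.

(** The polynomials with equal values at v and w after multiplication by g modulo H
    form a subring.  With the factor g this simplifies the coefficient of a
    generator g by means of the relations satisfied by g alone. *)
Lemma mmap_subst (v w : 'I_n -> S) (H : {pred S}) g : is_ideal H ->
  (forall i, (v i - w i) * g \in H) ->
  forall p, (mmap f v p - mmap f w p) * g \in H.
Proof.
move=> idH vwH; elim/mpoly_alg_ind => [c|i|p q pH qH|p q pH qH].
- by rewrite !mmapC subrr mul0r ideal0.
- by rewrite !mmapXU.
- by rewrite !rmorphD /= opprD addrACA mulrDl idealD.
rewrite !rmorphM /=.
set a := mmap f v p in pH *; set b := mmap f v q in qH *.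
set c := mmap f w p in pH *; set d := mmap f w q in qH *.
rewrite (_ : _ * g = a * ((b - d) * g) + d * ((a - c) * g)); last by ring.
by apply: idealD => //; apply: idealM.
Qed.

End Points.

Lemma mmap_id p : mmap (@mpolyC n K) (fun i => 'X_i) p = p.
Proof.
move: p; apply: (@mpoly_rmorph_eq R (mmap (@mpolyC n K) (fun i => 'X_i)) idfun) => [c|i].
  by rewrite /= mmapC.
by rewrite /= mmapXU.
Qed.

(** The generic point of the space V_ij, written in the coordinates x_i, x_j, x_l. *)
Definition piece_pt (i j l : 'I_n) (k : 'I_n) : R :=
  if (k == i) || (k == j) then 'X_k else 'X_l.
Definition piece_sub i j l : R -> R := mmap (@mpolyC n K) (piece_pt i j l).
HB.instance Definition _ i j l := GRing.RMorphism.copy (piece_sub i j l) (mmap (@mpolyC n K) (piece_pt i j l)).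

Definition const_off (T : Type) (v : 'I_n -> T) i j :=
  forall k l, k != i -> k != j -> l != i -> l != j -> v k = v l.

Lemma I_ideal_eval (S : comNzRingType) (f : {rmorphism K -> S}) (v : 'I_n -> S) i j p :
  i != j -> const_off v i j -> p \in I_ideal K n (n - 2) -> mmap f v p = 0.
Proof.
move=> ij vij /forallP /(_ (~: [set i; j])); rewrite cardsCs setCK cards2 ij card_ord eqxx /=.
pose J : {pred R} := [pred q | mmap f v q == 0].
have JE q : (q \in J) = (mmap f v q == 0) by [].
have idJ : is_ideal J.
  split=> [|a b|a b]; rewrite !JE ?rmorph0 //.
    by rewrite rmorphD /= => /eqP-> /eqP->; rewrite addr0.
  by rewrite rmorphM /= => /eqP->; rewrite mulr0.
move=> pP; apply/eqP; move: p pP; apply: ideal_gen_sub => // _ [k [l [kF lF ->]]].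
rewrite JE rmorphB /= !mmapXU subr_eq0; apply/eqP.
by move: kF lF; rewrite !inE !negb_or => /andP[? ?] /andP[? ?]; apply: vij.
Qed.

(** A polynomial differs from its substitution at [piece_pt i j l] by an element of
    the prime ideal P_F, where F is the complement of {i, j}. *)
Lemma I_idealP p : (2 < n)%N ->
  (forall i j l, i != j -> l != i -> l != j -> piece_sub i j l p = 0) ->
  p \in I_ideal K n (n - 2).
Proof.
move=> n2 p0; apply/forallP => F; apply/implyP => /eqP cF.
have cF2 : #|~: F| == 2.
  by rewrite cardsCs setCK card_ord cF subKn // ltnW.
have /card_gt0P[l lF] : (0 < #|F|)%N by rewrite cF subn_gt0.
case/cards2P: cF2 => i [j [ij FE]].
have inF k : (k \in F) = (k != i) && (k != j).
  by rewrite -[F]setCK FE !inE negb_or.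
have := lF; rewrite inF => /andP[li lj].
have idP := ideal_gen_ideal (fun p : R => exists i j, [/\ i \in F, j \in F & p = 'X_i - 'X_j]).
have := @mmap_subst R (@mpolyC n K) (fun i => 'X_i) (piece_pt i j l) (P_ideal (K:=K) F) 1 idP.
move/(_ _ p); rewrite mmap_id mulr1 [mmap _ _ _]p0 // subr0; apply => k.
rewrite mulr1 /piece_pt; case: ifPn => [_|kij]; first by rewrite subrr ideal0.
by apply: ideal_gen_in; exists k, l; rewrite !inF li lj -negb_or.
Qed.

Lemma piece_pt_const i j l : const_off (piece_pt i j l) i j.
Proof. by move=> a b ai aj bi bj; rewrite /piece_pt !ifN // negb_or ?ai ?bi. Qed.

End Substitution.

(** * Hilbert's basis theorem *)

(** Unlike [noetherian] this includes the unit ideal, so that it passes to images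
    without a discussion of properness. *)
Definition all_fin_gen (A : comNzRingType) : Prop :=
  forall J : {pred A}, is_ideal J -> exists s, J =i span_ideal s.

Lemma span_ideal_sub (A : comNzRingType) (s t : seq A) :
  {subset s <= t} -> {subset span_ideal s <= span_ideal t}.
Proof.
move=> st; apply: span_idealP; first exact: span_ideal_ideal.
by move=> a /st; apply: span_ideal_in.
Qed.

Lemma fin_gen_field (K : fieldType) : all_fin_gen K.
Proof.
move=> J idJ; case: (pselect (exists2 x, x \in J & x != 0)) => [[x xJ x0]|J0].
  exists [:: x] => y; apply/idP/idP => [_|]; last by apply: span_idealP => // a; rewrite inE => /eqP->.
  by apply/span_ideal1; exists (y / x); rewrite divfK.
exists [::] => y; rewrite span_ideal_nil; apply/idP/eqP => [yJ|->]; last exact: ideal0.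
by apply/eqP; apply: contrapT => /negP y0; apply: J0; exists y.
Qed.

Lemma fin_gen_surj (A B : comNzRingType) (f : {rmorphism A -> B}) :
  (forall y, exists x, f x = y) -> all_fin_gen A -> all_fin_gen B.
Proof.
move=> fsurj noeA J idJ.
pose fJ : {pred A} := [pred x | f x \in J].
have fJE x : (x \in fJ) = (f x \in J) by [].
have [|s sJ] := noeA fJ.
  split=> [|u v|a u]; rewrite !fJE ?rmorph0 ?rmorphD ?rmorphM; first exact: ideal0.
    exact: idealD.
  exact: idealM.
have idS := span_ideal_ideal (map f s).
exists (map f s) => y; apply/idP/idP => [yJ|].
  have [x xy] := fsurj y; rewrite -{}xy in yJ *.
  move: yJ; rewrite -fJE sJ.
  pose T : {pred A} := [pred x | f x \in span_ideal (map f s)].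
  have TE z : (z \in T) = (f z \in span_ideal (map f s)) by [].
  rewrite -TE; apply: span_idealP => [|a a_s].
    split=> [|u v|a u]; rewrite !TE ?rmorph0 ?rmorphD ?rmorphM; first exact: ideal0.
      exact: idealD.
    exact: idealM.
  by rewrite TE; apply: span_ideal_in; apply: map_f.
apply: span_idealP => // _ /mapP[x xs ->]; rewrite -fJE sJ; exact: span_ideal_in.
Qed.

Section HilbertBasis.
Variable A : comNzRingType.
Hypothesis noeA : all_fin_gen A.

(** The members of J of degree at most d have their coefficients of degree d in an
    ideal which grows with d. *)
Definition top_coef (J : {pred {poly A}}) (d : nat) (a : A) : Prop :=
  exists p, [/\ p \in J, (size p <= d.+1)%N & p`_d = a].

Lemma top_coef_lift (J : {pred {poly A}}) (d : nat) (t : seq {poly A}) a :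
  (forall p, p \in t -> (size p <= d.+1)%N) ->
  a \in span_ideal [seq (p : {poly A})`_d | p <- t] ->
  exists q : {poly A}, [/\ q \in span_ideal t, (size q <= d.+1)%N & q`_d = a].
Proof.
elim: t a => [|p t IH] a szt /=.
  rewrite span_ideal_nil => /eqP->; exists 0; rewrite size_poly0 coef0; split=> //.
  exact: (ideal0 (span_ideal_ideal _)).
move/span_ideal_cons=> [c /IH[|q [qt szq qa]]].
  by move=> u ut; apply: szt; rewrite inE ut orbT.
exists (c *: p + q); split.
- apply/span_ideal_cons; exists c%:P; rewrite mul_polyC addrC addKr //.
- rewrite (leq_trans (size_polyD _ _)) // geq_max szq andbT.
  by rewrite (leq_trans (size_scale_leq _ _)) // szt // inE eqxx.
by rewrite coefD coefZ qa addrC subrK.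
Qed.

Lemma top_coef_gen (J : {pred {poly A}}) (s : seq A) :
  is_ideal J ->
  (forall a, a \in s -> exists d, top_coef J d a) ->
  exists d (t : seq {poly A}), [/\ forall p, p \in t -> p \in J,
     forall p, p \in t -> (size p <= d.+1)%N & s = [seq (p : {poly A})`_d | p <- t]].
Proof.
move=> idJ; elim: s => [|a s IH] sJ; first by exists 0%N, [::].
have [|d [t [tJ szt sE]]] := IH; first by move=> b bs; apply: sJ; rewrite inE bs orbT.
have [|e [p [pJ szp pa]]] := sJ a; first by rewrite inE eqxx.
have szX (q : {poly A}) k l : (size q <= k.+1 -> size ('X^l * q)%R <= (k + l).+1)%N.
  move=> szq; apply: (leq_trans (size_polyMleq _ _)); rewrite size_polyXn addSn /=.
  by rewrite addnC -addSn leq_add2r.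
exists (d + e)%N, ('X^d * p :: [seq 'X^e * q | q <- t]); split.
- move=> q; rewrite inE => /orP[/eqP->|/mapP[r rt ->]]; apply: idealM => //.
  exact: tJ.
- move=> q; rewrite inE => /orP[/eqP->|/mapP[r rt ->]].
    by rewrite addnC; apply: szX.
  by apply: szX; apply: szt.
rewrite /= coefXnM ltnNge leq_addr /= addKn pa sE -map_comp; congr (_ :: _).
by apply: eq_map => q /=; rewrite coefXnM ltnNge leq_addl /= addnK.
Qed.

Lemma top_coef_ideal J d : is_ideal J -> is_ideal [pred a | `[< top_coef J d a >]].
Proof.
move=> idJ; split=> [|u v /asboolP[p [pJ szp <-]] /asboolP[q [qJ szq <-]]|c u /asboolP[p [pJ szp <-]]].
- by apply/asboolP; exists 0; rewrite ideal0 // size_poly0 coef0.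
- apply/asboolP; exists (p + q); rewrite idealD // coefD; split=> //.
  by rewrite (leq_trans (size_polyD _ _)) // geq_max szp.
apply/asboolP; exists (c *: p); rewrite -mul_polyC idealM // mul_polyC coefZ; split=> //.
by rewrite (leq_trans (size_scale_leq _ _)).
Qed.

Lemma top_coef_leq J d e a : is_ideal J -> (d <= e)%N -> top_coef J d a -> top_coef J e a.
Proof.
move=> idJ de [p [pJ szp pa]]; exists ('X^(e - d) * p); split; first exact: idealM.
  apply: (leq_trans (size_polyMleq _ _)); rewrite size_polyXn addSn /=.
  by rewrite -[in leqRHS](subnK de) -addnS leq_add2l.
by rewrite coefXnM ltnNge leq_subr /= subKn.
Qed.

(** The union of the ideals of top coefficients is generated by the top coefficients
    of finitely many members t of J, brought to a common degree D.  Adding, for each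
    degree below D, generators of the ideal of top coefficients of that degree, one
    can cancel the leading term of every member of J. *)
Lemma fin_gen_poly : all_fin_gen {poly A}.
Proof.
move=> J idJ.
pose L : {pred A} := [pred a | `[< exists d, top_coef J d a >]].
have idL : is_ideal L.
  split=> [|u v /asboolP[d ud] /asboolP[e ve]|c u /asboolP[d ud]]; apply/asboolP.
  - by exists 0%N, 0; rewrite ideal0 // size_poly0 coef0.
  - exists (d + e)%N; have [_ h _] := top_coef_ideal (d + e) idJ.
    apply/asboolP/h; apply/asboolP.
      exact: top_coef_leq (leq_addr _ _) ud.
    exact: top_coef_leq (leq_addl _ _) ve.
  by exists d; have [_ _ h] := top_coef_ideal d idJ; apply/asboolP/h/asboolP.
have [s sL] := noeA idL.
have [|D [t [tJ szt sE]]] := @top_coef_gen J s idJ.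
  by move=> a a_s; apply/asboolP; rewrite -[`[< _ >]]/(a \in L) sL; apply: span_ideal_in.
have low m : exists2 G : seq {poly A}, (forall p, p \in G -> p \in J) &
    forall d a, (d < m)%N -> top_coef J d a ->
      exists q, [/\ q \in span_ideal G, (size q <= d.+1)%N & q`_d = a].
  elim: m => [|m [G GJ Gm]]; first by exists [::].
  have [sm smL] := noeA (top_coef_ideal m idJ).
  have tm : exists tm : seq {poly A}, [/\ forall p, p \in tm -> p \in J,
     forall p, p \in tm -> (size p <= m.+1)%N & sm = [seq (p : {poly A})`_m | p <- tm]].
    have: forall a, a \in sm -> top_coef J m a.
      move=> a a_s; apply/asboolP; rewrite -[`[< _ >]]/(a \in [pred a | `[< top_coef J m a >]]).
      by rewrite smL; apply: span_ideal_in.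
    elim: sm {smL} => [|a sm IH] smJ; first by exists [::].
    have [|tm [tmJ sztm smE]] := IH; first by move=> b bs; apply: smJ; rewrite inE bs orbT.
    have [|p [pJ szp pa]] := smJ a; first by rewrite inE eqxx.
    exists (p :: tm); split=> [q|q|]; rewrite ?inE.
    - by case/orP => [/eqP->//|/tmJ].
    - by case/orP => [/eqP->//|/sztm].
    by rewrite /= pa smE.
  have {tm} [tm [tmJ sztm smE]] := tm.
  exists (tm ++ G) => [p|d a]; first by rewrite mem_cat => /orP[/tmJ|/GJ].
  have sG q : q \in span_ideal G -> q \in span_ideal (tm ++ G).
    by apply: span_ideal_sub => r rG; rewrite mem_cat rG orbT.
  have stm q : q \in span_ideal tm -> q \in span_ideal (tm ++ G).
    by apply: span_ideal_sub => r rG; rewrite mem_cat rG.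
  rewrite ltnS leq_eqVlt => /orP[/eqP->|dm] da; last first.
    by have [q [qG szq qa]] := Gm _ _ dm da; exists q; split=> //; apply: sG.
  have: a \in span_ideal [seq (p : {poly A})`_m | p <- tm].
    by rewrite -smE -smL; apply/asboolP.
  move/(top_coef_lift J sztm) => [q [qt szq qa]]; exists q; split=> //; exact: stm.
have [G GJ Glow] := low D.
exists (t ++ G) => p; have idS := span_ideal_ideal (t ++ G).
apply/idP/idP; last first.
  by apply: span_idealP => // q; rewrite mem_cat => /orP[/tJ|/GJ].
have [m] := ubnP (size p); elim: m p => // m IH p; rewrite ltnS => szp pJ.
have [sz0|sz_gt0] := posnP (size p).
  by move/eqP: sz0; rewrite size_poly_eq0 => /eqP->; apply: ideal0.
pose d := (size p).-1; have dE : size p = d.+1 by rewrite prednK.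
suff [q [qS szq qd]] : exists q, [/\ q \in span_ideal (t ++ G), (size q <= d.+1)%N & q`_d = p`_d].
  rewrite -(subrK q p) idealD // IH //.
    apply: leq_trans szp; rewrite dE ltnS; apply/leq_sizeP => k.
    rewrite leq_eqVlt coefB => /orP[/eqP<-|dk]; first by rewrite qd subrr.
    by rewrite !nth_default ?subr0 // ?dE // (leq_trans szq).
  apply: idealB => //; move: q qS {szq qd}; apply: span_idealP => // q.
  by rewrite mem_cat => /orP[/tJ|/GJ].
have pd : top_coef J d p`_d by exists p; rewrite dE.
have [dD|Dd] := ltnP d D.
  have [q [qG szq qd]] := Glow _ _ dD pd; exists q; split=> //.
  by move: q qG {szq qd}; apply: span_ideal_sub => r rG; rewrite mem_cat rG orbT.
have : p`_d \in L by apply/asboolP; exists d.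
rewrite sL sE => /(top_coef_lift J szt)[q [qt szq qd]].
exists ('X^(d - D) * q); split.
- apply: idealM => //; move: q qt {szq qd}; apply: span_ideal_sub => r rG.
  by rewrite mem_cat rG.
- apply: (leq_trans (size_polyMleq _ _)); rewrite size_polyXn addSn /=.
  by rewrite -[in leqRHS](subnK Dd) -addnS leq_add2l.
by rewrite coefXnM ltnNge leq_subr /= subKn.
Qed.

End HilbertBasis.

Lemma fin_gen_mpoly (K : fieldType) n : all_fin_gen {mpoly K[n]}.
Proof.
elim: n => [|n IH].
  apply: (fin_gen_surj (f := @mpolyC 0 K)) (@fin_gen_field K).
  elim/mpoly_alg_ind => [c|[]//|p q [x <-] [y <-]|p q [x <-] [y <-]].
  - by exists c.
  - by exists (x + y); rewrite rmorphD.
  by exists (x * y); rewrite rmorphM.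
pose w := mmap (@mpolyC n.+1 K) (fun i : 'I_n => 'X_(widen_ord (leqnSn n) i)).
pose g := horner_eval ('X_ord_max : {mpoly K[n.+1]}) \o map_poly w.
apply: (fin_gen_surj (f := g)) (fin_gen_poly IH).
elim/mpoly_alg_ind => [c|i|p q [x <-] [y <-]|p q [x <-] [y <-]].
- by exists c%:MP%:P; rewrite /g /= map_polyC /= /horner_eval hornerC mmapC.
- case: (unliftP ord_max i) => [j ->|->]; last first.
    by exists 'X; rewrite /g /= map_polyX /horner_eval hornerX.
  exists ('X_j)%:P; rewrite /g /= map_polyC /= /horner_eval hornerC /w mmapXU.
  by congr 'X__; apply/val_inj; rewrite /= /bump leqNgt ltn_ord.
- by exists (x + y); rewrite rmorphD.
by exists (x * y); rewrite rmorphM.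
Qed.

(** * At most three algebraically independent functions *)

Section Evaluation.
Variables (B A : comNzRingType) (e : {rmorphism B -> A}) (z : A).

Definition poly_at : {poly B} -> A := horner_eval z \o map_poly e.
HB.instance Definition _ := GRing.RMorphism.copy poly_at (horner_eval z \o map_poly e).

Lemma poly_atC c : poly_at c%:P = e c.
Proof. by rewrite /poly_at /= map_polyC /horner_eval hornerC. Qed.

Lemma poly_atX : poly_at 'X = z.
Proof. by rewrite /poly_at /= map_polyX /horner_eval hornerX. Qed.

Lemma poly_atE p : poly_at p = (map_poly e p).[z].
Proof. by []. Qed.

Definition inj_mod (Q : {pred A}) := forall b, e b \in Q -> b = 0.
End Evaluation.

(** A polynomial in z that lies in Q has its constant term in Q', since z does; this
    term is then zero, and z can be cancelled because it is regular modulo Q. *)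
Lemma inj_mod_poly (B A : comNzRingType) (e : {rmorphism B -> A}) (z : A) (Q Q' : {pred A}) :
  is_ideal Q -> is_ideal Q' -> {subset Q <= Q'} -> z \in Q' ->
  (forall a, a * z \in Q -> a \in Q) -> inj_mod e Q' -> inj_mod (poly_at e z) Q.
Proof.
move=> idQ idQ' QQ' zQ' zreg eQ'; elim/poly_ind => // p c IH.
rewrite rmorphD rmorphM /= poly_atX poly_atC => pQ.
have c0 : c = 0.
  apply: eQ'; rewrite -(addKr (poly_at e z p * z) (e c)) addrC.
  by apply: (idealB idQ'); [exact: QQ'|exact: (idealM idQ')].
move: pQ; rewrite c0 rmorph0 addr0 => /zreg/IH ->; by rewrite mul0r addr0.
Qed.

Lemma inj_mod_field (K : fieldType) (A : comNzRingType) (e : {rmorphism K -> A}) (Q : {pred A}) :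
  is_ideal Q -> 1 \notin Q -> inj_mod e Q.
Proof.
move=> idQ /negP Q1 c cQ; apply: contrapT => /eqP c0; apply: Q1.
by rewrite -(rmorph1 e) -(mulVf c0) rmorphM idealM.
Qed.

Section FourVariables.
Variable K : fieldType.
Local Notation K4 := {poly {poly {poly {poly K}}}}.

Lemma poly_at_comp (B A A' : comNzRingType) (g : {rmorphism A -> A'})
    (h : {rmorphism B -> A}) (h' : {rmorphism B -> A'}) (x : A) :
  g \o h =1 h' -> g \o poly_at h x =1 poly_at h' (g x).
Proof.
by move=> gh p; rewrite /= !poly_atE -horner_map -map_poly_comp (eq_map_poly gh).
Qed.

Definition poly4_at (A : comNzRingType) (e : {rmorphism K -> A}) (z : nat -> A) : K4 -> A :=
  poly_at (poly_at (poly_at (poly_at e (z 3%N)) (z 2%N)) (z 1%N)) (z 0%N).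
HB.instance Definition _ A e z := GRing.RMorphism.copy (@poly4_at A e z)
  (poly_at (poly_at (poly_at (poly_at e (z 3%N)) (z 2%N)) (z 1%N)) (z 0%N)).

Lemma poly4_at_comp (A A' : comNzRingType) (e : {rmorphism K -> A}) (g : {rmorphism A -> A'})
    (e' : {rmorphism K -> A'}) (z : nat -> A) :
  g \o e =1 e' -> forall p, g (poly4_at e z p) = poly4_at e' (g \o z) p.
Proof.
by move=> ge; do 4!apply: poly_at_comp.
Qed.

(** There are N^4 monomials with exponents below N in four elements of degree at most
    D, and they lie in the space of polynomials of degree at most 4ND, whose
    dimension is at most (4ND+1)^3.  For large N they are linearly dependent. *)
Lemma algebraic_dependence3 (w : nat -> {mpoly K[3]}) :
  exists2 p : K4, p != 0 & poly4_at (@mpolyC 3 K) w p = 0.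
Proof.
have [D D0 szw] : exists2 D, (0 < D)%N & forall i, (i < 4)%N -> (msize (w i) <= D.+1)%N.
  exists (msize (w 0%N) + msize (w 1%N) + msize (w 2%N) + msize (w 3%N)).+1 => // i.
  by case: i => [|[|[|[|]]]] // _; lia.
(* N > (5D)^3 makes (4ND+1)^3 <= (5ND)^3 smaller than N^4 *)
have [N NE] : exists N, N = ((5 * D) ^ 3).+1 by eexists.
have N0 : (0 < N)%N by rewrite NE.
pose M := (4 * N * D).+1.
pose T : finType := ('I_N * 'I_N * 'I_N * 'I_N)%type.
pose C : finType := ('I_M * 'I_M * 'I_M)%type.
have cTC : (#|C| < #|T|)%N.
  rewrite !card_prod !card_ord.
  apply: (@leq_ltn_trans ((5 * D) ^ 3 * (N * N * N))); last by rewrite -[ltnRHS]mulnC !mulnA NE; nia.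
  have MX : (M <= 5 * D * N)%N.
    have ND0 : (0 < N * D)%N by rewrite muln_gt0 N0 D0.
    by rewrite /M -!mulnA (mulnC D); lia.
  apply: (@leq_trans ((5 * D * N) * (5 * D * N) * (5 * D * N))); first by rewrite !leq_mul.
  by rewrite !expnS expn0; lia.
pose mon (t : T) : {mpoly K[3]} := w 0%N ^+ t.1.1.1 * w 1%N ^+ t.1.1.2 * w 2%N ^+ t.1.2 * w 3%N ^+ t.2.
have szM (p q : {mpoly K[3]}) d e : (msize p <= d.+1 -> msize q <= e.+1 -> msize (p * q) <= (d + e).+1)%N.
  have [->|p0] := eqVneq p 0; first by rewrite mul0r msize0.
  have [->|q0] := eqVneq q 0; first by rewrite mulr0 msize0.
  move=> sp sq; have := leq_add sp sq; rewrite msizeM // addSn addnS.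
  by case: (msize p + msize q)%N => //= m; rewrite ltnS.
have szX (p : {mpoly K[3]}) d k : (msize p <= d.+1 -> msize (p ^+ k) <= (k * d).+1)%N.
  by move=> szp; elim: k => [|k IH]; rewrite ?expr0 ?msize1 // exprS mulSn; apply: szM.
have szmon t : (msize (mon t) <= M)%N.
  have le k : (k < 4)%N -> forall j : 'I_N, (msize (w k ^+ j) <= (N * D).+1)%N.
    move=> k4 j; apply: leq_trans (szX _ D j (szw k k4)) _.
    by rewrite ltnS leq_mul2r ltnW ?orbT.
  apply: (@leq_trans (N * D + N * D + N * D + N * D).+1); last by rewrite /M; lia.
  by do 3!(apply: (szM); last exact: (le)); exact: (le).
pose mm (c : C) : 'X_{1..3} := [multinom nth 0%N [:: (c.1.1 : nat); (c.1.2 : nat); (c.2 : nat)] i | i < 3].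
pose X := \matrix_(t < #|T|, c < #|C|) ((mon (enum_val t))@_(mm (enum_val c))).
have : kermx X != 0.
  rewrite kermx_eq0; apply/negP => /eqP rX; have := rank_leq_col X.
  by rewrite rX leqNgt cTC.
move/rowV0Pn => [v /sub_kermxP vX v0].
have [t0 vt0] : exists t, v 0 t != 0.
  by apply/existsP; move: v0; apply: contraR => /existsPn v0; apply/eqP/rowP => i; rewrite mxE; apply/eqP/negPn/v0.
pose c i j k l : K := if insub i is Some i then if insub j is Some j then
  if insub k is Some k then if insub l is Some l then v 0 (enum_rank ((i, j, k, l) : T)) else 0 else 0 else 0 else 0.
have cE (i j k l : 'I_N) : c i j k l = v 0 (enum_rank ((i, j, k, l) : T)) by rewrite /c !valK.
pose P : K4 := \poly_(i < N) \poly_(j < N) \poly_(k < N) \poly_(l < N) c i j k l.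
exists P.
  apply: contra_neq vt0 => P0.
  rewrite -(enum_valK t0); case: (enum_val t0) => -[[i j] k] l; rewrite -cE.
  by have := congr1 (fun p : K4 => p`_i`_j`_k`_l) P0; rewrite !(coef_poly, ltn_ord, coef0).
have at_poly (B A : comNzRingType) (e : {rmorphism B -> A}) z m (E : nat -> B) :
   poly_at e z (\poly_(i < m) E i) = \sum_(i < m) e (E i) * z ^+ i.
  rewrite poly_def rmorph_sum; apply: eq_bigr => i _.
  by rewrite -mul_polyC rmorphM rmorphXn /= poly_atX poly_atC.
have -> : poly4_at (@mpolyC 3 K) w P = \sum_(t : T) v 0 (enum_rank t) *: mon t.
  rewrite /poly4_at at_poly.
  under eq_bigr => i _ do [rewrite /= at_poly; under eq_bigr => j _ do
    [rewrite /= at_poly; under eq_bigr => k _ do rewrite /= at_poly]].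
  have -> : \sum_(t : T) v 0 (enum_rank t) *: mon t =
      \sum_i \sum_j \sum_k \sum_l v 0 (enum_rank ((i, j, k, l) : T)) *: mon (i, j, k, l).
    by rewrite !pair_bigA; apply: eq_bigr => -[[[i j] k] l].
  apply: eq_bigr => i _; rewrite mulr_suml; apply: eq_bigr => j _; rewrite 2!mulr_suml.
  apply: eq_bigr => k _; rewrite 3!mulr_suml; apply: eq_bigr => l _.
  by rewrite cE -mul_mpolyC /mon /=; ring.
set S := \sum_t _.
apply/mpolyP => m; rewrite mcoeff0.
have szS : (msize S <= M)%N.
  rewrite /S; elim/big_ind: _ => [|p q szp szq|t _]; first by rewrite msize0.
    by rewrite (leq_trans (msizeD_le _ _)) // geq_max szp.
  by rewrite (leq_trans (msizeZ_le _ _)).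
have [mM|Mm] := ltnP (mdeg m) M; last first.
  by apply/memN_msupp_eq0/msize_mdeg_ge; apply: leq_trans Mm.
have lem i : (m i < M)%N.
  by apply: leq_ltn_trans mM; rewrite mdegE (bigD1 i) //= leq_addr.
pose c0 : C := (Ordinal (lem 0), Ordinal (lem 1), Ordinal (lem 2%:R)).
have -> : m = mm c0.
  apply/mnmP => i; rewrite mnmE; case: i => -[|[|[|]]] //= h; congr (m _); exact/val_inj.
have := congr1 (fun u : 'rV_#|C| => u 0 (enum_rank c0)) vX.
rewrite !mxE => <-; rewrite /S raddf_sum /= (reindex_onto enum_val enum_rank) => [|t _]; last by rewrite enum_rankK.
apply: eq_big => [t|t _]; first by rewrite enum_valK eqxx.
by rewrite mcoeffZ mxE enum_valK enum_rankK.
Qed.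

Section UpperBound.
Variables (n : nat) (n3 : (2 < n)%N).
Local Notation R := {mpoly K[n]}.
Local Notation I := (I_ideal K n (n - 2)).

(** The product of the dependence relations over the spaces V_ij. *)
Lemma algebraic_dependence (w : nat -> R) :
  exists2 p : K4, p != 0 & poly4_at (@mpolyC n K) w p \in I.
Proof.
pose v (i j : 'I_n) (k : 'I_n) : {mpoly K[3]} := if k == i then 'X_0 else if k == j then 'X_1 else 'X_(2%:R).
pose s i j := mmap (@mpolyC 3 K) (v i j).
pose F i j : K4 := projT1 (cid2 (algebraic_dependence3 (s i j \o w))).
have [F0 Fs] : (forall i j, F i j != 0) /\ (forall i j, s i j (poly4_at (@mpolyC n K) w (F i j)) = 0).
  split=> i j; rewrite /F; case: cid2 => // p p0 p1 /=.
  apply: etrans (poly4_at_comp (g := s i j) (e' := @mpolyC 3 K) _ _ _) p1 => c.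
  by rewrite /s /= mmapC.
exists (\prod_i \prod_j F i j).
  by apply/prodf_neq0 => i _; apply/prodf_neq0 => j _; exact: F0.
apply: I_idealP => // i j l ij li lj.
pose u (k : 'I_3) : R := nth 0 [:: 'X_i; 'X_j; 'X_l] k.
have sE p : piece_sub i j l p = mmap (@mpolyC n K) u (s i j p).
  move: p; apply: (@mpoly_rmorph_eq _ _ R (piece_sub i j l) (mmap (@mpolyC n K) u \o s i j)) => [c|k].
    by rewrite /= /piece_sub /s !mmapC.
  rewrite /= /piece_sub /s !mmapXU /piece_pt /v; case: eqP => [->|_]; first by rewrite mmapXU.
  by case: eqP => [->|_]; rewrite mmapXU.
have [q ->] : exists q, \prod_i \prod_j F i j = F i j * q.
  by rewrite (bigD1 i) //= (bigD1 j) //= -mulrA; eexists.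
by rewrite (rmorphM (poly4_at _ w) (F i j)) (rmorphM (piece_sub i j l)) /= sE Fs rmorph0 mul0r.
Qed.

(** This bounds at once the length of chains of primes, with z i an element of the
    (i+1)-st prime not in the i-th, and the length of regular sequences. *)
Lemma no_chain4 (Q : nat -> {pred R}) (z : nat -> R) :
  (forall i, (i <= 4)%N -> is_ideal (Q i)) -> {subset I <= Q 0%N} -> 1 \notin Q 4%N ->
  (forall i, (i < 4)%N -> [/\ {subset Q i <= Q i.+1}, z i \in Q i.+1 &
     forall a, a * z i \in Q i -> a \in Q i]) -> False.
Proof.
move=> idQ IQ Q1 Qz; have [p p0 /IQ pQ] := algebraic_dependence z.
move/eqP: p0; apply; move: p pQ; rewrite -/(inj_mod _ _) /poly4_at.
have [s0 m0 r0] := Qz 0%N isT.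
have [s1 m1 r1] := Qz 1%N isT.
have [s2 m2 r2] := Qz 2%N isT.
have [s3 m3 r3] := Qz 3%N isT.
apply: (inj_mod_poly _ _ s0 m0 r0); [exact: idQ|exact: idQ|].
apply: (inj_mod_poly _ _ s1 m1 r1); [exact: idQ|exact: idQ|].
apply: (inj_mod_poly _ _ s2 m2 r2); [exact: idQ|exact: idQ|].
apply: (inj_mod_poly _ _ s3 m3 r3); [exact: idQ|exact: idQ|].
by apply: inj_mod_field => //; apply: idQ.
Qed.
End UpperBound.
End FourVariables.

(** * Residue fields and Zariski's lemma *)

Section ResidueField.
Variables (A : comNzRingType) (P : {pred A}) (hP : idealr_closed P).
Hypothesis maxP : forall J : {pred A}, idealr_closed J -> {subset P <= J} -> {subset J <= P}.
Local Notation Q := (quotient_ring hP).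
Local Notation pi := (\pi_Q%qT : A -> Q).

Lemma pi_eq0 (a : A) : (pi a == 0) = (a \in P).
Proof. by rewrite -(rmorph0 (\pi_Q%qT)) -[RHS]/(a \in (idealr_of hP : {pred A})) -[a in RHS]subr0 Quotient.idealrBE. Qed.

(** Otherwise a and P would generate a proper ideal larger than P. *)
Lemma residue_inverse (q : Q) : q != 0 -> exists r, r * q == 1.
Proof.
rewrite -[q]reprK; set a := repr q; rewrite pi_eq0 => aP.
have idP := is_ideal_closed hP.
pose J : {pred A} := [pred x | `[< exists b, x - b * a \in P >]].
have JP x : reflect (exists b, x - b * a \in P) (x \in J) by apply: asboolP.
have idJ : is_ideal J.
  split=> [|u v /JP[b ub] /JP[c vc]|c u /JP[b ub]]; apply/JP.
  - by exists 0; rewrite mul0r subr0 ideal0.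
  - by exists (b + c); rewrite mulrDl opprD addrACA idealD.
  - by exists (c * b); rewrite -mulrA -mulrBr idealM.
have [/JP[b b1]|J1] := boolP (1 \in J).
  by exists (pi b); rewrite -subr_eq0 -(rmorph1 (\pi_Q%qT)) -rmorphM -rmorphB pi_eq0 -opprB; apply: idealN.
case/negP: aP; apply: (maxP (ideal_closed_of idJ J1)).
  by move=> x xP; apply/JP; exists 0; rewrite mul0r subr0.
by apply/JP; exists 1; rewrite mul1r subrr ideal0.
Qed.

Definition residue_inv (q : Q) : Q :=
  match pselect (exists r, r * q == 1) with left h => xchoose h | right _ => 0 end.

Lemma residue_mulVf (q : Q) : q != 0 -> residue_inv q * q = 1.
Proof.
move=> /residue_inverse q0; rewrite /residue_inv; case: pselect => // h.
exact/eqP/(xchooseP h).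
Qed.

Lemma residue_inv0 : residue_inv 0 = 0.
Proof.
rewrite /residue_inv; case: pselect => // h; have [r] := h; rewrite mulr0 eq_sym.
by rewrite (negbTE (oner_neq0 _)).
Qed.

Definition residue_field : fieldType :=
  HB.pack Q (GRing.ComNzRing_isField.Build Q residue_mulVf residue_inv0).

Lemma residue_fieldP : exists (L : fieldType) (g : {rmorphism A -> L}),
  (forall y, exists x, g x = y) /\ (forall x, (x \in P) = (g x == 0)).
Proof.
exists residue_field, (\pi_Q%qT : {rmorphism A -> Q}); split=> [y|x].
  by exists (repr (y : Q)); exact: (reprK (y : Q)).
exact: (esym (pi_eq0 x)).
Qed.
End ResidueField.

Section Zariski.
Variable L : fieldType.

(** Says that the fraction field of the ring e(E) is obtained by inverting one
    element.  Unlike the property that the values of e form a field, it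
    descends when a generator is removed ([one_inverse_down]). *)
Definition one_inverse (E : comNzRingType) (e : {rmorphism E -> L}) : Prop :=
  exists2 f, e f != 0 & forall y, e y != 0 -> exists k z, e y * e z = e f ^+ k.

Definition algebraic_at (E : comNzRingType) (e : {rmorphism E -> L}) (a : L) : Prop :=
  exists2 p : {poly E}, map_poly e p != 0 & root (map_poly e p) a.

Section Step.
Variables (E : comNzRingType) (e : {rmorphism E -> L}) (a : L).
Hypothesis Ga : one_inverse (poly_at e a).

(** If a were transcendental over e(E), the polynomial 1 + X f would divide a power
    of f; but it is prime to X f. *)
Lemma one_inverse_algebraic : algebraic_at e a.
Proof.
apply: contrapT => nalg.
have inj p : poly_at e a p = 0 -> map_poly e p = 0.
  move=> pa; apply: contrapT => /eqP p0; apply: nalg; exists p => //.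
  by rewrite rootE -poly_atE pa.
have [f fa Gf] := Ga; set F := map_poly e f.
have F0 : F != 0.
  by apply: contra_neq fa => F0; rewrite /= poly_atE -/F F0 horner0.
have yE : map_poly e (1 + 'X * f) = 1 + 'X * F.
  by rewrite rmorphD rmorphM rmorph1 /= map_polyX.
have szy : size (1 + 'X * F) = (size F).+1.
  by rewrite addrC size_polyDl mulrC size_mulX // size_poly1 ltnS size_poly_gt0.
have [|k [z yz]] := Gf (1 + 'X * f).
  by apply/negP => /eqP/inj/(congr1 (fun p : {poly L} => size p)); rewrite yE szy size_poly0.
have {yz} yzF : (1 + 'X * F) * map_poly e z = F ^+ k.
  rewrite -yE -rmorphM -rmorphXn; apply/eqP; rewrite -subr_eq0 -rmorphB; apply/eqP/inj.
  by rewrite rmorphB rmorphM rmorphXn /= yz subrr.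
have dv : 1 + 'X * F %| ('X * F) ^+ k.
  by rewrite exprMn -yzF mulrCA dvdp_mulr.
have cp : coprimep (1 + 'X * F) ('X * F).
  by apply/Bezout_eq1_coprimepP; exists (1, -1) => /=; ring.
have := coprimep_dvdr dv (coprimep_expl k (etrans (coprimep_sym _ _) cp)).
rewrite coprimepp szy eqSS size_poly_eq0; exact/negP.
Qed.

(** A root of Q other than 0 is a root of Q divided by the largest power of X. *)
Lemma lowest_coef (S : L -> Prop) (Q : {poly L}) x : Q != 0 -> root Q x ->
  (forall i, S Q`_i) -> x != 0 ->
  exists c T, [/\ S c, forall i, S (T : {poly L})`_i, c != 0 & c + T.[x] * x = 0].
Proof.
move=> + + + x0; elim/poly_ind: Q => [|Q c IH]; first by rewrite eqxx.
have [-> Q0|c0 _ /rootP] := eqVneq c 0.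
  rewrite addr0 rootM rootX (negbTE x0) orbF => rQ SQ.
  apply: IH => //.
    by apply: contra_neq Q0 => ->; rewrite mul0r addr0.
  by move=> i; have := SQ i.+1; rewrite coefMX.
rewrite !hornerE => QxC SQ; exists c, Q; split=> //.
- by have := SQ 0%N; rewrite coefD coefMX coefC add0r.
- by move=> i; have := SQ i.+1; rewrite coefD coefMX coefC addr0.
by rewrite addrC.
Qed.

Local Notation loc d := (poly_at e (e d)^-1).

Lemma locE d r : e d != 0 -> exists N u, loc d r = e u / e d ^+ N.
Proof.
move=> d0; elim/poly_ind: r => [|r c [N [u IH]]].
  by exists 0%N, 0; rewrite !rmorph0 mul0r.
exists N.+1, (u + c * d ^+ N.+1); rewrite [LHS]rmorphD [in LHS]rmorphM /= poly_atX poly_atC IH.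
by rewrite rmorphD rmorphM rmorphXn mulrDl mulfK ?expf_neq0 // -mulrA -invfM -exprSr.
Qed.

Lemma integral_loc d u x : e d != 0 -> e u != 0 ->
  integralOver (loc d) x -> integralOver (loc (d * u)) x.
Proof.
move=> d0 u0 [p monp px]; pose g := poly_at (@polyC E) (u *: 'X).
exists (map_poly g p); first exact: monic_map.
rewrite -map_poly_comp (@eq_map_poly _ _ _ (loc d)) // => q /=.
apply: etrans (poly_at_comp (g := loc (d * u)) (h' := e) _ _ _) _ => [c /=|].
  by rewrite poly_atC.
rewrite /=; congr (poly_at _ _ _).
by rewrite -mul_polyC [LHS]rmorphM /= poly_atC poly_atX rmorphM invfM mulrCA mulfV ?mulr1.
Qed.

(** After inverting the leading coefficient d of an equation of a, every value at a is
    integral; in particular so is f(a), and 1/f(a) becomes integral after inverting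
    also the numerator u of the lowest nonzero coefficient of an equation of f(a).
    Hence so is the inverse of every nonzero y in e(E); multiplying its integral
    equation by a power of y shows that 1/y is already in e(E)[1/(du)]. *)
Lemma one_inverse_down : one_inverse e.
Proof.
have [p p0 pa] := one_inverse_algebraic; have [f fa Gf] := Ga.
set P := map_poly e p in p0 pa; pose d := p`_(size P).-1.
have dE : e d = lead_coef P by rewrite lead_coefE coef_map.
have d0 : e d != 0 by rewrite dE lead_coef_eq0.
have int_e (x : E) c : integralOver (loc c) (e x).
  by rewrite -[e x](poly_atC e (e c)^-1); exact: (integral_id (loc c) x%:P).
have inta : integralOver (loc d) a.
  apply: (@integral_root_monic _ _ _ _ ((e d)^-1 *: P)).
  - by rewrite monicE lead_coefZ -dE mulVf.
  - by rewrite rootZ // invr_eq0.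
  apply/integral_poly => i; rewrite coefZ coef_map; apply: integral_mul; last exact: int_e.
  by rewrite -[(e d)^-1 in X in integralOver _ X](poly_atX e (e d)^-1); exact: (integral_id (loc d) 'X).
have intE q c : integralOver (loc c) a -> integralOver (loc c) (poly_at e a q).
  move=> inta'; rewrite poly_atE; apply: integral_horner => //.
  by apply/integral_poly => i; rewrite coef_map; apply: int_e.
have [q monq qfa] := intE f d inta.
pose S (x : L) := exists r, x = loc d r.
have [||c [T [[r cE] TS c0 cT]]] := @lowest_coef S _ _ _ qfa _ fa.
- by rewrite monic_neq0 // monic_map.
- by move=> i; exists q`_i; rewrite coef_map.
have [N [u ru]] := locE r d0.
have u0 : e u != 0.
  by apply: contra_neq c0 => u0; rewrite cE ru u0 mul0r.
exists (d * u); first by rewrite rmorphM mulf_neq0.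
have int_c : integralOver (loc (d * u)) c^-1.
  rewrite cE ru invf_div.
  rewrite (_ : _ / _ = loc (d * u) (d ^+ N.+1 *: 'X)); first exact: integral_id.
  rewrite -mul_polyC rmorphM /= poly_atC poly_atX rmorphXn rmorphM invfM exprSr.
  by rewrite mulrA mulfK.
have intf : integralOver (loc (d * u)) (poly_at e a f)^-1.
  have -> : (poly_at e a f)^-1 = (- c^-1) * T.[poly_at e a f].
    apply: (mulIf fa); rewrite mulVf // -mulrA.
    by rewrite -(addr0_eq cT) mulrNN mulVf.
  apply: integral_mul; first exact: integral_opp.
  apply: integral_horner.
    apply/integral_poly => i; have [r' ->] := TS i.
    by apply: integral_loc => //; apply: integral_id.
  by apply: integral_loc => //; exists q.
move=> y y0; have [|k [z yz]] := Gf y%:P; first by rewrite /= poly_atC.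
rewrite /= poly_atC in yz.
have : integralOver (loc (d * u)) (e y)^-1.
  have -> : (e y)^-1 = poly_at e a z * (poly_at e a f)^-1 ^+ k.
    by apply: (mulfI y0); rewrite mulfV // mulrA yz -exprMn mulfV // expr1n.
  apply: integral_mul; first by apply: intE; apply: integral_loc.
  by elim: k {yz} => [|k IH]; [exact: integral1 | rewrite exprS; apply: integral_mul].
have du0 : e (d * u) != 0 by rewrite rmorphM mulf_neq0.
case=> s mons /rootP; rewrite horner_coef size_map_poly_id0 ?(monicP mons) ?rmorph1 ?oner_eq0 //.
have s_gt0 : (0 < size s)%N by rewrite size_poly_gt0 monic_neq0.
have [m sE] : exists m, size s = m.+1 by exists (size s).-1; rewrite prednK.
have sm : s`_m = 1 by rewrite -(monicP mons) lead_coefE sE.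
have {sm} sm : (map_poly (loc (d * u)) s)`_m = 1 by rewrite coef_map sm; exact: (rmorph1 (loc (d * u))).
rewrite sE big_ord_recr /= sm mul1r.
case: m {sE sm s_gt0} => [|m]; first by rewrite big_ord0 add0r expr0 => /eqP; rewrite oner_eq0.
move=> sy0.
pose w := - \sum_(i < m.+1) s`_i * (y ^+ (m - i))%:P.
have yr : (e y)^-1 = loc (d * u) w.
  rewrite rmorphN rmorph_sum /=; apply/eqP; rewrite eq_sym eqr_oppLR; apply/eqP.
  apply: (mulIf (expf_neq0 m (invr_neq0 y0))); rewrite mulNr -exprS.
  rewrite -(addr0_eq sy0) opprK mulr_suml; apply: eq_bigr => i _.
  rewrite [loc _ _]rmorphM /= poly_atC coef_map -mulrA; congr (_ * _).
  rewrite rmorphXn -[X in _ * _ ^+ X](subnK (ltn_ord i : i <= m)%N) exprD mulrA -exprMn mulfV //.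
  by rewrite expr1n mul1r.
have [M [v vE]] := locE w du0; exists M, v.
apply: (mulfI (invr_neq0 y0)); rewrite mulKf // yr vE.
by rewrite divfK ?expf_neq0.
Qed.
End Step.

Lemma one_inverse_surj (E : comNzRingType) (e : {rmorphism E -> L}) :
  (forall y, exists x, e x = y) -> one_inverse e.
Proof.
move=> esurj; exists 1; first by rewrite rmorph1 oner_neq0.
move=> y y0; have [z zE] := esurj (e y)^-1; exists 0%N, z.
by rewrite expr0 zE mulfV.
Qed.

Section Generated.
Variables (K : fieldType) (e : {rmorphism K -> L}).

Definition generated_by3 (a b c : L) : Prop :=
  forall S : L -> Prop, (forall x, S (e x)) -> S a -> S b -> S c ->
    (forall x y, S x -> S y -> S (x + y)) -> (forall x y, S x -> S y -> S (x * y)) ->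
  forall y, S y.

Lemma zariski3 a b c : generated_by3 a b c -> exists2 p : {poly K}, p != 0 & root (map_poly e p) a.
Proof.
move=> gen.
suff [p p0 pa] : algebraic_at e a by exists p => //; rewrite map_poly_eq0 in p0.
apply: one_inverse_algebraic; apply: (@one_inverse_down _ _ b); apply: (@one_inverse_down _ _ c).
apply: one_inverse_surj; apply: gen => [x||||x y [u <-] [v <-]|x y [u <-] [v <-]].
- by exists x%:P%:P%:P; do 3!rewrite /= poly_atC.
- by exists 'X%:P%:P; do 2!rewrite /= poly_atC; rewrite /= poly_atX.
- by exists 'X%:P; rewrite /= poly_atC /= poly_atX.
- by exists 'X; rewrite /= poly_atX.
- by exists (u + v); rewrite rmorphD.
by exists (u * v); rewrite rmorphM.
Qed.
End Generated.
End Zariski.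

(** * The coordinate ring has dimension three at every point *)

Section CoordinateRing.
Variables (K : fieldType) (n : nat).
Local Notation R := {mpoly K[n]}.
Local Notation I := (I_ideal K n (n - 2)).
Hypotheses (n2 : (2 < n)%N) (hI : idealr_closed I).
Local Notation A := (quotient_ring hI).

Definition proj : {rmorphism R -> A} := (\pi_A%qT : {rmorphism R -> A}).
Definition coset_rep (x : A) : R := repr x.

Lemma coset_repK x : proj (coset_rep x) = x. Proof. exact: (reprK (x : A)). Qed.

Lemma proj_eq0 a : (proj a == 0) = (a \in I). Proof. exact: pi_eq0. Qed.

Lemma proj_preim_ideal (J : {pred A}) : is_ideal J -> is_ideal [pred r | proj r \in J].
Proof.
move=> idJ; split=> [|u v|a u]; rewrite !unfold_in ?rmorph0 ?rmorphD ?rmorphM.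
- exact: ideal0.
- exact: idealD.
exact: idealM.
Qed.

Lemma coordinate_ring_noetherian : noetherian A.
Proof.
move=> J /is_ideal_closed; apply: (fin_gen_surj (f := proj)) (@fin_gen_mpoly K n) _.
by move=> y; exists (coset_rep y); rewrite coset_repK.
Qed.

Lemma prime_chain_length P e c : @prime_chain A P e c -> (e <= 3)%N.
Proof.
case=> cprime cinc _; rewrite leqNgt; apply/negP => e4.
have /choice[z zE] : forall i, exists z : R, (i < e)%N -> (proj z \in c i.+1) && (proj z \notin c i).
  move=> i; apply: contrapT => /forallNP nz.
  have ie : (i < e)%N by apply: contrapT => ie; apply: (nz 0) => /ie.
  have [_] := cinc i ie; apply => x xc; apply: contrapT => /negP xnc; apply: (nz (coset_rep x)) => _.
  by rewrite coset_repK xc.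
have idc i : (i <= 4)%N -> is_ideal (c i).
  by move=> i4; apply: is_ideal_closed; have [] := cprime i (leq_trans i4 e4).
apply: (@no_chain4 K n n2 (fun i => [pred r | proj r \in c i]) z).
- by move=> i i4; apply: proj_preim_ideal; apply: idc.
- by move=> r rI; rewrite unfold_in; move: rI; rewrite -proj_eq0 => /eqP ->; apply/ideal0/idc.
- have [[_ c1 _] _] := cprime 4%N e4; by rewrite unfold_in rmorph1.
move=> i i4; have ie := leq_trans i4 e4.
have /andP[zc znc] := zE i ie; split=> //.
  by move=> r; rewrite !unfold_in; apply: (cinc i ie).1.
move=> a; rewrite !unfold_in rmorphM => azc.
have [_ /(_ _ _ azc)] := cprime i (ltnW ie).
by rewrite (negbTE znc) orbF.
Qed.

Lemma regular_sequence_length (s : seq A) : regular_sequence s -> (size s <= 3)%N.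
Proof.
case=> s1 sreg; rewrite leqNgt; apply/negP => s4.
apply: (@no_chain4 K n n2 (fun i => [pred r | proj r \in span_ideal (take i s)]) (fun i => coset_rep s`_i)).
- by move=> i i4; apply: proj_preim_ideal; apply: span_ideal_ideal.
- move=> r rI; rewrite unfold_in; move: rI; rewrite -proj_eq0 => /eqP ->.
  exact/ideal0/span_ideal_ideal.
- apply: contra s1; rewrite unfold_in rmorph1; apply: span_ideal_sub => x; exact: mem_take.
move=> i i4; have ilt := leq_trans i4 s4.
have tE : take i.+1 s = rcons (take i s) s`_i by rewrite (take_nth 0).
split.
- move=> r; rewrite !unfold_in; apply: span_ideal_sub => x xs.
  by rewrite tE mem_rcons inE xs orbT.
- by rewrite unfold_in coset_repK; apply: span_ideal_in; rewrite tE mem_rcons inE eqxx.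
by move=> a; rewrite !unfold_in rmorphM /= coset_repK; apply: sreg.
Qed.

(** If the point g were on no V_ij, then for each {i, j} some difference X_k - X_l with k
    and l outside {i, j} would not vanish at g.  The product of these differences
    lies in I, but would not vanish at g. *)
Lemma maximal_point (P : {pred A}) : maximal_ideal P ->
  exists (L : fieldType) (g : {rmorphism R -> L}) (i j l : 'I_n),
  [/\ [/\ i != j, l != i & l != j], const_off (fun k => g 'X_k) i j,
      forall y, exists r, g r = y & forall r, (proj r \in P) = (g r == 0)].
Proof.
case=> idP maxP; have [L [h [hsurj hker]]] := residue_fieldP idP maxP.
pose g : {rmorphism R -> L} := h \o proj.
have gI r : r \in I -> g r = 0.
  by rewrite -proj_eq0 /g /= => /eqP ->; rewrite rmorph0.
exists L, g.
suff [i [j [ij gij]]] : exists i j, i != j /\ const_off (fun k => g 'X_k) i j.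
  have : (0 < #|~: [set i; j]|)%N by rewrite cardsCs setCK cards2 ij card_ord subn_gt0.
  case/card_gt0P => l; rewrite !inE negb_or => /andP[li lj].
  exists i, j, l; split=> // y.
  by have [x <-] := hsurj y; exists (coset_rep x); rewrite /g /= coset_repK.
apply: contrapT => /forallNP nij.
have /choice[u uE] : forall ij : 'I_n * 'I_n, exists kl : 'I_n * 'I_n, ij.1 != ij.2 ->
  [/\ kl.1 != ij.1, kl.1 != ij.2, kl.2 != ij.1, kl.2 != ij.2 & g 'X_kl.1 != g 'X_kl.2].
  move=> [i j] /=; apply: contrapT => /forallNP nkl.
  have ij : i != j by apply: contrapT => ij; apply: (nkl (i, j)) => /ij.
  apply: (nij i); exists j; split=> // k l ki kj li lj; apply/eqP/negP => /negP gkl.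
  by apply: (nkl (k, l)).
pose p : R := \prod_(ij : 'I_n * 'I_n | ij.1 != ij.2) ('X_((u ij).1) - 'X_((u ij).2)).
have pI : p \in I.
  apply: I_idealP => // i j l ij li lj; rewrite /p rmorph_prod (bigD1 (i, j)) //=.
  have [k1 k2 l1 l2 _] := uE (i, j) ij.
  by rewrite rmorphB /= /piece_sub !mmapXU /piece_pt !ifN ?negb_or ?k1 ?k2 ?l1 ?l2 // subrr mul0r.
have /eqP := gI _ pI; rewrite rmorph_prod; apply/negP/prodf_neq0 => ij /uE[_ _ _ _].
by rewrite rmorphB subr_eq0.
Qed.

Section Point.
Variables (L : fieldType) (g : {rmorphism R -> L}) (i j l : 'I_n).
Hypotheses (ij : i != j) (li : l != i) (lj : l != j).
Hypothesis gconst : const_off (fun k => g 'X_k) i j.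
Hypothesis gsurj : forall y, exists r, g r = y.
Let e : {rmorphism K -> L} := g \o @mpolyC n K.
Let e3 : {rmorphism K -> {mpoly L[3]}} := @mpolyC 3 L \o e.

Lemma point_algebraic k : exists2 p : {poly K}, p != 0 & root (map_poly e p) (g 'X_k).
Proof.
have gen (S : L -> Prop) : (forall x, S (e x)) -> S (g 'X_i) -> S (g 'X_j) -> S (g 'X_l) ->
   (forall x y, S x -> S y -> S (x + y)) -> (forall x y, S x -> S y -> S (x * y)) ->
   forall y, S y.
  move=> Se Si Sj Sl SD SM y; have [r <-] := gsurj y; move: r; apply: mpoly_alg_ind => //.
  - move=> k'; have [->//|ki] := eqVneq k' i; have [->//|kj] := eqVneq k' j.
    by rewrite (gconst (l := l)).
  - by move=> p q Sp Sq; rewrite rmorphD; apply: SD.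
  - by move=> p q Sp Sq; rewrite rmorphM; apply: SM.
have [->|ki] := eqVneq k i.
  by apply: (@zariski3 _ _ _ _ (g 'X_j) (g 'X_l)) => S *; apply: gen.
have [->|kj] := eqVneq k j.
  by apply: (@zariski3 _ _ _ _ (g 'X_i) (g 'X_l)) => S *; apply: gen.
rewrite (gconst (l := l)) //.
by apply: (@zariski3 _ _ _ _ (g 'X_i) (g 'X_j)) => S *; apply: gen.
Qed.

Definition slot (k : 'I_n) : 'I_3 :=
  if k == i then @Ordinal 3 0 isT else if k == j then @Ordinal 3 1 isT else @Ordinal 3 2 isT.
Definition slot_var (s : 'I_3) : 'I_n := nth l [:: i; j; l] s.

(** The generic point of V_ij over L, with its first m coordinates replaced by those
    of g.  The kernels of [partial_eval m] for m = 0, ..., 3 are the chain of primes. *)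
Definition partial_pt m (k : 'I_n) : {mpoly L[3]} :=
  if (slot k < m)%N then (g 'X_(slot_var (slot k)))%:MP else 'X_(slot k).
Definition partial_eval m := mmap e3 (partial_pt m).
HB.instance Definition _ m := GRing.RMorphism.copy (partial_eval m)
  (mmap e3 (partial_pt m)).

Lemma slot_varK s : slot (slot_var s) = s.
Proof.
by case: s => -[|[|[|//]]] h; apply/val_inj;
  rewrite /slot /= ?(negbTE li) ?(negbTE lj) ?[j == i]eq_sym ?(negbTE ij) ?eqxx.
Qed.

Lemma partial_eval_I m r : r \in I -> partial_eval m r = 0.
Proof.
apply: I_ideal_eval ij _ => k k' ki kj k'i k'j.
by rewrite /partial_pt /slot (negbTE ki) (negbTE kj) (negbTE k'i) (negbTE k'j).
Qed.

Lemma partial_eval0_lt m r : partial_eval m r = 0 -> partial_eval m.+1 r = 0.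
Proof.
pose h := mmap (@mpolyC 3 L) (fun s => if (s < m.+1)%N then (g 'X_(slot_var s))%:MP else 'X_s : {mpoly L[3]}).
have hE : partial_eval m.+1 =1 h \o partial_eval m.
  apply: (@mpoly_rmorph_eq _ _ _ (partial_eval m.+1) (h \o partial_eval m)) => [c|k] /=.
    by rewrite /partial_eval !mmapC /h /=.
  rewrite /partial_eval !mmapXU /h /partial_pt; case: ifPn => [km|km].
    case: ifPn => [km'|km']; first by rewrite mmapC.
    by rewrite mmapXU km.
  rewrite ifN; first by rewrite mmapXU ifN.
  by apply: contra km => km; apply: leq_trans km _.
by move=> r0; rewrite hE /= r0; exact: mmap0.
Qed.

(** An equation over K of the m-th coordinate of the point distinguishes the two
    kernels. *)
Lemma partial_eval_strict m : (m < 3)%N ->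
  exists r, partial_eval m r != 0 /\ partial_eval m.+1 r = 0.
Proof.
move=> m3; pose s := Ordinal m3; have [p p0 pr] := point_algebraic (slot_var s).
pose r : R := (map_poly (@mpolyC n K) p).['X_(slot_var s)]; exists r.
have rE m' : partial_eval m' r = (map_poly (@mpolyC 3 L \o e) p).[partial_pt m' (slot_var s)].
  rewrite /r -horner_map -map_poly_comp /= /partial_eval mmapXU; congr (horner _ _).
  by apply: eq_map_poly => c /=; rewrite mmapC.
rewrite !rE /partial_pt slot_varK /= ltnn ltnSn; split.
  pose h : {rmorphism {mpoly L[3]} -> {poly L}} := mmap (@polyC L) (fun _ : 'I_3 => 'X).
  have hX : h 'X_s = 'X by rewrite /h /= mmapXU.
  apply: contra_neq p0 => /(congr1 h); rewrite rmorph0 -horner_map -map_poly_comp hX.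
  rewrite (@eq_map_poly _ _ _ (@polyC L \o e)) => [|c]; last by rewrite /h /= mmapC.
  rewrite map_poly_comp -/(_ \Po _) comp_polyXr => /eqP.
  by rewrite map_poly_eq0 => /eqP.
by rewrite map_poly_comp horner_map /= (rootP pr) mpolyC0.
Qed.

Lemma partial_eval3 r : (partial_eval 3 r == 0) = (g r == 0).
Proof.
have -> : partial_eval 3 r = (g r)%:MP.
  move: r; apply: (@mpoly_rmorph_eq _ _ _ (partial_eval 3) (@mpolyC 3 L \o g)) => [c|k] /=.
    by rewrite /partial_eval mmapC.
  rewrite /partial_eval mmapXU /partial_pt ltn_ord /slot /slot_var.
  have [->|ki] := eqVneq k i; first by [].
  have [->|kj] := eqVneq k j; first by [].
  by congr (_%:MP); apply: gconst.
by rewrite mpolyC_eq0.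
Qed.

Lemma point_chain (P : {pred A}) : (forall r, (proj r \in P) = (g r == 0)) ->
  exists c, prime_chain P 3 c.
Proof.
move=> Pg; exists (fun m (x : A) => partial_eval m (coset_rep x) == 0).
have cE m r : (partial_eval m (coset_rep (proj r)) == 0) = (partial_eval m r == 0).
  congr (_ == _); apply/eqP; rewrite -subr_eq0 -rmorphB; apply/eqP/partial_eval_I.
  by rewrite -proj_eq0 rmorphB /= coset_repK subrr.
split.
- move=> m _; split; first split.
  + by rewrite unfold_in -(rmorph0 proj) cE rmorph0.
  + by rewrite unfold_in -(rmorph1 proj) cE rmorph1 oner_neq0.
  + move=> a u v; rewrite !unfold_in => u0 v0.
    rewrite -(coset_repK a) -(coset_repK u) -(coset_repK v) -rmorphM -rmorphD cE rmorphD rmorphM /=.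
    by rewrite (eqP u0) (eqP v0) mulr0 addr0.
  by move=> u v; rewrite !unfold_in -{1}(coset_repK u) -{1}(coset_repK v) -rmorphM cE rmorphM mulf_eq0.
- move=> m m3; split=> [x|sub]; first by rewrite !unfold_in => /eqP/partial_eval0_lt ->.
  have [r [r0 r1]] := partial_eval_strict m3; move/negP: r0; apply.
  by rewrite -cE; apply: sub; rewrite unfold_in cE r1.
by move=> x; rewrite unfold_in partial_eval3 -Pg coset_repK.
Qed.
End Point.

Lemma cohen_macaulay_of_regular :
  (forall P : {pred A}, maximal_ideal P -> exists s,
     [/\ regular_sequence s, {subset s <= P} & size s = 3]) ->
  cohen_macaulay A.
Proof.
move=> reg; split; first exact: coordinate_ring_noetherian.
move=> P maxP; exists 3%N; split; last first.
- by move=> s sreg _; apply: regular_sequence_length.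
- exact: reg.
- by move=> e c; apply: prime_chain_length.
have [L [g [i [j [l [[ij li lj] gc gs Pg]]]]]] := maximal_point maxP.
exact: point_chain ij li lj gc gs _ Pg.
Qed.

Lemma regular_of_cohen_macaulay (P : {pred A}) : cohen_macaulay A -> maximal_ideal P ->
  exists s, [/\ regular_sequence s, {subset s <= P} & (3 <= size s)%N].
Proof.
move=> [_ cm] maxP; have [d [_ hd] [[s [sreg sP szs]] _]] := cm P maxP.
exists s; split=> //; rewrite szs.
have [L [g [i [j [l [[ij li lj] gc gs Pg]]]]]] := maximal_point maxP.
have [c cP] := point_chain ij li lj gc gs Pg; exact: hd cP.
Qed.
End CoordinateRing.

(** * Functions on the spaces V_ij and compatible families *)

Section Families.
Variables (K : fieldType) (n : nat) (o : 'I_n).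
Local Notation R := {mpoly K[n]}.
Local Notation I := (I_ideal K n (n - 2)).
Local Notation D := {poly {poly K}}.
Implicit Types (i j k : 'I_n).

(** The k-th coordinate of the vector alpha e_i + beta e_j, where alpha is the inner
    variable ['X%:P] and beta the outer variable ['X]. *)
Definition pcoord i j k : D := (if k == i then 'X%:P else 0) + (if k == j then 'X else 0).

Definition cst : {rmorphism K -> D} := @polyC {poly K} \o @polyC K.
Definition cstZ : {rmorphism K -> {poly D}} := @polyC D \o cst.

(** The point of V_ij with x_o equal to the outermost variable z and with differences
    of coordinates given by (alpha, beta).  As the differences do not involve z, every
    polynomial has as coefficients of the powers of z functions invariant under the
    translations by (1, ..., 1). *)
Definition ev_pt i j k : {poly D} := 'X + (pcoord i j k - pcoord i j o)%:P.
Definition ev i j : R -> {poly D} := mmap cstZ (ev_pt i j).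
HB.instance Definition _ i j := GRing.RMorphism.copy (ev i j) (mmap cstZ (ev_pt i j)).

Lemma evC i j c : ev i j c%:MP = (cst c)%:P. Proof. by rewrite /ev mmapC. Qed.
Lemma evX i j k : ev i j 'X_k = 'X + (pcoord i j k - pcoord i j o)%:P.
Proof. by rewrite /ev mmapXU. Qed.
Lemma ev_add i j p q : ev i j (p + q) = ev i j p + ev i j q. Proof. exact: rmorphD. Qed.
Lemma ev_sub i j p q : ev i j (p - q) = ev i j p - ev i j q. Proof. exact: rmorphB. Qed.
Lemma ev_mul i j p q : ev i j (p * q) = ev i j p * ev i j q. Proof. exact: rmorphM. Qed.
Lemma ev_o i j : ev i j 'X_o = 'X.
Proof. by rewrite evX subrr addr0. Qed.
Lemma evB i j k l : ev i j ('X_k - 'X_l) = (pcoord i j k - pcoord i j l)%:P.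
Proof. by rewrite rmorphB /= !evX !polyCB; ring. Qed.

Lemma pcoord_off i j k : k != i -> k != j -> pcoord i j k = 0.
Proof. by move=> /negbTE ki /negbTE kj; rewrite /pcoord ki kj addr0. Qed.

Definition at_point (S : comNzRingType) (f : {rmorphism K -> S}) (a b z : S) : {poly D} -> S :=
  poly_at (poly_at (poly_at f a) b) z.
HB.instance Definition _ S f a b z := GRing.RMorphism.copy (@at_point S f a b z)
  (poly_at (poly_at (poly_at f a) b) z).

Lemma at_point_pcoord (S : comNzRingType) (f : {rmorphism K -> S}) (a b z : S) i j k :
  at_point f a b z (pcoord i j k)%:P = (if k == i then a else 0) + (if k == j then b else 0).
Proof.
have aX : poly_at (poly_at f a) b 'X%:P = a by rewrite poly_atC /= poly_atX.
have bX : poly_at (poly_at f a) b 'X = b by rewrite poly_atX.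
rewrite /at_point poly_atC /pcoord rmorphD /=.
by case: ifP => _; case: ifP => _; rewrite ?aX ?bX ?rmorph0.
Qed.

Lemma at_pointC (S : comNzRingType) (f : {rmorphism K -> S}) (a b z : S) c :
  at_point f a b z (cstZ c) = f c.
Proof. by rewrite /at_point poly_atC /= poly_atC /= poly_atC. Qed.

(** Every point of V_ij with values in some ring is a specialization of the one
    defining [ev i j]. *)
Lemma at_pointE (S : comNzRingType) (f : {rmorphism K -> S}) (v : 'I_n -> S) i j l :
  i != j -> l != i -> l != j -> const_off v i j ->
  mmap f v =1 at_point f (v i - v l) (v j - v l) (v o) \o ev i j.
Proof.
move=> ij li lj vc.
pose c k := (if k == i then v i - v l else 0) + (if k == j then v j - v l else 0).
have vE k : v k = v l + c k; rewrite /c.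
  have [->|ki] := eqVneq k i; first by rewrite (negbTE ij); ring.
  have [->|kj] := eqVneq k j; first by ring.
  by rewrite !addr0; apply: vc.
apply: (@mpoly_rmorph_eq _ _ _ (mmap f v) (at_point f (v i - v l) (v j - v l) (v o) \o ev i j)) => [x|k].
  by rewrite /= mmapC evC -/(cstZ x) at_pointC.
rewrite /= mmapXU evX rmorphD rmorphB /= rmorphB /= !at_point_pcoord -/(c k) -/(c o).
by rewrite {1}/at_point poly_atX (vE k) (vE o); ring.
Qed.

Lemma ev_I i j r : i != j -> r \in I -> ev i j r = 0.
Proof.
move=> ij; apply: (@I_ideal_eval _ _ _ cstZ (ev_pt i j) i j r ij) => k l ki kj li lj.
by rewrite /ev_pt (pcoord_off ki kj) (pcoord_off li lj).
Qed.

Lemma I_of_ev r : (2 < n)%N -> (forall i j, i != j -> ev i j r = 0) -> r \in I.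
Proof.
move=> n2 r0; apply: I_idealP => // i j l ij li lj.
rewrite /piece_sub (at_pointE _ ij li lj); last exact: piece_pt_const.
by rewrite /= r0 // rmorph0.
Qed.

(** The polynomials f i j are functions on the planes z = 0 of the spaces V_ij.  The
    condition in the last clause is the vanishing, along the axis alpha, of the
    derivative in the direction (1, ..., 1), which is computed from the derivatives along
    the axis and in the normal directions e_k. *)
Definition compat (f : 'I_n -> 'I_n -> D) : Prop :=
  [/\ forall i j, i != j -> f j i = swapXY (f i j),
      forall i j j', i != j -> i != j' -> (f i j)`_0 = (f i j')`_0
    & forall i j, i != j -> ((f i j)`_0)^`() + \sum_(k | k != i) (f i k)`_1 = 0].

Lemma coef1M (S : nzRingType) (p q : {poly S}) : (p * q)`_1 = p`_0 * q`_1 + p`_1 * q`_0.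
Proof. by rewrite coefM big_ord_recl big_ord1. Qed.

Lemma compatD f g : compat f -> compat g -> compat (fun i j => f i j + g i j).
Proof.
case=> fs f0 f1 [gs g0 g1]; split=> [i j ij|i j j' ij ij'|i j ij].
- by rewrite raddfD (fs _ _ ij) (gs _ _ ij).
- by rewrite !coefD (f0 i j j') // (g0 i j j').
rewrite coefD derivD; under eq_bigr => k _ do rewrite coefD.
by rewrite big_split addrACA f1 // g1 // addr0.
Qed.

Lemma compatM f g : compat f -> compat g -> compat (fun i j => f i j * g i j).
Proof.
case=> fs f0 f1 [gs g0 g1]; split=> [i j ij|i j j' ij ij'|i j ij].
- by rewrite (fs _ _ ij) (gs _ _ ij) -rmorphM.
- by rewrite !coef0M (f0 i j j') // (g0 i j j').
rewrite coef0M derivM.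
rewrite (eq_bigr (fun k => (f i j)`_0 * (g i k)`_1 + (g i j)`_0 * (f i k)`_1)); last first.
  by move=> k; rewrite eq_sym => ik; rewrite coef1M (f0 i k j) // (g0 i k j) // [X in _ + X]mulrC.
rewrite big_split -!mulr_sumr addrACA [X in X + _]addrC.
rewrite (_ : _ + _ = (f i j)`_0 * (((g i j)`_0)^`() + \sum_(k | k != i) (g i k)`_1)
  + (g i j)`_0 * (((f i j)`_0)^`() + \sum_(k | k != i) (f i k)`_1)); last by ring.
by rewrite f1 // g1 // !mulr0 addr0.
Qed.

Lemma compat_cst c : compat (fun _ _ => cst c).
Proof.
split=> [i j _|//|i j _]; first by rewrite /cst /= swapXY_polyC map_polyC.
by rewrite /cst /= coefC derivC big1 ?addr0 // => k _; rewrite coefC.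
Qed.

Lemma compatN f : compat f -> compat (fun i j => - f i j).
Proof.
case=> fs f0 f1; split=> [i j ij|i j j' ij ij'|i j ij].
- by rewrite (fs _ _ ij) -raddfN.
- by rewrite !coefN (f0 _ _ _ ij ij').
rewrite coefN derivN; under eq_bigr => k _ do rewrite coefN.
by rewrite sumrN -opprD f1 // oppr0.
Qed.

Lemma compatB f g : compat f -> compat g -> compat (fun i j => f i j - g i j).
Proof. by move=> cf /compatN; apply: compatD. Qed.

Lemma compat_ext f g : (forall i j, i != j -> f i j = g i j) -> compat f -> compat g.
Proof.
move=> fg [fs f0 f1]; split=> [i j ij|i j j' ij ij'|i j ij].
- have ji : j != i by rewrite eq_sym.
  by rewrite -(fg _ _ ij) -(fg _ _ ji); exact: fs.
- by rewrite -(fg _ _ ij) -(fg _ _ ij'); exact: f0.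
rewrite -(fg _ _ ij); apply: etrans (f1 i j ij); congr (_ + _); apply: eq_bigr => k; rewrite eq_sym => ik.
by rewrite -(fg _ _ ik).
Qed.

Lemma compat_sum m (f : nat -> 'I_n -> 'I_n -> D) : (forall k : nat, (k < m)%N -> compat (f k)) ->
  compat (fun i j => \sum_(k < m) f k i j).
Proof.
elim: m => [|m IH] cf.
  by apply: compat_ext (compat_cst 0) => i j _; rewrite big_ord0 rmorph0.
apply: (compat_ext (f := fun i j => \sum_(k < m) f k i j + f m i j)) => [i j _|].
  by rewrite big_ord_recr.
have cm : compat (f m) by apply: (cf).
by apply: (compatD _ cm); apply: IH => k km; apply: (cf); exact: leqW.
Qed.

Lemma pcoord_coef0 i j k : (pcoord i j k)`_0 = if k == i then 'X else 0.
Proof.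
rewrite coefD; case: (k == i); case: (k == j); by rewrite ?coefC ?coefX ?coef0 ?addr0.
Qed.

Lemma pcoord_coef1 i j k : (pcoord i j k)`_1 = (k == j)%:R.
Proof.
rewrite coefD; case: (k == i); case: (k == j); by rewrite ?coefC ?coefX ?coef0 ?addr0 ?add0r.
Qed.

Lemma pcoord_swap i j k : swapXY (pcoord i j k) = pcoord j i k.
Proof.
rewrite /pcoord rmorphD addrC; congr (_ + _); first by case: ifP => _; [exact: swapXY_X|exact: raddf0].
by case: ifP => _; [exact: swapXY_Y|exact: raddf0].
Qed.

Lemma compat_pcoordB a b : compat (fun i j => pcoord i j a - pcoord i j b).
Proof.
split=> [i j _|i j j' _ _|i j _].
- by rewrite raddfB /= !pcoord_swap.
- by rewrite !coefB !pcoord_coef0.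
rewrite coefB !pcoord_coef0; under eq_bigr => k _ do rewrite coefB !pcoord_coef1.
rewrite sumrB derivB addrACA -opprD.
have one c : (if c == i then 'X else 0 : {poly K})^`() + \sum_(k | k != i) (c == k)%:R = 1.
  have [->|ci] := eqVneq c i.
    by rewrite derivX big1 ?addr0 // => k; rewrite eq_sym => /negbTE->.
  rewrite deriv0 add0r (bigD1 c) //= eqxx big1 ?addr0 // => k /andP[_].
  by rewrite eq_sym => /negbTE->.
by rewrite !one subrr.
Qed.

(** The invariance under translations of the coefficients of the powers of z. *)
Lemma compat_ev r (k : nat) : compat (fun i j => (ev i j r)`_k).
Proof.
move: r k; apply: mpoly_alg_ind => [c k|a k|p q cp cq k|p q cp cq k].
- have [k0|k0] := eqVneq k 0%N.
    by apply: compat_ext (compat_cst c) => i j _; rewrite evC k0 coefC.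
  by apply: compat_ext (compat_cst 0) => i j _; rewrite evC coefC (negbTE k0) rmorph0.
- have cX : compat (fun _ _ => (k == 1%N)%:R).
    by apply: compat_ext (compat_cst (k == 1%N)%:R) => i j _; rewrite rmorph_nat.
  have [k0|k0] := eqVneq k 0%N.
    apply: compat_ext (compatD cX (compat_pcoordB a o)) => i j _.
    by rewrite evX coefD coefX coefC k0.
  by apply: compat_ext cX => i j _; rewrite evX coefD coefX coefC (negbTE k0) addr0.
- by apply: compat_ext (compatD (cp k) (cq k)) => i j _; rewrite rmorphD coefD.
apply: compat_ext (@compat_sum k.+1 (fun l i j => (ev i j p)`_l * (ev i j q)`_(k - l)) _).
  by move=> i j _; rewrite rmorphM coefM.
by move=> l _; apply: compatM.
Qed.

(** Each condition on c holds after multiplication by a value of g on an axis, and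
    these values are not zero divisors. *)
Lemma compat_div f g c : compat f -> compat g -> (forall i j, i != j -> (g i j)`_0 != 0) ->
  (forall i j, i != j -> f i j = g i j * c i j) -> compat c.
Proof.
move=> [fs f0 f1] [gs g0 g1] gn0 fE.
have gn i j : i != j -> g i j != 0.
  by move=> ij; apply: contra_neq (gn0 i j ij) => ->; rewrite coef0.
have c0 i j j' : i != j -> i != j' -> (c i j)`_0 = (c i j')`_0.
  move=> ij ij'; apply: (mulfI (gn0 i j ij)); rewrite {2}(g0 i j j') //.
  by rewrite -!coef0M -!fE // (f0 i j j').
split=> // [i j ij|i j ij].
  have ji : j != i by rewrite eq_sym.
  by apply: (mulfI (gn j i ji)); rewrite -(fE _ _ ji) (fs _ _ ij) (fE _ _ ij) (gs _ _ ij) -rmorphM.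
apply: (mulfI (gn0 i j ij)); rewrite mulr0; apply: etrans _ (f1 i j ij).
rewrite (fE _ _ ij) coef0M derivM.
rewrite [in RHS](eq_bigr (fun k => (g i j)`_0 * (c i k)`_1 + (c i j)`_0 * (g i k)`_1)); last first.
  by move=> k; rewrite eq_sym => ik; rewrite (fE _ _ ik) coef1M (c0 _ _ _ ik ij) (g0 _ _ _ ik ij) [X in _ + X]mulrC.
rewrite big_split /= -!mulr_sumr.
rewrite [RHS](_ : _ = (g i j)`_0 * (((c i j)`_0)^`() + \sum_(k | k != i) (c i k)`_1)
  + (c i j)`_0 * (((g i j)`_0)^`() + \sum_(k | k != i) (g i k)`_1)); last by ring.
by rewrite (g1 _ _ ij) mulr0 addr0.
Qed.

Definition realized (f : 'I_n -> 'I_n -> D) : Prop :=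
  exists r, forall i j, i != j -> ev i j r = (f i j)%:P.

Lemma realized_compat f : realized f -> compat f.
Proof.
by case=> r rE; apply: compat_ext (compat_ev r 0) => i j ij; rewrite (rE _ _ ij) coefC.
Qed.

Lemma realized_ext f g : (forall i j, i != j -> f i j = g i j) -> realized f -> realized g.
Proof. by move=> fg [r rE]; exists r => i j ij; rewrite (rE _ _ ij) (fg _ _ ij). Qed.

Lemma realized_cst c : realized (fun _ _ => cst c).
Proof. by exists c%:MP => i j _; rewrite evC. Qed.

Lemma realized_pcoordB a b : realized (fun i j => pcoord i j a - pcoord i j b).
Proof. by exists ('X_a - 'X_b) => i j _; rewrite evB. Qed.

Lemma realizedD f g : realized f -> realized g -> realized (fun i j => f i j + g i j).
Proof. by move=> [r rE] [s sE]; exists (r + s) => i j ij; rewrite rmorphD /= (rE _ _ ij) (sE _ _ ij) polyCD. Qed.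

Lemma realizedM f g : realized f -> realized g -> realized (fun i j => f i j * g i j).
Proof. by move=> [r rE] [s sE]; exists (r * s) => i j ij; rewrite rmorphM /= (rE _ _ ij) (sE _ _ ij) polyCM. Qed.

Lemma realized_sum (T : eqType) (s : seq T) (f : T -> 'I_n -> 'I_n -> D) :
  (forall t, t \in s -> realized (f t)) -> realized (fun i j => \sum_(t <- s) f t i j).
Proof.
elim: s => [|t s IH] rf.
  by apply: realized_ext (realized_cst 0) => i j _; rewrite big_nil rmorph0.
have rt : realized (f t) by apply: (rf); rewrite inE eqxx.
have [|r rE] := realizedD rt (g := fun i j => \sum_(t <- s) f t i j).
  by apply: IH => u us; apply: (rf); rewrite inE us orbT.
by exists r => i j ij; rewrite (rE _ _ ij) big_cons.
Qed.

Lemma realized_sub f g : realized g -> (compat (fun i j => f i j - g i j) ->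
  realized (fun i j => f i j - g i j)) -> compat f -> realized f.
Proof.
move=> rg fgr cf; apply: (realized_ext _ (realizedD (fgr _) rg)) => [i j _|].
  by rewrite subrK.
exact/compatB/realized_compat.
Qed.

Definition subst1 (u : D) : {poly K} -> D := poly_at cst u.
HB.instance Definition _ u := GRing.RMorphism.copy (subst1 u) (poly_at cst u).
Definition subst2 (u v : D) : D -> D := poly_at (subst1 u) v.
HB.instance Definition _ u v := GRing.RMorphism.copy (subst2 u v) (poly_at (subst1 u) v).

Lemma subst_realized (S : comNzRingType) (h : {rmorphism S -> R}) (g : 'I_n -> 'I_n -> {rmorphism S -> D}) r v (q : {poly S}) :
  (forall i j s, i != j -> ev i j (h s) = (g i j s)%:P) ->
  (forall i j, i != j -> ev i j r = (v i j)%:P) ->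
  forall i j, i != j -> ev i j (poly_at h r q) = (poly_at (g i j) (v i j) q)%:P.
Proof.
move=> hg rv i j ij.
apply: etrans (poly_at_comp (g := ev i j) (h' := @polyC D \o g i j) r _ q) _.
  by move=> s; exact: hg.
rewrite /= (rv _ _ ij); apply/esym.
exact: (poly_at_comp (g := @polyC D) (h := g i j) (h' := @polyC D \o g i j)).
Qed.

Lemma realized_subst1 u q : realized u -> realized (fun i j => subst1 (u i j) q).
Proof.
move=> [r rE]; exists (poly_at (@mpolyC n K) r q).
by apply: (subst_realized (g := fun _ _ => cst)) => // i j s _; rewrite evC.
Qed.

Lemma realized_subst2 u v q : realized u -> realized v ->
  realized (fun i j => subst2 (u i j) (v i j) q).
Proof.
move=> [r rE] [s sE]; exists (poly_at (poly_at (@mpolyC n K) r) s q).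
apply: (subst_realized (g := fun i j => subst1 (u i j))) => // i j t ij.
by apply: (subst_realized (g := fun _ _ => cst)) => // i' j' c _; rewrite evC.
Qed.
End Families.

(** * In characteristic other than 2 every compatible family comes from a polynomial *)

Section Realization.
Variables (K : fieldType) (n : nat) (o : 'I_n).
Hypotheses (n5 : (5 <= n)%N) (K2 : 2%:R != 0 :> K).
Local Notation R := {mpoly K[n]}.
Local Notation D := {poly {poly K}}.
Local Notation realized := (@realized K n o).
Local Notation pcoord := (@pcoord K n).
Implicit Types (i j k a b : 'I_n) (f : 'I_n -> 'I_n -> D).

Definition fresh (s : seq 'I_n) : 'I_n := odflt o [pick x | x \notin s].
Lemma freshP s : (size s < n)%N -> fresh s \notin s.
Proof.
move=> sn; rewrite /fresh; case: pickP => //= noneP.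
by have [x xs] := exists_fresh sn (leqnn _); have := noneP x; rewrite xs.
Qed.

Lemma compat_coef f i j x y : compat f -> i != j -> (f j i)`_x`_y = (f i j)`_y`_x.
Proof. by case=> fs _ _ ij; rewrite fs // coef_swapXY. Qed.

(** On V_ij only two of the differences are nonzero. *)
Lemma pcoord_triple i j a b c : uniq [:: a; b; c] ->
  pcoord i j a * pcoord i j b * pcoord i j c = 0.
Proof.
move=> abc; apply/eqP; apply: contraT; rewrite !mulf_eq0 !negb_or => /andP[/andP[a0 b0] c0].
have in_ij x : pcoord i j x != 0 -> x \in [:: i; j].
  by apply: contraR; rewrite !inE negb_or => /andP[? ?]; rewrite pcoord_off.
have /= := @uniq_leq_size _ _ [:: i; j] abc; apply=> x.
by rewrite !inE => /or3P[] /eqP->; have := in_ij _ a0; have := in_ij _ b0; have := in_ij _ c0; rewrite !inE.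
Qed.

Lemma poly_at_mulr (S : comNzRingType) (g g' : {rmorphism S -> D}) u u' (w : D) q :
  (forall s, g s * w = g' s * w) -> u * w = u' * w -> poly_at g u q * w = poly_at g' u' q * w.
Proof.
move=> gg uu; elim/poly_ind: q => [|q c IH]; first by rewrite !rmorph0.
rewrite !rmorphD !rmorphM /= !poly_atX !poly_atC !mulrDl gg -!mulrA uu; congr (_ + _).
by rewrite ![_ * (u' * w)]mulrCA IH.
Qed.

Lemma subst2_mulr (u v u' v' w : D) q : u * w = u' * w -> v * w = v' * w ->
  subst2 u v q * w = subst2 u' v' q * w.
Proof. by move=> uu vv; apply: poly_at_mulr => // s; apply: poly_at_mulr. Qed.

Lemma subst2_id (q : D) : subst2 'X%:P 'X q = q.
Proof.
elim/poly_ind: q => [|q c IH]; first by rewrite rmorph0.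
rewrite rmorphD rmorphM /= /subst2 poly_atX -/(subst2 _ _ q) IH poly_atC; congr (_ + _).
elim/poly_ind: c => [|c x IHc]; first by rewrite !rmorph0.
by rewrite !rmorphD !rmorphM /= IHc /subst1 poly_atX poly_atC.
Qed.

Lemma subst1_coef0 (u : D) p : (subst1 u p)`_0 = p \Po u`_0 :> {poly K}.
Proof.
elim/poly_ind: p => [|p c IH]; first by rewrite rmorph0 coef0 comp_poly0.
rewrite rmorphD rmorphM /= /subst1 poly_atX poly_atC -/(subst1 u p).
by rewrite coefD coef0M IH comp_polyD comp_polyM comp_polyX comp_polyC /= coefC.
Qed.

(** For a < b the polynomial E has the value alpha^2 beta^2 q on V_ab and 0 on the other
    spaces: products of three differences with distinct indices vanish everywhere, so
    that E can be computed as if x_m, x_l and x_k were equal to the common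
    coordinate. *)
Lemma realized_interior f : compat f -> (forall i j, i != j -> (f i j)`_0 = 0) ->
  (forall i j, i != j -> (f i j)`_1 = 0) -> realized f.
Proof.
move=> cf f0 f1.
pose q i j : D := swapXY (drop_poly 2 (swapXY (drop_poly 2 (f i j)))).
have fE i j : i != j -> f i j = 'X%:P ^+ 2 * 'X ^+ 2 * q i j.
  move=> ij; have ji : j != i by rewrite eq_sym.
  have drop2 (S : nzRingType) (p : {poly S}) : p`_0 = 0 -> p`_1 = 0 -> drop_poly 2 p * 'X^2 = p.
    move=> p0 p1; rewrite -[RHS](poly_take_drop 2) [take_poly 2 p](_ : _ = 0) ?add0r //.
    by apply/polyP => -[|[|k]]; rewrite coef_take_poly coef0 ?p0 ?p1.
  rewrite -{1}[f i j](drop2 _ _ (f0 _ _ ij) (f1 _ _ ij)).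
  rewrite mulrAC; congr (_ * _); rewrite -[LHS]swapXYK -[swapXY (drop_poly _ _)]drop2.
  - by rewrite rmorphM rmorphXn /= swapXY_X mulrC.
  - apply/polyP => k; rewrite coef_swapXY coef_drop_poly coef0 (compat_coef _ _ cf ji).
    by rewrite (f0 _ _ ji) coef0.
  - apply/polyP => k; rewrite coef_swapXY coef_drop_poly coef0 (compat_coef _ _ cf ji).
    by rewrite (f1 _ _ ji) coef0.
pose m a b := fresh [:: a; b]; pose l a b := fresh [:: a; b; m a b].
pose k a b := fresh [:: a; b; m a b; l a b].
pose E (t : 'I_n * 'I_n) i j : D := (pcoord i j t.1 - pcoord i j (m t.1 t.2)) *
  (pcoord i j t.1 - pcoord i j (l t.1 t.2)) * (pcoord i j t.2 - pcoord i j (m t.1 t.2)) *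
  (pcoord i j t.2 - pcoord i j (k t.1 t.2)) *
  subst2 (pcoord i j t.1 - pcoord i j (m t.1 t.2)) (pcoord i j t.2 - pcoord i j (m t.1 t.2)) (q t.1 t.2).
pose s := [seq t : 'I_n * 'I_n <- enum {: 'I_n * 'I_n} | (t.1 < t.2)%N].
have rS : realized (fun i j => \sum_(t <- s) E t i j).
  apply: realized_sum => t _; do !apply: realizedM; do ?exact: realized_pcoordB.
  by apply: realized_subst2; apply: realized_pcoordB.
have EE i j (t : 'I_n * 'I_n) : (t.1 < t.2)%N -> E t i j = pcoord i j t.1 ^+ 2 * pcoord i j t.2 ^+ 2 * subst2 (pcoord i j t.1) (pcoord i j t.2) (q t.1 t.2).
  case: t => a b /= ab; rewrite /E /=.
  have neq_ab : a != b by apply: contraTneq ab => ->; rewrite ltnn.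
  have := @freshP [:: a; b] (leq_trans _ n5); rewrite -/(m a b) => /(_ isT) mP.
  have := @freshP [:: a; b; m a b] (leq_trans _ n5); rewrite -/(l a b) => /(_ isT) lP.
  have := @freshP [:: a; b; m a b; l a b] (leq_trans _ n5); rewrite -/(k a b) => /(_ isT) kP.
  move: (m a b) (l a b) (k a b) mP lP kP => x y z; rewrite !inE !negb_or.
  move=> /andP[xa xb] /and3P[ya yb yx] /and4P[za zb zx zy].
  have abx : pcoord i j a * pcoord i j b * pcoord i j x = 0 by apply: pcoord_triple; distinct.
  have aby : pcoord i j a * pcoord i j b * pcoord i j y = 0 by apply: pcoord_triple; distinct.
  have abz : pcoord i j a * pcoord i j b * pcoord i j z = 0 by apply: pcoord_triple; distinct.
  have axz : pcoord i j a * pcoord i j x * pcoord i j z = 0 by apply: pcoord_triple; distinct.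
  have bxy : pcoord i j b * pcoord i j x * pcoord i j y = 0 by apply: pcoord_triple; distinct.
  have xyz : pcoord i j x * pcoord i j y * pcoord i j z = 0 by apply: pcoord_triple; distinct.
  move: (pcoord i j a) (pcoord i j b) (pcoord i j x) (pcoord i j y) (pcoord i j z) abx aby abz axz bxy xyz.
  move=> A B X Y Z abx aby abz axz bxy xyz.
  have -> : (A - X) * (A - Y) * (B - X) * (B - Z) = A ^+ 2 * B ^+ 2.
    rewrite (_ : _ * (B - Z) = A ^+ 2 * B ^+ 2 + (A * B * X) * (Z + X - A - B)
       + (A * B * Y) * (Z + X - B) - (A * B * Z) * A + (A * X * Z) * (A - Y - X)
       + (B * X * Y) * (B - Z - X) + (X * Y * Z) * X); last by ring.
    by rewrite abx aby abz axz bxy xyz; ring.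
  have XW : X * (A ^+ 2 * B ^+ 2) = 0.
    by rewrite (_ : X * _ = (A * B * X) * (A * B)); [rewrite abx mul0r|ring].
  rewrite [LHS]mulrC [RHS]mulrC; apply: subst2_mulr.
    by rewrite mulrBl XW subr0.
  by rewrite mulrBl XW subr0.
have fS i j : (i < j)%N -> \sum_(t <- s) E t i j = f i j.
  move=> ij; have neq_ij : i != j by apply: contraTneq ij => ->; rewrite ltnn.
  have us : uniq s by rewrite filter_uniq // enum_uniq.
  rewrite (bigD1_seq (i, j)) //=; last by rewrite mem_filter /= ij mem_enum.
  rewrite EE //= /pcoord !eqxx (negbTE neq_ij) eq_sym (negbTE neq_ij) addr0 add0r subst2_id -fE //.
  rewrite big_seq_cond big1 ?addr0 // => -[a b] /andP[]; rewrite mem_filter /= => /andP[ab _] abij.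
  rewrite EE //=; case: (boolP (pcoord i j a == 0)) => [/eqP->|a0]; first by rewrite expr2 !mul0r.
  case: (boolP (pcoord i j b == 0)) => [/eqP->|b0]; first by rewrite expr0n mulr0 mul0r.
  have in_ij x : pcoord i j x != 0 -> (x == i) || (x == j).
    by apply: contraR; rewrite negb_or => /andP[? ?]; rewrite pcoord_off.
  case/orP: (in_ij _ a0) abij ab => /eqP->; case/orP: (in_ij _ b0) => /eqP->; rewrite ?eqxx ?ltnn //.
  by move=> _; rewrite ltnNge ltnW.
have cS := realized_compat rS; apply: realized_ext rS => i j ij.
have [|ji|/val_inj] := ltngtP i j; first exact: fS; last by move/eqP; rewrite (negbTE ij).
have [cSs _ _] := cS; have [cfs _ _] := cf.
by rewrite cSs 1?eq_sym // fS // -cfs // eq_sym.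
Qed.

Lemma poly_drop_X (k : nat) (p : {poly K}) : (forall x, (x < k)%N -> p`_x = 0) -> 'X^k * drop_poly k p = p.
Proof.
move=> p0; rewrite -[RHS](poly_take_drop k) [take_poly k p](_ : _ = 0) ?add0r 1?mulrC //.
by apply/polyP => x; rewrite coef_take_poly coef0; case: ifP => // /p0.
Qed.

Lemma realized_sum_pred (T : finType) (P : pred T) (f : T -> 'I_n -> 'I_n -> D) :
  (forall t, realized (f t)) -> realized (fun i j => \sum_(t | P t) f t i j).
Proof.
move=> rf; have rs : realized (fun i j => \sum_(t <- [seq t <- enum T | P t]) f t i j).
  by apply: realized_sum.
by apply: realized_ext rs => i j _; rewrite big_filter big_enum_cond.
Qed.

(** The normal derivative of f along the axis a in the direction b is the one of the
    polynomial U indexed by (a, b), for each b except one direction m a.  The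
    derivative of U in the direction m a is the opposite one, and since
    the normal derivatives have sum 0 the direction m a is right as well. *)
Lemma realized_normal f : compat f -> (forall i j, i != j -> (f i j)`_0 = 0) ->
  (forall i j, i != j -> (f i j)`_1`_1 = 0) -> realized f.
Proof.
move=> cf f0 f11.
pose m a := fresh [:: a]; pose l a b := fresh [:: a; m a; b]; pose k a b := fresh [:: a; m a; b; l a b].
pose p a b := drop_poly 2 (f a b)`_1.
pose U (t : 'I_n * 'I_n) i j : D := (pcoord i j t.1 - pcoord i j (k t.1 t.2)) *
  (pcoord i j t.1 - pcoord i j (l t.1 t.2)) * (pcoord i j t.2 - pcoord i j (m t.1)) *
  subst1 (pcoord i j t.1 - pcoord i j (l t.1 t.2)) (p t.1 t.2).
pose P (t : 'I_n * 'I_n) := (t.2 != t.1) && (t.2 != m t.1).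
have rS : realized (fun i j => \sum_(t | P t) U t i j).
  apply: realized_sum_pred => t; do !apply: realizedM; do ?exact: realized_pcoordB.
  by apply: realized_subst1; apply: realized_pcoordB.
have pE i j : i != j -> 'X^2 * p i j = (f i j)`_1.
  move=> ij; apply: poly_drop_X => -[|[|//]] _; last exact: f11.
  have ji : j != i by rewrite eq_sym.
  by rewrite (compat_coef _ _ cf ji) (f0 _ _ ji) coef0.
have UE t i j : i != j -> P t -> (U t i j)`_0 = 0 /\
   (U t i j)`_1 = (if i == t.1 then 'X^2 * p t.1 t.2 * ((j == t.2)%:R - (j == m t.1)%:R) else 0).
  case: t => a b ij /andP[/= ba bm]; rewrite /U /=.
  have := @freshP [:: a] (leq_trans _ n5); rewrite -/(m a) => /(_ isT).
  have := @freshP [:: a; m a; b] (leq_trans _ n5); rewrite -/(l a b) => /(_ isT).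
  have := @freshP [:: a; m a; b; l a b] (leq_trans _ n5); rewrite -/(k a b) => /(_ isT).
  move: (m a) (l a b) (k a b) bm => x y z; rewrite !inE !negb_or.
  move=> bx /and4P[za zx zb zy] /and3P[ya yx yb] xa.
  rewrite !(coef1M, coef0M, coefB, pcoord_coef0, pcoord_coef1, subst1_coef0).
  have [ia|ia] := eqVneq i a.
    subst i; rewrite (negbTE za) (negbTE ya) (negbTE ba) (negbTE xa).
    rewrite !subr0 !mulr0 !mul0r addr0 comp_polyXr; split=> //.
    by rewrite ![_ == j]eq_sym expr2 /=; ring.
  have [zi|zi] := eqVneq z i.
    subst i; rewrite (eq_sym y) (negbTE zy) (eq_sym b) (negbTE zb) (eq_sym x) (negbTE zx).
    by split; ring.
  have [yi|yi] := eqVneq y i.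
    subst i; rewrite (eq_sym b) (negbTE yb) (eq_sym x) (negbTE yx).
    by split; ring.
  by split; ring.
apply: (realized_sub rS) (cf) => cg; apply: realized_interior => // i j ij; rewrite coefB coef_sum.
  by rewrite f0 // big1 ?subr0 // => t Pt; case: (UE t i j ij Pt).
rewrite (eq_bigr (fun t : 'I_n * 'I_n => if i == t.1 then (f t.1 t.2)`_1 * ((j == t.2)%:R - (j == m t.1)%:R) else 0)); last first.
  move=> t Pt; case: (UE t i j ij Pt) => _ ->; case: eqP => // _; rewrite pE //.
  by case/andP: Pt; rewrite eq_sym.
rewrite -big_mkcondr /= (eq_bigl (fun t : 'I_n * 'I_n => (t.1 == i) && ((t.2 != i) && (t.2 != m i)))); last first.
  move=> t; by rewrite /P /= [i == _]eq_sym; case: (t.1 =P i) => [->|]; rewrite ?andbT ?andbF.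
rewrite -(pair_big_dep (pred1 i) (fun _ b => (b != i) && (b != m i)) (fun a b => (f a b)`_1 * ((j == b)%:R - (j == m a)%:R))) /=.
rewrite big_pred1_eq.
have [_ _ cf1] := cf.
have [jm|jm] := eqVneq j (m i).
  rewrite (eq_bigr (fun b => - (f i b)`_1)); last first.
    by move=> b /andP[_ bm]; rewrite jm [m i == b]eq_sym (negbTE bm) sub0r mulrN1.
  have ji : j != i by rewrite eq_sym.
  have h := cf1 i j ij; rewrite (f0 _ _ ij) deriv0 add0r (bigD1 j ji) /= in h.
  rewrite sumrN opprK; apply: etrans h.
  by congr (_ + _); apply: eq_bigl => b; rewrite jm.
rewrite (bigD1 j) /= ?[j == i]eq_sym ?ij ?jm // eqxx subr0 mulr1 big1 ?addr0 ?subrr //.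
by move=> b /andP[_ bj]; rewrite [j == b]eq_sym (negbTE bj) subr0 mulr0.
Qed.

(** The coefficients of alpha beta are obtained from the squares (x_a - x_b)^2; the
    condition on the derivative along (1, ..., 1) says that the coefficients of
    alpha^2 are then right too.  This is where 2 has to be invertible. *)
Lemma realized_quadratic f : compat f ->
  (forall i j (k : nat), i != j -> k != 2%N -> (f i j)`_0`_k = 0) -> realized f.
Proof.
move=> cf f0.
(* one factor 1/2 for the double product in the square, and one because each pair
   {a, b} is counted twice *)
pose c (t : 'I_n * 'I_n) : K := - 2%:R^-1 * 2%:R^-1 * (f t.1 t.2)`_1`_1.
pose P (t : 'I_n * 'I_n) := t.2 != t.1.
pose Q (t : 'I_n * 'I_n) i j : D := cst K (c t) * (pcoord i j t.1 - pcoord i j t.2) ^+ 2.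
have rS : realized (fun i j => \sum_(t | P t) Q t i j).
  apply: realized_sum_pred => t; apply: realizedM; first exact: realized_cst.
  by rewrite /=; apply: realizedM; apply: realized_pcoordB.
have csym a b : a != b -> c (a, b) = c (b, a).
  by move=> ab; rewrite /c /= (compat_coef 1 1 cf ab).
have [_ _ cf1] := cf.
have sumE (F : 'I_n -> 'I_n -> {poly K}) i :
   \sum_(t : 'I_n * 'I_n | P t) (if t.1 == i then F t.1 t.2 else 0) = \sum_(b | b != i) F i b.
  rewrite -big_mkcondr /= (eq_bigl (fun t : 'I_n * 'I_n => (t.1 == i) && (t.2 != i))); last first.
    by move=> t; rewrite /P andbC; case: (t.1 =P i) => [->|].
  by rewrite -(pair_big_dep (pred1 i) (fun _ b => b != i) F) /= big_pred1_eq.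
have sumE' (F : 'I_n -> 'I_n -> {poly K}) i :
   \sum_(t : 'I_n * 'I_n | P t) (if t.2 == i then F t.1 t.2 else 0) = \sum_(b | b != i) F b i.
  rewrite -(sumE (fun x y => F y x)).
  rewrite (reindex_inj (h := fun t : 'I_n * 'I_n => (t.2, t.1))) => [|[? ?] [? ?] [-> ->]//].
  by apply: eq_bigl => t; rewrite /P /= eq_sym.
have Q0 t i j : P t -> (Q t i j)`_0 = (if t.1 == i then (c t)%:P * 'X^2 else 0) + (if t.2 == i then (c t)%:P * 'X^2 else 0).
  rewrite /P /Q expr2 !coef0M coefB !pcoord_coef0 /cst /= coefC /=.
  have [->|ti] := eqVneq t.1 i; last by case: (t.2 == i) => _; ring.
  by move=> /negbTE ->; ring.
have Q1 t i j : P t -> i != j -> (Q t i j)`_1 = (if t.1 == i then if t.2 == j then - ((c t)%:P * 2%:R * 'X) else 0 else 0)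
     + (if t.2 == i then if t.1 == j then - ((c t)%:P * 2%:R * 'X) else 0 else 0).
  rewrite /P /Q expr2 !(coef1M, coef0M, coefB) !pcoord_coef0 !pcoord_coef1 /cst /= !coefC /= => Pt ij.
  have [t1i|t1i] := eqVneq t.1 i.
    rewrite -t1i (negbTE Pt) eq_sym t1i eq_sym (negbTE ij).
    by case: (t.2 == j) => /=; ring.
  have [t2i|t2i] := eqVneq t.2 i; last by ring.
  rewrite -t2i in ij *; rewrite (negbTE ij).
  by case: (t.1 == j) => /=; ring.
apply: (realized_sub rS) (cf) => cg; apply: realized_normal => // i j ij; rewrite coefB coef_sum.
  rewrite (eq_bigr _ (fun t Pt => Q0 t i j Pt)) big_split /=.
  rewrite (sumE (fun a b => (c (a, b))%:P * 'X^2)) (sumE' (fun a b => (c (a, b))%:P * 'X^2)).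
  rewrite [X in _ - (_ + X)](eq_bigr (fun b => (c (i, b))%:P * 'X^2)) => [|b bi]; last by rewrite csym.
  rewrite -mulr_suml -rmorph_sum /=.
  have -> : (f i j)`_0 = ((f i j)`_0`_2)%:P * 'X^2.
    apply/polyP => k; rewrite coefCM coefXn.
    by have [->|k2] := eqVneq k 2%N; rewrite ?mulr1 // mulr0 f0.
  have := congr1 (fun p : {poly K} => p`_1) (cf1 i j ij); rewrite coefD coef_deriv coef_sum coef0 => h.
  have -> : \sum_(b | b != i) c (i, b) = 2%:R^-1 * (f i j)`_0`_2.
    rewrite /c /= -mulr_sumr; move/addr0_eq: h => <-.
    have v2 := mulVf K2; move: (2%:R^-1 : K) v2 (((f i j)`_0)`_2) => v v2 y.
    by rewrite (_ : - v * v * - (y *+ 2) = v * y * (v * 2%:R)); [rewrite v2 mulr1|ring].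
  rewrite -mulrDl -polyCD -mulrDl (_ : 2%:R^-1 + 2%:R^-1 = 1) ?mul1r ?subrr //.
  by rewrite -[X in X + _]mul1r -[X in _ + X]mul1r -mulrDl mulfV.
rewrite (eq_bigr _ (fun t Pt => Q1 t i j Pt ij)) big_split /=.
rewrite (sumE (fun a b => if b == j then - ((c (a, b))%:P * 2%:R * 'X) else 0)).
rewrite (sumE' (fun a b => if a == j then - ((c (a, b))%:P * 2%:R * 'X) else 0)).
have ji : j != i by rewrite eq_sym.
have one (F : 'I_n -> {poly K}) : \sum_(b | b != i) (if b == j then F b else 0) = F j.
  by rewrite (bigD1 j ji) /= eqxx big1 ?addr0 // => b /andP[_ /negbTE ->].
rewrite (one (fun b => - ((c (i, b))%:P * 2%:R * 'X))) (one (fun b => - ((c (b, i))%:P * 2%:R * 'X))).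
rewrite -(csym _ _ ij) coefB -opprD -mulrDl -mulrDr coefN coefMX /=.
rewrite -natrD -polyC_natr -polyCM coefC /= /c /= (_ : 4%:R = 2%:R * 2%:R :> K); last by rewrite -natrM.
set x := (f i j)`_1`_1; rewrite mulrAC.
rewrite (_ : - 2%:R^-1 * 2%:R^-1 * (2%:R * 2%:R) * x = - x * (2%:R^-1 * 2%:R) * (2%:R^-1 * 2%:R)); last by ring.
by rewrite mulVf // !mulr1 opprK subrr.
Qed.

(** The polynomial W a is a product of three differences, which restricts to
    alpha^3 p on the axis a and to 0 on the other axes. *)
Lemma realized_cubic f : compat f -> (forall i j, i != j -> (f i j)`_0`_0 = 0) ->
  (forall i j, i != j -> (f i j)`_0`_1 = 0) -> realized f.
Proof.
move=> cf f0 f1.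
pose d a := fresh [:: a].
have dP a : a != d a by have := @freshP [:: a] (leq_trans _ n5); rewrite inE eq_sym => ->.
pose x a := fresh [:: a]; pose y a := fresh [:: a; x a]; pose z a := fresh [:: a; x a; y a].
pose p a : {poly K} := drop_poly 3 (f a (d a))`_0.
pose W a i j : D := (pcoord i j a - pcoord i j (x a)) * (pcoord i j a - pcoord i j (y a)) *
  (pcoord i j a - pcoord i j (z a)) * subst1 (pcoord i j a - pcoord i j (z a)) (p a).
have rS : realized (fun i j => \sum_(a | predT a) W a i j).
  apply: realized_sum_pred => t; do !apply: realizedM; do ?exact: realized_pcoordB.
  by apply: realized_subst1; apply: realized_pcoordB.
have W0 a i j : (W a i j)`_0 = if a == i then 'X^3 * p a else 0.
  rewrite /W.
  have := @freshP [:: a] (leq_trans _ n5); rewrite -/(x a) => /(_ isT).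
  have := @freshP [:: a; x a] (leq_trans _ n5); rewrite -/(y a) => /(_ isT).
  have := @freshP [:: a; x a; y a] (leq_trans _ n5); rewrite -/(z a) => /(_ isT).
  move: (x a) (y a) (z a) => u v w; rewrite !inE !negb_or.
  move=> /and3P[wa wu wv] /andP[va vu] ua.
  rewrite !(coef0M, coefB, pcoord_coef0, subst1_coef0).
  have [ia|ia] := eqVneq a i.
    subst i; rewrite (negbTE ua) (negbTE va) (negbTE wa) !subr0 comp_polyXr.
    by ring.
  have [ui|ui] := eqVneq u i; last by rewrite subrr !mul0r.
  by subst i; rewrite (negbTE vu) subrr mulr0 !mul0r.
have [_ fax _] := cf.
apply: (realized_sub rS) (cf) => cg; apply: realized_quadratic => // i j k ij k2.
rewrite coefB coef_sum (eq_bigr _ (fun a _ => W0 a i j)) (bigD1 i) //= eqxx big1 ?addr0.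
  rewrite (fax i j (d i) ij (dP i)) -[X in X - _](poly_take_drop 3) mulrC addrK coef_take_poly.
  case: k k2 => [|[|[|k]]] //= _; first exact: f0.
  exact: f1.
by move=> a /negbTE ->.
Qed.

(** The coefficients c a of the linear terms on the axes have sum 0 by the condition
    on the derivative along (1, ..., 1), so that the linear form with these coefficients is
    invariant under translations. *)
Lemma realized_linear f : compat f -> (forall i j, i != j -> (f i j)`_0`_0 = 0) -> realized f.
Proof.
move=> cf f0.
pose d a := fresh [:: a].
have dP a : a != d a by have := @freshP [:: a] (leq_trans _ n5); rewrite inE eq_sym => ->.
pose c a : K := (f a (d a))`_0`_1.
have [_ fax f1] := cf.
have cE i j : i != j -> (f i j)`_0`_1 = c i by move=> ij; rewrite (fax _ _ _ ij (dP i)).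
pose L a i j : D := cst K (c a) * (pcoord i j a - pcoord i j o).
have rS : realized (fun i j => \sum_(a | predT a) L a i j).
  by apply: realized_sum_pred => t; apply: realizedM; [exact: realized_cst|exact: realized_pcoordB].
have sumc : \sum_a c a = 0.
  have := congr1 (fun p : {poly K} => p`_0) (f1 o (d o) (dP o)).
  rewrite coefD coef_deriv coef_sum coef0 mulr1n cE // => h; rewrite (bigD1 o) //=.
  apply: etrans h; congr (_ + _); apply: eq_bigr => b; rewrite eq_sym => ob.
  by rewrite -(compat_coef _ _ cf ob) cE // eq_sym.
have L0 i j : (\sum_a L a i j)`_0 = (c i)%:P * 'X.
  rewrite coef_sum (eq_bigr (fun a => (if a == i then (c a)%:P * 'X else 0) - (c a)%:P * (if o == i then 'X else 0))).
    rewrite sumrB -mulr_suml -rmorph_sum /= sumc mul0r subr0 (bigD1 i) //= eqxx big1 ?addr0 //.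
    by move=> a /negbTE->.
  move=> a _; rewrite /L coef0M coefB !pcoord_coef0 /cst /= coefC mulrBr; congr (_ - _).
  by case: (a == i); rewrite ?mulr0.
apply: (realized_sub rS) (cf) => cg; apply: realized_cubic => // i j ij; rewrite coefB L0 coefB coefMX ?coefC ?f0 ?subrr //=.
by rewrite cE // subrr.
Qed.

(** The terms on the axes of degree 0, of degree 1, of degree at least 3 and of degree 2,
    then the normal derivatives, and finally the multiples of alpha^2 beta^2 are
    realized in turn. *)
Theorem compat_realized f : compat f -> realized f.
Proof.
move=> cf; have [_ fax _] := cf.
have csym i j : i != j -> (f j i)`_0`_0 = (f i j)`_0`_0 by move=> ij; rewrite (compat_coef _ _ cf ij).
pose d a := fresh [:: a].
have dP a : a != d a by have := @freshP [:: a] (leq_trans _ n5); rewrite inE eq_sym => ->.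
pose c0 := (f o (d o))`_0`_0.
have c0E i j : i != j -> (f i j)`_0`_0 = c0.
  move=> ij; have [io|io] := eqVneq i o.
    by subst i; rewrite (fax _ _ _ ij (dP o)).
  have oi : o != i by rewrite eq_sym.
  by rewrite (fax _ _ _ ij io) (csym _ _ oi) (fax _ _ _ oi (dP o)).
apply: (realized_sub (realized_cst o c0)) (cf) => cg; apply: realized_linear => // i j ij.
by rewrite !coefB c0E // /cst /= !coefC subrr.
Qed.
End Realization.

(** * A regular sequence in characteristic other than 2 *)

(** The remainder r of b modulo h, taken coefficientwise, satisfies that h divides G r,
    so that h divides its leading coefficient, which is of smaller degree. *)
Lemma dvd_monic_mul (K : fieldType) (G x b : {poly {poly K}}) (h : {poly K}) :
  G \is monic -> h != 0 -> h%:P * x = G * b -> exists b', b = h%:P * b'.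
Proof.
move=> monG h0 hx.
pose b' := map_poly (fun c => c %/ h) b; pose r := map_poly (fun c => c %% h) b.
have bE : b = h%:P * b' + r.
  apply/polyP => k; rewrite coefD coefCM !coef_map_id0 ?div0p ?mod0p //.
  by rewrite mulrC -divp_eq.
have [r0|r0] := eqVneq r 0; first by exists b'; rewrite bE r0 addr0.
have GrE : G * r = h%:P * (x - G * b').
  by rewrite mulrBr hx bE mulrDr; ring.
have szr : (size (lead_coef r) < size h)%N.
  by rewrite lead_coefE coef_map_id0 ?mod0p // ltn_modp.
have dvr : h %| lead_coef r.
  by rewrite -[lead_coef r]mul1r -(monicP monG) -lead_coefM lead_coefE GrE coefCM dvdp_mulr.
by move: r0; rewrite -lead_coef_eq0 -(modp_small szr) (eqP dvr) eqxx.
Qed.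

Section RegularSequence.
Variables (K : fieldType) (n : nat) (o : 'I_n).
Hypotheses (n5 : (5 <= n)%N).
Local Notation R := {mpoly K[n]}.
Local Notation I := (I_ideal K n (n - 2)).
Local Notation D := {poly {poly K}}.
Variables (h1 : {poly K}).
Let h : {poly K} := 'X^2 * h1.
Hypothesis monh : h \is monic.
Let P : {poly K} := h ^+ n.-1.
Let Q : {poly K} := h^`() * h ^+ n.-2.

(** The same polynomial is taken on all the spaces V_ij.  On an axis it is P, with normal derivative -Q in all the n - 1
    directions; such a family is compatible because P' = (n - 1) Q.  Both P and Q are
    multiples of h, so that it vanishes at the points where h(alpha) = h(beta) = 0. *)
Definition param1 : D := P%:P + P^:P - 'X * Q%:P - 'X%:P * Q^:P.
Definition param2 : D := h%:P * h^:P.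

Let n1E : n.-1 = n.-2.+1. Proof. by case: n n5 => [|[|]]. Qed.
Let n2E : n.-2 = (n - 3).+1. Proof. by case: n n5 => [|[|[|k]]] // _; rewrite !subSS subn0. Qed.
Let h_neq0 : h != 0. Proof. exact: monic_neq0. Qed.

Lemma XnM_coef01 (p : {poly K}) : ('X^2 * p)`_0 = 0 /\ ('X^2 * p)`_1 = 0.
Proof. by rewrite !coefXnM. Qed.

Let h01 : h`_0 = 0 /\ h`_1 = 0. Proof. exact: XnM_coef01. Qed.
Let P01 : P`_0 = 0 /\ P`_1 = 0.
Proof. by rewrite /P n1E exprS {1 3}/h -mulrA; apply: XnM_coef01. Qed.
Let Q01 : Q`_0 = 0 /\ Q`_1 = 0.
Proof. by rewrite /Q n2E exprS mulrCA {1 4}/h -mulrA; apply: XnM_coef01. Qed.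
Let PQ : P^`() = Q *+ n.-1. Proof. by rewrite /P deriv_exp. Qed.
Let P_neq0 : P != 0. Proof. by rewrite expf_neq0. Qed.

Lemma param1_coef0 : param1`_0 = P.
Proof.
rewrite /param1 !(coefB, coefD) coefXM coefCM !coef_map !coefC /=.
by rewrite P01.1 Q01.1 mulr0 !subr0 addr0.
Qed.

Lemma param1_coef1 : param1`_1 = - Q.
Proof.
rewrite /param1 !(coefB, coefD) coefXM coefCM !coef_map !coefC /=.
by rewrite P01.2 Q01.2 mulr0 subr0 !add0r.
Qed.

Lemma param1_swap : swapXY param1 = param1.
Proof.
rewrite /param1 !raddfB raddfD /= !rmorphM /= !swapXY_polyC !swapXY_map_polyC swapXY_X map_polyX.
by ring.
Qed.

Lemma compat_constant (G : D) : swapXY G = G -> (G`_0)^`() + G`_1 *+ n.-1 = 0 ->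
  compat (fun _ _ : 'I_n => G).
Proof.
move=> Gs G01; split=> // i j ij.
by rewrite sumr_const (@eq_card _ _ (predC1 i)) // cardC1 card_ord.
Qed.

Lemma param1_compat : compat (fun _ _ : 'I_n => param1).
Proof.
apply: compat_constant; first exact: param1_swap.
by rewrite param1_coef0 param1_coef1 PQ mulNrn subrr.
Qed.

Lemma param2_compat : compat (fun _ _ : 'I_n => param2).
Proof.
apply: compat_constant.
  by rewrite /param2 rmorphM /= swapXY_polyC swapXY_map_polyC mulrC.
rewrite /param2 !coefCM !coef_map /= h01.1 h01.2 mulr0 mul0rn addr0.
by rewrite deriv0.
Qed.

Lemma param1_neq0 : param1 != 0.
Proof. by apply: contra_neq P_neq0 => G0; rewrite -param1_coef0 G0 coef0. Qed.

Lemma param1_monic : param1 \is monic.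
Proof.
have szP : size (P^:P) = size P by rewrite size_map_polyC.
have monP : P \is monic by rewrite monic_exp.
have szh : (2 < size h)%N.
  have h10 : h1 != 0 by apply: contra_neq h_neq0 => h10; rewrite /h h10 mulr0.
  by rewrite /h mulrC size_mulXn // ltnS ltnS size_poly_gt0.
have szP3 : (2 < size P)%N.
  rewrite /P n1E exprS size_mul ?expf_neq0 // -subn1 ltn_subRL.
  apply: (@leq_trans (size h + 1)); first by rewrite addn1 ltnS.
  by rewrite leq_add2l size_poly_gt0 expf_neq0.
have szQ : (size Q < size P)%N.
  have [h'0|h'0] := eqVneq h^`() 0.
    by rewrite /Q h'0 mul0r size_poly0 (leq_trans _ szP3).
  rewrite /Q /P n1E exprS (size_mul h'0) ?expf_neq0 // (size_mul h_neq0) ?expf_neq0 //.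
  have s0 : (0 < size (h ^+ n.-2))%N by rewrite size_poly_gt0 expf_neq0.
  rewrite -(prednK s0) !addnS /= ltn_add2r.
  exact: (lt_size_deriv h_neq0).
pose E := P%:P - 'X * Q%:P - 'X%:P * Q^:P.
have GE : param1 = P^:P + E by rewrite /param1 /E; ring.
have szE : (size E < size (P^:P))%N.
  rewrite szP /E; apply: leq_ltn_trans (size_polyD _ _) _; rewrite gtn_max size_polyN.
  apply/andP; split.
    apply: leq_ltn_trans (size_polyD _ _) _; rewrite gtn_max size_polyN.
    apply/andP; split; first by rewrite (leq_ltn_trans (size_polyC_leq1 _)) // ltnW.
    apply: leq_ltn_trans szP3; rewrite mulrC; apply: leq_trans (size_polyMleq _ _) _.
    by rewrite size_polyX addn2 /= ltnS size_polyC_leq1.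
  rewrite mul_polyC; apply: leq_ltn_trans szQ.
  by rewrite (leq_trans (size_scale_leq _ _)) // size_map_polyC.
by rewrite GE monicE lead_coefDl // lead_coef_map_inj ?(monicP monP) //; apply: polyC_inj.
Qed.

(** The sequence ([param1], [param2]) is regular on each V_ij: [param1] is monic in
    each of the two variables, and [param2] is the product of a polynomial in alpha and
    one in beta. *)
Lemma param_dvd a b : a * param2 = b * param1 -> exists c, a = param1 * c.
Proof.
have swap_dvd x y : h%:P * x = param1 * y -> exists y', y = h%:P * y' /\ x = param1 * y'.
  move=> hxy; have [y' yE] := dvd_monic_mul param1_monic h_neq0 hxy; exists y'; split=> //.
  apply: (mulfI (x := h%:P)); first by rewrite polyC_eq0.
  by rewrite hxy yE mulrCA.
rewrite /param2 mulrC -mulrA [b * _]mulrC => /swap_dvd[y [_ hy]].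
have : h%:P * swapXY a = param1 * swapXY y.
  by rewrite -{1}(swapXY_map_polyC h) -rmorphM hy rmorphM /= param1_swap.
case/swap_dvd => c [_ ac]; exists (swapXY c).
by rewrite -[a]swapXYK ac rmorphM /= param1_swap.
Qed.

Variables (f : {poly K}) (monf : f \is monic).
Let param3 : R := (map_poly (@mpolyC n K) f).['X_o].

Lemma ev_param3 i j : ev o i j param3 = map_poly (@cst K) f.
Proof.
rewrite /param3 -horner_map -map_poly_comp /= ev_o.
rewrite (eq_map_poly (g := @polyC D \o @cst K)) => [|c]; last by rewrite /= evC.
by rewrite map_poly_comp -/(_ \Po _) comp_polyXr.
Qed.

Hypothesis K2 : 2%:R != 0 :> K.

Lemma realize_poly (C : nat -> 'I_n -> 'I_n -> D) N : (forall k, compat (C k)) ->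
  exists V : R, forall i j, i != j -> ev o i j V = \poly_(k < N) C k i j.
Proof.
move=> cC; have /choice[v vE] := fun k => compat_realized o n5 K2 (cC k).
exists (\sum_(k < N) v k * 'X_o ^+ k) => i j ij.
rewrite raddf_sum poly_def; apply: eq_bigr => k _.
by rewrite /= rmorphM rmorphXn /= ev_o (vE _ _ _ ij) mul_polyC.
Qed.

Variables (g1 g2 : R).
Hypothesis g1E : forall i j, i != j -> ev o i j g1 = param1%:P.
Hypothesis g2E : forall i j, i != j -> ev o i j g2 = param2%:P.
Let n2 : (2 < n)%N. Proof. exact: leq_trans n5. Qed.

Lemma param_regular1 r : r * g1 \in I -> r \in I.
Proof.
move=> rI; apply: (I_of_ev (o := o) n2) => i j ij.
have := ev_I o ij rI; rewrite ev_mul (g1E ij) => /eqP.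
by rewrite mulf_eq0 polyC_eq0 (negbTE param1_neq0) orbF => /eqP.
Qed.

Lemma ev_size_bound (r : R) : exists N, forall i j, (size (ev o i j r) <= N)%N.
Proof.
exists (\max_i \max_j size (ev o i j r)) => i j.
by apply: leq_trans (leq_bigmax i); apply: leq_trans (leq_bigmax j).
Qed.

(** The quotients on the spaces V_ij form compatible families by [compat_div]. *)
Lemma param_regular2 r p : r * g2 - p * g1 \in I -> exists v, r - v * g1 \in I.
Proof.
move=> rI.
have coefE i j k : i != j -> (ev o i j r)`_k * param2 = (ev o i j p)`_k * param1.
  move=> ij; have := ev_I o ij rI; rewrite ev_sub !ev_mul (g1E ij) (g2E ij).
  by move/eqP; rewrite subr_eq0 => /eqP/(congr1 (fun u : {poly D} => u`_k)); rewrite !coefMC.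
have /choice[C CE] : forall t : nat * 'I_n * 'I_n, exists c : D,
    t.1.2 != t.2 -> (ev o t.1.2 t.2 r)`_t.1.1 = param1 * c.
  move=> [[k i] j] /=; have [ij|] := boolP (i != j); last by exists 0.
  by have [c] := param_dvd (coefE i j k ij); exists c.
have cC k : compat (fun i j => C (k, i, j)).
  apply: (compat_div (compat_ev o r k) param1_compat) => i j ij; first by rewrite param1_coef0.
  exact: (CE (k, i, j)).
have [N szN] := ev_size_bound r; have [V VE] := realize_poly N cC.
exists V; apply: (I_of_ev (o := o) n2) => i j ij; rewrite ev_sub ev_mul (g1E ij) (VE _ _ ij).
apply/eqP; rewrite subr_eq0; apply/eqP/polyP => k; rewrite coefMC coef_poly.
case: ltnP => kN; first by rewrite (CE (k, i, j) ij) mulrC.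
by rewrite mul0r nth_default // (leq_trans (szN i j)).
Qed.

(** The ideal generated by the first two parameters, for the coefficients of the powers
    of z. *)
Definition param_ideal (u : 'I_n -> 'I_n -> D) : Prop := exists v w,
  [/\ compat v, compat w & forall i j, i != j -> u i j = v i j * param1 + w i j * param2].

Lemma param_ideal_ext u u' : (forall i j, i != j -> u i j = u' i j) -> param_ideal u -> param_ideal u'.
Proof. by move=> uu [v [w [cv cw uE]]]; exists v, w; split=> // i j ij; rewrite -uu // uE. Qed.

Lemma param_ideal0 : param_ideal (fun _ _ => 0).
Proof.
have c0 : compat (fun _ _ : 'I_n => 0 : D).
  by apply: compat_ext (compat_cst n 0) => i j _; rewrite rmorph0.
by exists (fun _ _ => 0), (fun _ _ => 0); split=> // i j _; rewrite !mul0r addr0.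
Qed.

Lemma param_idealB u u' : param_ideal u -> param_ideal u' -> param_ideal (fun i j => u i j - u' i j).
Proof.
move=> [v [w [cv cw uE]]] [v' [w' [cv' cw' uE']]].
exists (fun i j => v i j - v' i j), (fun i j => w i j - w' i j).
split=> [||i j ij]; [exact: compatB|exact: compatB|].
by rewrite (uE _ _ ij) (uE' _ _ ij); ring.
Qed.

Lemma param_idealZ c u : param_ideal u -> param_ideal (fun i j => cst K c * u i j).
Proof.
move=> [v [w [cv cw uE]]]; have cc := compat_cst n c.
exists (fun i j => cst K c * v i j), (fun i j => cst K c * w i j).
split=> [||i j ij]; [exact: compatM|exact: compatM|].
by rewrite (uE _ _ ij); ring.
Qed.

Lemma param_ideal_sum (T : Type) (s : seq T) (B : pred T) (u : T -> 'I_n -> 'I_n -> D) :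
  (forall t, B t -> param_ideal (u t)) -> param_ideal (fun i j => \sum_(t <- s | B t) u t i j).
Proof.
move=> uI; elim: s => [|t s IH].
  by apply: param_ideal_ext param_ideal0 => i j _; rewrite big_nil.
have [Bt|Bt] := boolP (B t); last first.
  by apply: param_ideal_ext IH => i j _; rewrite big_cons (negbTE Bt).
have := param_idealB (uI t Bt) (param_idealB param_ideal0 IH).
by apply: param_ideal_ext => i j _; rewrite big_cons Bt sub0r opprK.
Qed.

(** On V_ij the third parameter is a monic polynomial f(z) with constant
    coefficients; the coefficients of r are found in the ideal from the highest down. *)
Lemma param_regular3 r p q : r * param3 - (p * g1 + q * g2) \in I ->
  exists v w, r - (v * g1 + w * g2) \in I.
Proof.
move=> rI; have [N szN] := ev_size_bound r.
pose F : {poly D} := map_poly (@cst K) f; pose d := (size f).-1.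
have szf : size f = d.+1 by rewrite prednK // size_poly_gt0 monic_neq0.
have Fd : F`_d = 1 by rewrite coef_map /= -/(lead_coef f) (monicP monf) rmorph1.
have FrI k : param_ideal (fun i j => (F * ev o i j r)`_k).
  exists (fun i j => (ev o i j p)`_k), (fun i j => (ev o i j q)`_k).
  split=> [||i j ij]; [exact: compat_ev|exact: compat_ev|].
  have := ev_I o ij rI; rewrite ev_sub ev_add !ev_mul (g1E ij) (g2E ij) ev_param3.
  by move/eqP; rewrite subr_eq0 mulrC => /eqP ->; rewrite coefD !coefMC.
have rk k : param_ideal (fun i j => (ev o i j r)`_k).
  have [m] := ubnP (N - k); elim: m k => // m IH k; rewrite ltnS => km.
  have [Nk|kN] := leqP N k.
    apply: param_ideal_ext param_ideal0 => i j _.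
    by rewrite nth_default // (leq_trans (szN i j)).
  have dk : (d < (k + d).+1)%N by rewrite ltnS leq_addl.
  pose u (y : 'I_(k + d).+1) i j := cst K f`_y * (ev o i j r)`_(k + d - y).
  have uI : param_ideal (fun i j => \sum_(y | y != Ordinal dk) u y i j).
    apply: param_ideal_sum => y yd; rewrite /u.
    have [dy|yd'] := ltnP d y.
      apply: param_ideal_ext param_ideal0 => i j _.
      by rewrite [f`_y]nth_default ?rmorph0 ?mul0r // szf.
    apply: param_idealZ; apply: IH.
    have {yd'} yd : (y < d)%N.
      by rewrite ltn_neqAle yd' andbT; move: yd; rewrite -val_eqE.
    by move: km kN yd; clear; lia.
  apply: param_ideal_ext (param_idealB (FrI (k + d)%N) uI) => i j ij.
  rewrite coefM (bigD1 (Ordinal dk)) //= Fd mul1r addnK -addrA -sumrB.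
  by rewrite big1 ?addr0 // => y _; rewrite coef_map subrr.
have /choice[v /choice[w vw]] := rk.
have [V VE] := realize_poly N (fun k => let: And3 a _ _ := vw k in a).
have [W WE] := realize_poly N (fun k => let: And3 _ a _ := vw k in a).
exists V, W; apply: (I_of_ev (o := o) n2) => i j ij.
rewrite ev_sub ev_add !ev_mul (g1E ij) (g2E ij) (VE _ _ ij) (WE _ _ ij).
apply/eqP; rewrite subr_eq0; apply/eqP/polyP => k; rewrite coefD !coefMC !coef_poly.
case: ltnP => kN; first by have [_ _ ->] := vw k.
by rewrite !mul0r addr0 nth_default // (leq_trans (szN i j)).
Qed.
End RegularSequence.

(** * Cohen-Macaulayness in characteristic other than 2 *)

Lemma regular_sequence3 (A : comNzRingType) (a b c : A) :
  1 \notin span_ideal [:: a; b; c] ->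
  (forall x, x * a = 0 -> x = 0) ->
  (forall x p, x * b = p * a -> exists v, x = v * a) ->
  (forall x p q, x * c = p * a + q * b -> exists v w, x = v * a + w * b) ->
  regular_sequence [:: a; b; c].
Proof.
move=> nspan ra rb rc; split=> // -[|[|[|//]]] _ x /=.
- by rewrite !span_ideal_nil => /eqP/ra ->.
- by move/span_ideal1 => [p /rb]; case=> v ->; apply/span_ideal1; exists v.
by move/span_ideal2 => [p [q /rc]]; case=> v [w ->]; apply/span_ideal2; exists v, w.
Qed.

Section CharNot2.
Variables (K : fieldType) (n : nat).
Hypotheses (n5 : (5 <= n)%N) (K2 : 2%:R != 0 :> K).
Local Notation R := {mpoly K[n]}.
Local Notation I := (I_ideal K n (n - 2)).
Variable hI : idealr_closed I.
Local Notation A := (quotient_ring hI).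
Local Notation D := {poly {poly K}}.

Lemma point_algebraic_sub (L : fieldType) (g : {rmorphism R -> L}) (i j l : 'I_n) :
  const_off (fun k => g 'X_k) i j -> l != i -> l != j -> (forall y, exists r, g r = y) ->
  (exists2 p : {poly K}, p != 0 & root (map_poly (g \o @mpolyC n K) p) (g 'X_i - g 'X_l)) /\
  (exists2 p : {poly K}, p != 0 & root (map_poly (g \o @mpolyC n K) p) (g 'X_j - g 'X_l)).
Proof.
move=> gc li lj gs; set e := g \o _.
have gen (S : L -> Prop) : (forall x, S (e x)) -> S (g 'X_i - g 'X_l) -> S (g 'X_j - g 'X_l) ->
   S (g 'X_l) -> (forall x y, S x -> S y -> S (x + y)) -> (forall x y, S x -> S y -> S (x * y)) ->
   forall y, S y.
  move=> Se Si Sj Sl SD SM y; have [r <-] := gs y; move: r; apply: mpoly_alg_ind => //.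
  - move=> k; have [->|ki] := eqVneq k i; first by rewrite -(subrK (g 'X_l) (g 'X_i)); apply: SD.
    have [->|kj] := eqVneq k j; first by rewrite -(subrK (g 'X_l) (g 'X_j)); apply: SD.
    by rewrite (gc k l).
  - by move=> p q Sp Sq; rewrite rmorphD; apply: SD.
  - by move=> p q Sp Sq; rewrite rmorphM; apply: SM.
split.
  by apply: (@zariski3 _ _ e _ (g 'X_j - g 'X_l) (g 'X_l)) => S *; apply: gen.
by apply: (@zariski3 _ _ e _ (g 'X_i - g 'X_l) (g 'X_l)) => S *; apply: gen.
Qed.

Lemma scale_monic (p : {poly K}) : p != 0 -> (lead_coef p)^-1 *: p \is monic.
Proof. by move=> p0; rewrite monicE lead_coefZ mulVf ?lead_coef_eq0. Qed.

Lemma poly_at_swap (S T : comNzRingType) (e : {rmorphism S -> T}) (a b : T) (q : {poly S}) :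
  poly_at (poly_at e a) b q^:P = poly_at e b q.
Proof.
rewrite !poly_atE -map_poly_comp; congr (horner _ _); apply: eq_map_poly => c /=.
by rewrite poly_atC.
Qed.

(** The differences alpha, beta and the coordinate z of the point are algebraic over K;
    equations of alpha and beta, multiplied by X^2, give h, and an equation of z gives f. *)
Lemma regular_sequence_at_point (P : {pred A}) : maximal_ideal P -> exists s,
  [/\ regular_sequence s, {subset s <= P} & size s = 3].
Proof.
move=> maxP; have n2 : (2 < n)%N by apply: leq_trans n5.
have idP : is_ideal P by case: maxP => /is_ideal_closed.
have P1 : 1 \notin P by case: maxP => -[].
have [L [g [i [j [l [[ij li lj] gc gs Pg]]]]]] := maximal_point n2 maxP.
have [[pa pa0 ra] [pb pb0 rb]] := point_algebraic_sub gc li lj gs.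
have [pf pf0 rf] := point_algebraic li lj gc gs l.
pose e : {rmorphism K -> L} := g \o @mpolyC n K.
pose h1 : {poly K} := (lead_coef (pa * pb))^-1 *: (pa * pb).
pose h : {poly K} := 'X^2 * h1.
have monh : h \is monic by rewrite rpredM ?monicXn // scale_monic // mulf_neq0.
pose f : {poly K} := (lead_coef pf)^-1 *: pf.
have monf : f \is monic by exact: scale_monic.
have [g1 g1E] := compat_realized l n5 K2 (param1_compat n5 h1).
have [g2 g2E] := compat_realized l n5 K2 (param2_compat n h1).
pose t : R := (map_poly (@mpolyC n K) f).['X_l].
set a := g 'X_i - g 'X_l in ra; set b := g 'X_j - g 'X_l in rb.
have gE r : g r = at_point e a b (g 'X_l) (ev l i j r).
  rewrite -[RHS](at_pointE l e ij li lj gc r); move: r.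
  apply: (@mpoly_rmorph_eq _ _ _ g (mmap e (fun k => g 'X_k))) => [c|k] /=.
    by rewrite mmapC.
  by rewrite mmapXU.
have ha : poly_at e a h = 0.
  rewrite rmorphM /= /h1 -mul_polyC !rmorphM /= [poly_at e a pa](rootP ra).
  by rewrite mul0r !mulr0.
have hb : poly_at e b h = 0.
  rewrite rmorphM /= /h1 -mul_polyC !rmorphM /= [poly_at e b pb](rootP rb).
  by rewrite !mulr0.
have P0 x : poly_at e x h = 0 -> poly_at e x (h ^+ n.-1) = 0.
  by move=> hx; rewrite rmorphXn /= hx expr0n; case: (n) n5 => [|[|]].
have Q0 x : poly_at e x h = 0 -> poly_at e x (h^`() * h ^+ n.-2) = 0.
  by move=> hx; rewrite rmorphM rmorphXn /= hx expr0n; case: (n) n5 => [|[|[|m]]] //= _; rewrite mulr0.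
have gg1 : g g1 = 0.
  have eval_param (p q : {poly K}) : poly_at e a p = 0 -> poly_at e b p = 0 ->
      poly_at e a q = 0 -> poly_at e b q = 0 ->
      poly_at (poly_at e a) b (p%:P + p^:P - 'X * q%:P - 'X%:P * q^:P) = 0.
    move=> pa0' pb0' qa0 qb0; rewrite raddfB raddfB raddfD /= ![poly_at _ _ (_ * _)]rmorphM /=.
    by rewrite !poly_at_swap !poly_atC /= pa0' pb0' qa0 qb0 !mulr0 addr0 !subr0.
  rewrite gE (g1E _ _ ij) /at_point poly_atC /=.
  by apply: eval_param; [exact: P0|exact: P0|exact: Q0|exact: Q0].
have gg2 : g g2 = 0.
  rewrite gE (g2E _ _ ij) /at_point poly_atC /= /param2 -/h.
  by rewrite [LHS]rmorphM /= poly_atC /= ha mul0r.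
have gt : g t = 0.
  rewrite /t -horner_map -map_poly_comp /= /f linearZ /= hornerZ.
  by rewrite [_.[_]](rootP rf) mulr0.
exists [:: proj hI g1; proj hI g2; proj hI t]; split=> //; last first.
  by move=> x; rewrite !inE => /or3P[] /eqP->; rewrite Pg ?gg1 ?gg2 ?gt.
have sub : {subset span_ideal [:: proj hI g1; proj hI g2; proj hI t] <= P}.
  apply: span_idealP => // x; rewrite !inE => /or3P[] /eqP->; by rewrite Pg ?gg1 ?gg2 ?gt.
apply: regular_sequence3.
- by apply: contra P1; exact: sub.
- move=> x; rewrite -(coset_repK (x : A)) -rmorphM => /eqP; rewrite proj_eq0.
  by move/(param_regular1 n5 monh g1E) => xI; apply/eqP; rewrite proj_eq0.
- move=> x p; rewrite -(coset_repK (x : A)) -(coset_repK (p : A)) -!rmorphM => /eqP.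
  rewrite -subr_eq0 -rmorphB proj_eq0 => /(param_regular2 n5 monh K2 g1E g2E)[v].
  by rewrite -(proj_eq0 hI) rmorphB rmorphM subr_eq0 => /eqP ->; exists (proj hI v).
move=> x p q; rewrite -(coset_repK (x : A)) -(coset_repK (p : A)) -(coset_repK (q : A)) -!rmorphM -rmorphD => /eqP.
rewrite -subr_eq0 -rmorphB proj_eq0 => /(param_regular3 n5 monf K2 g1E g2E)[v [w]].
rewrite -(proj_eq0 hI) rmorphB rmorphD !rmorphM subr_eq0 => /eqP ->.
by exists (proj hI v), (proj hI w).
Qed.

Theorem cohen_macaulay_char_neq2 : cohen_macaulay A.
Proof.
apply: cohen_macaulay_of_regular; first exact: leq_trans n5.
exact: regular_sequence_at_point.
Qed.
End CharNot2.

(** * Failure of Cohen-Macaulayness in characteristic 2 *)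

Lemma sum_square (S : comNzRingType) n (F : 'I_n -> 'I_n -> S) :
  \sum_(i < n) \sum_j F i j = \sum_(i < n) F i i + \sum_(i < n) \sum_(j < n | (i < j)%N) (F i j + F j i).
Proof.
have -> : \sum_(i < n) \sum_(j < n | (i < j)%N) (F i j + F j i) =
    \sum_(i < n) \sum_(j < n | (i < j)%N) F i j + \sum_(i < n) \sum_(j < n | (j < i)%N) F i j.
  rewrite [X in _ + X](exchange_big_dep predT) //= -big_split.
  by apply: eq_bigr => i _; rewrite -big_split.
rewrite -!big_split; apply: eq_bigr => i _ /=.
rewrite (bigD1 i) //= (bigID (fun j : 'I_n => (i < j)%N)) /=; congr (_ + (_ + _)).
  by apply: eq_bigl => j; case: ltngtP; rewrite ?andbF //= => ij; rewrite andbT; apply: contraTneq ij => ->; rewrite ltnn.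
apply: eq_bigl => j; rewrite -leqNgt; rewrite leq_eqVlt; case: ltngtP; rewrite ?andbF ?orbT ?andbT //=.
  by move=> ji; apply: contraTneq ji => ->; rewrite ltnn.
by move/val_inj ->; rewrite eqxx.
Qed.

Section CharTwo.
Variables (K : fieldType) (n : nat) (o : 'I_n).
Hypotheses (n5 : (5 <= n)%N) (K2 : 2%:R = 0 :> K).
Local Notation R := {mpoly K[n]}.
Local Notation I := (I_ideal K n (n - 2)).
Implicit Types (i j k l : 'I_n) (y w p q r : R).
Let n2 : (2 < n)%N. Proof. exact: leq_trans n5. Qed.

Lemma I_ideal_ideal : is_ideal I.
Proof. by apply/is_ideal_closed/I_ideal_proper; rewrite leq_subr leq_subRL ltnW // ltnW. Qed.

(** Says that w is the product of y with the function s = t^2, where t is the common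
    value of the coordinates other than x_i and x_j. *)
Definition square_mul y w : Prop := forall i j l, i != j -> l != i -> l != j ->
  piece_sub i j l w = piece_sub i j l y * 'X_l ^+ 2.

Lemma square_mulD y y' w w' : square_mul y w -> square_mul y' w' -> square_mul (y + y') (w + w').
Proof. by move=> yw yw' i j l ij li lj; rewrite !rmorphD /= yw // yw' // mulrDl. Qed.

Lemma square_mulM r y w : square_mul y w -> square_mul (r * y) (r * w).
Proof. by move=> yw i j l ij li lj; rewrite !rmorphM /= yw // mulrA. Qed.

Lemma square_mulB y y' w w' : square_mul y w -> square_mul y' w' -> square_mul (y - y') (w - w').
Proof.
by move=> yw /(square_mulM (-1)); rewrite !mulN1r; apply: square_mulD.
Qed.

Lemma square_mul_cross y y' w w' : square_mul y w -> square_mul y' w' -> y * w' - y' * w \in I.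
Proof.
move=> yw yw'; apply: I_idealP => // i j l ij li lj.
by rewrite rmorphB !rmorphM /= yw // yw' //; ring.
Qed.

Lemma square_mul_uniq y w w' : square_mul y w -> square_mul y w' -> w - w' \in I.
Proof.
move=> yw yw'; apply: I_idealP => // i j l ij li lj.
by rewrite rmorphB /= yw // yw' // subrr.
Qed.

Lemma two_eq0 : 2%:R = 0 :> R.
Proof. by rewrite -(rmorph_nat (@mpolyC n K)) K2 rmorph0. Qed.

(** On V_ij, either k and o are outside {i, j} and both sides vanish, or at most one of
    x, y, z is in {i, j}; in the latter case the quadratic polynomial
    takes the value t^2 + 2 t u, where u is the third coordinate. *)
Lemma square_mul_gen k : exists w, square_mul ('X_k - 'X_o) w.
Proof.
have [->|ko] := eqVneq k o.
  by exists 0 => i j l _ _ _; rewrite subrr !rmorph0 mul0r.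
have [x] := @exists_fresh 4 n [:: k; o] n5 isT; rewrite !inE negb_or => /andP[xk xo].
have [y] := @exists_fresh 4 n [:: k; o; x] n5 isT; rewrite !inE !negb_or => /and3P[yk yo yx].
have [z] := @exists_fresh 4 n [:: k; o; x; y] n5 isT; rewrite !inE !negb_or => /and4P[zk zo zx zy].
exists (('X_k - 'X_o) * ('X_x * 'X_y + 'X_x * 'X_z + 'X_y * 'X_z)) => i j l ij li lj.
rewrite rmorphM /= rmorphB /= !rmorphD !rmorphM /= /piece_sub !mmapXU.
have pl u : u != i -> u != j -> piece_pt K i j l u = 'X_l.
  by move=> ui uj; rewrite /piece_pt ifN // negb_or ui.
have sq (u : R) : u * 'X_l + u * 'X_l + 'X_l * 'X_l = 'X_l ^+ 2.
  by rewrite (_ : _ + _ = 2%:R * (u * 'X_l) + 'X_l ^+ 2); [rewrite two_eq0; ring|ring].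
have two u u' v : u != u' -> u != v -> u' != v -> (v == i) || (v == j) -> (u != i) && (u != j) || (u' != i) && (u' != j).
  move=> uu' uv u'v; case/orP=> /eqP vE; subst v.
    by rewrite uv u'v /=; case: (u =P j) uu' => [->|//] /=; rewrite eq_sym.
  by rewrite uv u'v !andbT /=; case: (u =P i) uu' => [->|//] /=; rewrite eq_sym.
have xyn : x != y by rewrite eq_sym.
have xzn : x != z by rewrite eq_sym.
have yzn : y != z by rewrite eq_sym.
have main c : x != c -> y != c -> z != c -> (c == i) || (c == j) ->
    piece_pt K i j l x * piece_pt K i j l y + piece_pt K i j l x * piece_pt K i j l z
    + piece_pt K i j l y * piece_pt K i j l z = 'X_l ^+ 2.
  move=> xc yc zc cij.
  case/orP: (two x y c xyn xc yc cij) => [/andP[xi xj]|/andP[yi yj]].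
    case/orP: (two y z c yzn yc zc cij) => [/andP[yi yj]|/andP[zi zj]].
      by rewrite (pl x) // (pl y) // -(sq (piece_pt K i j l z)); ring.
    by rewrite (pl x) // (pl z) // -(sq (piece_pt K i j l y)); ring.
  case/orP: (two x z c xzn xc zc cij) => [/andP[xi xj]|/andP[zi zj]].
    by rewrite (pl x) // (pl y) // -(sq (piece_pt K i j l z)); ring.
  by rewrite (pl z) // (pl y) // -(sq (piece_pt K i j l x)); ring.
have [kij|kij] := boolP ((k == i) || (k == j)).
  by congr (_ * _); apply: (main k).
have [oij|oij] := boolP ((o == i) || (o == j)).
  by congr (_ * _); apply: (main o).
move: kij oij; rewrite !negb_or => /andP[? ?] /andP[? ?].
by rewrite (pl k) // (pl o) // subrr !mul0r.
Qed.

Definition diag : R -> {poly K} := mmap (@polyC K) (fun _ => 'X).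
HB.instance Definition _ := GRing.RMorphism.copy diag (mmap (@polyC K) (fun _ => 'X)).
Definition in_o : {poly K} -> R := poly_at (@mpolyC n K) 'X_o.
HB.instance Definition _ := GRing.RMorphism.copy in_o (poly_at (@mpolyC n K) 'X_o).

Lemma diag_in_o (p : {poly K}) : diag (in_o p) = p.
Proof.
elim/poly_ind: p => [|p c IH]; first by rewrite !rmorph0.
rewrite !rmorphD !rmorphM /= IH; congr (_ * _ + _).
  by rewrite /in_o poly_atX /diag mmapXU.
by rewrite /in_o poly_atC /diag mmapC.
Qed.

(** The polynomials that vanish on the diagonal are generated by the X_k - X_o. *)
Lemma square_mul_exists y : diag y = 0 -> exists w, square_mul y w.
Proof.
move=> y0; pose J : {pred R} := [pred y | `[< exists w, square_mul y w >]].
have JP x : reflect (exists w, square_mul x w) (x \in J) by apply: asboolP.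
have idJ : is_ideal J.
  split=> [|u v /JP[w uw] /JP[w' vw]|a u /JP[w uw]]; apply/JP.
  - by exists 0 => i j l _ _ _; rewrite !rmorph0 mul0r.
  - by exists (w + w'); apply: square_mulD.
  - by exists (a * w); apply: square_mulM.
have := @mmap_subst K n R (@mpolyC n K) (fun i => 'X_i) (fun _ => 'X_o) J 1 idJ _ y.
have yE : mmap (@mpolyC n K) (fun _ => 'X_o) y = in_o (diag y).
  move: (y); apply: (@mpoly_rmorph_eq K n R (mmap (@mpolyC n K) (fun _ => 'X_o)) (in_o \o diag)) => [c|k] /=.
    by rewrite mmapC /diag mmapC /in_o poly_atC.
  by rewrite mmapXU /diag mmapXU /in_o poly_atX.
rewrite mmap_id mulr1 yE y0 rmorph0 subr0 => H.
by apply/JP/H => k; rewrite mulr1; apply/JP; exact: square_mul_gen.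
Qed.

Local Notation C := {poly K}.
Local Notation D := {poly {poly C}}.

Definition offset i j k : D := (if k == i then 'X%:P else 0) + (if k == j then 'X else 0).
Definition cst3 : {rmorphism K -> D} := @polyC {poly C} \o (@polyC C \o @polyC K).
Definition base : D := 'X%:P%:P.

(** The point of V_ij near the point (t, ..., t) of the diagonal, where t is [base];
    the coefficients of the powers of alpha and beta are the Taylor coefficients of a
    polynomial on V_ij at this point. *)
Definition jet_pt i j k : D := base + (offset i j k - offset i j o).
Definition jet i j : R -> D := mmap cst3 (jet_pt i j).
HB.instance Definition _ i j := GRing.RMorphism.copy (jet i j) (mmap cst3 (jet_pt i j)).

Lemma jetM i j p q : jet i j (p * q) = jet i j p * jet i j q. Proof. exact: rmorphM. Qed.
Lemma jetD i j p q : jet i j (p + q) = jet i j p + jet i j q. Proof. exact: rmorphD. Qed.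
Lemma jetB i j p q : jet i j (p - q) = jet i j p - jet i j q. Proof. exact: rmorphB. Qed.
Lemma jetX i j k : jet i j 'X_k = jet_pt i j k. Proof. by rewrite /jet mmapXU. Qed.
Lemma jetC i j c : jet i j c%:MP = cst3 c. Proof. by rewrite /jet mmapC. Qed.

Lemma offset_off i j k : k != i -> k != j -> offset i j k = 0.
Proof. by move=> /negbTE ki /negbTE kj; rewrite /offset ki kj addr0. Qed.

Lemma jet_diff i j k : i != j -> k != i -> k != j ->
  jet i j ('X_i - 'X_k) = 'X%:P /\ jet i j ('X_j - 'X_k) = 'X.
Proof.
move=> ij ki kj; rewrite !jetB !jetX /jet_pt (offset_off ki kj) /offset !eqxx (negbTE ij).
by rewrite [j == i]eq_sym (negbTE ij); split; ring.
Qed.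

Lemma jet_const i j : const_off (jet_pt i j) i j.
Proof. by move=> k l ki kj li lj; rewrite /jet_pt (offset_off ki kj) (offset_off li lj). Qed.

Lemma jet_I i j p : i != j -> p \in I -> jet i j p = 0.
Proof. by move=> ij; apply: (@I_ideal_eval _ _ _ cst3 (jet_pt i j) i j p ij); apply: jet_const. Qed.

Lemma jet_eq i j p q : i != j -> p - q \in I -> jet i j p = jet i j q.
Proof. by move=> ij /(jet_I ij)/eqP; rewrite jetB subr_eq0 => /eqP. Qed.

Lemma jet_piece i j l p : i != j -> l != i -> l != j -> jet i j (piece_sub i j l p) = jet i j p.
Proof.
move=> ij li lj; move: p.
apply: (@mpoly_rmorph_eq K n D (jet i j \o piece_sub i j l) (jet i j)) => [c|k] /=.
  by rewrite /piece_sub mmapC.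
rewrite /piece_sub mmapXU /piece_pt; case: ifPn => [_|]; first by [].
by rewrite negb_or !jetX => /andP[ki kj]; apply: jet_const.
Qed.

Lemma jet_square i j y w : i != j -> square_mul y w ->
  jet i j w = jet i j y * (base - offset i j o) ^+ 2.
Proof.
move=> ij yw; have [l] := @exists_fresh 4 n [:: i; j] n5 isT; rewrite !inE negb_or => /andP[li lj].
have lE : jet i j ('X_l ^+ 2) = (base - offset i j o) ^+ 2.
  have -> : base - offset i j o = jet i j 'X_l.
    by rewrite jetX /jet_pt (offset_off li lj); congr (_ + _); apply/esym/sub0r.
  exact: rmorphXn.
by rewrite -(jet_piece w ij li lj) (yw _ _ _ ij li lj) jetM (jet_piece _ ij li lj) lE.
Qed.

Lemma jet_in_o i j (p : C) : jet i j (in_o p) = p%:P%:P.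
Proof.
elim/poly_ind: p => [|p c IH]; first by rewrite !rmorph0.
rewrite rmorphD jetD rmorphM jetM IH /= /in_o poly_atX jetX /jet_pt subrr addr0.
by rewrite poly_atC jetC !polyCD !polyCM.
Qed.

(** The 2-jet c + a_i alpha + a_j beta + b_i alpha^2 + b_j beta^2 + m_ij alpha beta of a
    function on the union of the V_ij; the inner coefficient is that of alpha. *)
Record jets (F : 'I_n -> 'I_n -> D) (c : C) (a b : 'I_n -> C) (m : 'I_n -> 'I_n -> C) : Prop := Jets {
  jets0 : forall i j, i != j -> (F i j)`_0`_0 = c;
  jets10 : forall i j, i != j -> (F i j)`_0`_1 = a i;
  jets01 : forall i j, i != j -> (F i j)`_1`_0 = a j;
  jets20 : forall i j, i != j -> (F i j)`_0`_2 = b i;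
  jets02 : forall i j, i != j -> (F i j)`_2`_0 = b j;
  jets11 : forall i j, i != j -> (F i j)`_1`_1 = m i j }.

Lemma coef2M (S : nzRingType) (p q : {poly S}) :
  (p * q)`_2 = p`_0 * q`_2 + (p`_1 * q`_1 + p`_2 * q`_0).
Proof. by rewrite coefM !big_ord_recl big_ord0 addr0. Qed.

Lemma coefM00 (F G : D) : (F * G)`_0`_0 = F`_0`_0 * G`_0`_0.
Proof. by rewrite (coef0M F G) (coef0M F`_0 G`_0). Qed.
Lemma coefM01 (F G : D) : (F * G)`_0`_1 = F`_0`_0 * G`_0`_1 + F`_0`_1 * G`_0`_0.
Proof. by rewrite (coef0M F G) (coef1M F`_0 G`_0). Qed.
Lemma coefM10 (F G : D) : (F * G)`_1`_0 = F`_0`_0 * G`_1`_0 + F`_1`_0 * G`_0`_0.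
Proof.
by rewrite (coef1M F G) (coefD (F`_0 * G`_1)) (coef0M F`_0 G`_1) (coef0M F`_1 G`_0).
Qed.
Lemma coefM02 (F G : D) : (F * G)`_0`_2 =
  F`_0`_0 * G`_0`_2 + F`_0`_1 * G`_0`_1 + F`_0`_2 * G`_0`_0.
Proof. by rewrite (coef0M F G) (coef2M F`_0 G`_0) addrA. Qed.
Lemma coefM20 (F G : D) : (F * G)`_2`_0 =
  F`_0`_0 * G`_2`_0 + F`_1`_0 * G`_1`_0 + F`_2`_0 * G`_0`_0.
Proof.
rewrite (coef2M F G) (coefD (F`_0 * G`_2)) (coefD (F`_1 * G`_1)) (coef0M F`_0 G`_2).
by rewrite (coef0M F`_1 G`_1) (coef0M F`_2 G`_0) addrA.
Qed.
Lemma coefM11 (F G : D) : (F * G)`_1`_1 =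
  F`_0`_0 * G`_1`_1 + (F`_0`_1 * G`_1`_0 + F`_1`_0 * G`_0`_1) + F`_1`_1 * G`_0`_0.
Proof.
rewrite (coef1M F G) (coefD (F`_0 * G`_1)) (coef1M F`_0 G`_1) (coef1M F`_1 G`_0).
by ring.
Qed.

(** The Taylor coefficients of degree 1 and 2 along (1, ..., 1) vanish.  In degree 2 this is
    the divided second derivative, which is meaningful in characteristic 2. *)
Definition flat (a b : 'I_n -> C) (m : 'I_n -> 'I_n -> C) : Prop :=
  \sum_i a i = 0 /\ \sum_i b i + \sum_(i < n) \sum_(j < n | (i < j)%N) m i j = 0.

(** The product rule for the divided second derivative along (1, ..., 1). *)
Lemma jets_sum (c c' : C) (a b a' b' : 'I_n -> C) (m m' : 'I_n -> 'I_n -> C) :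
  \sum_i (c * b' i + a i * a' i + b i * c') +
  \sum_(i < n) \sum_(j < n | (i < j)%N) (c * m' i j + (a i * a' j + a j * a' i) + m i j * c') =
  c * (\sum_i b' i + \sum_(i < n) \sum_(j < n | (i < j)%N) m' i j) + (\sum_i a i) * (\sum_i a' i)
  + (\sum_i b i + \sum_(i < n) \sum_(j < n | (i < j)%N) m i j) * c'.
Proof.
have E2 (P : 'I_n -> 'I_n -> C) :
    \sum_(i < n) \sum_(j < n | (i < j)%N) (c * m' i j + P i j + m i j * c') =
    c * (\sum_(i < n) \sum_(j < n | (i < j)%N) m' i j) + \sum_(i < n) \sum_(j < n | (i < j)%N) P i j
    + (\sum_(i < n) \sum_(j < n | (i < j)%N) m i j) * c'.
  rewrite mulr_sumr mulr_suml -!big_split; apply: eq_bigr => i _ /=.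
  by rewrite mulr_sumr mulr_suml -!big_split.
rewrite E2 !big_split /= -mulr_sumr -mulr_suml [(\sum_i a i) * _]big_distrlr /= sum_square.
by ring.
Qed.

Lemma jetsM F G c c' a a' b b' m m' : jets F c a b m -> jets G c' a' b' m' ->
  jets (fun i j => F i j * G i j) (c * c') (fun i => c * a' i + a i * c')
    (fun i => c * b' i + a i * a' i + b i * c')
    (fun i j => c * m' i j + (a i * a' j + a j * a' i) + m i j * c').
Proof.
move=> [f0 f1 f2 f3 f4 f5] [g0 g1 g2 g3 g4 g5]; split=> i j ij.
+ by rewrite coefM00 (f0 _ _ ij) (g0 _ _ ij).
+ by rewrite coefM01 (f0 _ _ ij) (g0 _ _ ij) (f1 _ _ ij) (g1 _ _ ij).
+ by rewrite coefM10 (f0 _ _ ij) (g0 _ _ ij) (f2 _ _ ij) (g2 _ _ ij).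
+ by rewrite coefM02 (f0 _ _ ij) (g0 _ _ ij) (f1 _ _ ij) (g1 _ _ ij) (f3 _ _ ij) (g3 _ _ ij).
+ by rewrite coefM20 (f0 _ _ ij) (g0 _ _ ij) (f2 _ _ ij) (g2 _ _ ij) (f4 _ _ ij) (g4 _ _ ij).
+ rewrite coefM11 (f0 _ _ ij) (g0 _ _ ij) (f1 _ _ ij) (g1 _ _ ij) (f2 _ _ ij) (g2 _ _ ij).
  by rewrite (f5 _ _ ij) (g5 _ _ ij) [a j * _]mulrC; congr (_ + _ + _); ring.
Qed.

(** The jets of polynomials are flat because those of the variables are, the point [jet_pt]
    being normalized by x_o = t. *)
Lemma jet_jets p : exists c a b m, [/\ jets (fun i j => jet i j p) c a b m, flat a b m & c = diag p].
Proof.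
move: p; apply: mpoly_alg_ind => [x|k|p q|p q].
- exists x%:P, (fun _ => 0), (fun _ => 0), (fun _ _ => 0); split.
  + by split=> i j _; rewrite jetC /cst3 /= !coefC /= ?coef0.
  + by split; rewrite !big1 ?addr0 // => i _; rewrite big1.
  + by rewrite /diag mmapC.
- have jp i j (s t : nat) : (jet_pt i j k)`_s`_t =
      base`_s`_t + ((offset i j k)`_s`_t - (offset i j o)`_s`_t).
    by rewrite /jet_pt coefD coefB coefD coefB.
  have op i j l (s t : nat) : (offset i j l)`_s`_t =
      ((l == i) && (s == 0%N) && (t == 1%N))%:R + ((l == j) && (s == 1%N) && (t == 0%N))%:R.
    rewrite /offset coefD coefD; congr (_ + _); case: eqP => _ /=; rewrite ?coef0 //.
      by rewrite coefC; case: (s == 0%N) => /=; rewrite ?coefX ?coef0.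
    by rewrite coefX; case: (s == 1%N); rewrite ?coef1 ?coef0.
  have bp (s t : nat) : base`_s`_t = if (s == 0%N) && (t == 0%N) then 'X else 0.
    rewrite /base coefC; case: s => [|s] /=; last exact: coef0.
    by rewrite coefC; case: t.
  exists 'X, (fun i => (k == i)%:R - (o == i)%:R), (fun _ => 0), (fun _ _ => 0); split.
  + by split=> i j ij; rewrite jetX jp !op bp /= ?andbF ?andbT /= ?mulr0n ?subr0 ?addr0 ?add0r ?subr0 ?addr0 ?oppr0.
  + have one x : \sum_i (x == i)%:R = 1 :> C.
      by rewrite (bigD1 x) //= eqxx big1 ?addr0 // => i; rewrite eq_sym => /negbTE ->.
    by split; rewrite ?sumrB ?one ?subrr // !big1 ?addr0 // => i _; rewrite big1.
  + by rewrite /diag mmapXU.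
- move=> [c [a [b [m [[f0 f1 f2 f3 f4 f5] [A B] cE]]]]] [c' [a' [b' [m' [[g0 g1 g2 g3 g4 g5] [A' B'] cE']]]]].
  exists (c + c'), (fun i => a i + a' i), (fun i => b i + b' i), (fun i j => m i j + m' i j); split.
  + by split=> i j ij; rewrite jetD !coefD; congr (_ + _); auto.
  + split; first by rewrite big_split /= A A' addr0.
    rewrite big_split /=; under [X in _ + X = _]eq_bigr => i _ do rewrite big_split.
    by rewrite big_split /= addrACA B B' addr0.
  + by rewrite cE cE' rmorphD.
move=> [c [a [b [m [jp [A B] cE]]]]] [c' [a' [b' [m' [jq [A' B'] cE']]]]].
exists (c * c'), (fun i => c * a' i + a i * c'), (fun i => c * b' i + a i * a' i + b i * c'),
  (fun i j => c * m' i j + (a i * a' j + a j * a' i) + m i j * c'); split.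
- by have [h0 h1 h2 h3 h4 h5] := jetsM jp jq; split=> i j ij; rewrite jetM; auto.
- split; first by rewrite big_split /= -mulr_sumr -mulr_suml A A' mulr0 mul0r addr0.
  by rewrite (jets_sum _ _) A B B' !mulr0 !mul0r !addr0.
by rewrite cE cE' rmorphM.
Qed.

(** The functions r k l / (x_k - x_l) coincide; on V_ij with k outside {i, j}
    the cases of x_i - x_k = alpha and x_j - x_k = beta show that the quotient is a
    polynomial. *)
Lemma common_quotient (r : 'I_n -> 'I_n -> R) :
  (forall k l k' l', ('X_k' - 'X_l') * r k l - ('X_k - 'X_l) * r k' l' \in I) ->
  exists h : 'I_n -> 'I_n -> D, forall i j k, i != j -> k != i -> k != j ->
    jet i j (r i k) = 'X%:P * h i j /\ jet i j (r j k) = 'X * h i j.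
Proof.
move=> rI.
have eqn i j k l k' l' : i != j -> jet i j ('X_k' - 'X_l') * jet i j (r k l) = jet i j ('X_k - 'X_l) * jet i j (r k' l').
  by move=> ij; rewrite -!jetM; apply: jet_eq ij (rI k l k' l').
have hP (t : 'I_n * 'I_n) : exists h : D, t.1 != t.2 -> forall k, k != t.1 -> k != t.2 ->
    jet t.1 t.2 (r t.1 k) = 'X%:P * h /\ jet t.1 t.2 (r t.2 k) = 'X * h.
  case: t => i j /=; have [ij|_] := boolP (i != j); last by exists 0.
  have X0 : 'X%:P != 0 :> D by rewrite polyC_eq0 polyX_eq0.
  have Y0 : 'X != 0 :> D by rewrite polyX_eq0.
  have [k0] := @exists_fresh 4 n [:: i; j] n5 isT; rewrite !inE negb_or => /andP[k0i k0j].
  have [xa xb] := jet_diff ij k0i k0j.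
  have ab := eqn i j i k0 j k0 ij; rewrite xa xb in ab.
  set ea := jet i j (r i k0) in ab; set eb := jet i j (r j k0) in ab.
  have eb0 : eb`_0 = 0.
    have := congr1 (fun u : D => u`_0) ab; rewrite coefXM coefCM /= => /esym/eqP.
    by rewrite mulf_eq0 polyX_eq0 => /eqP.
  have ebE : eb = 'X * drop_poly 1 eb.
    by apply/polyP => -[|t]; rewrite coefXM //= coef_drop_poly addn1.
  have eaE : ea = 'X%:P * drop_poly 1 eb.
    by apply: (mulfI Y0); rewrite ab {1}ebE mulrCA.
  exists (drop_poly 1 eb) => _ k ki kj; have [ya yb] := jet_diff ij ki kj; split.
    by rewrite -eaE; apply: (mulfI X0); rewrite -{1}xa -ya; exact: eqn.
  by rewrite -ebE; apply: (mulfI Y0); rewrite -{1}xb -yb; exact: eqn.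
have /choice[h hE] := hP; exists (fun i j => h (i, j)) => i j k ij ki kj.
exact: (hE (i, j) ij k ki kj).
Qed.

(** By the hypotheses a1 s + q = a h, where h is the common quotient of the r k l by
    the x_k - x_l.  The divided second derivative along (1, ..., 1) is 0 on q
    and 1 on s; on a h it is the product of that of h with the value
    t a1 of a on the diagonal, since a is flat.  Hence a1 (1 - t T) = 0 for some T. *)
Lemma square_not_divisible (a q : R) (a1 : C) (w r : 'I_n -> 'I_n -> R) :
  diag a = 'X * a1 -> (forall k l, square_mul ('X_k - 'X_l) (w k l)) ->
  (forall k l, in_o a1 * w k l + q * ('X_k - 'X_l) - a * r k l \in I) ->
  (forall k l k' l', ('X_k' - 'X_l') * r k l - ('X_k - 'X_l) * r k' l' \in I) ->
  a1 = 0.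
Proof.
move=> da wE wI rI; have [h hE] := common_quotient rI.
have fresh2 i j : exists k, k != i /\ k != j.
  by have [k] := @exists_fresh 4 n [:: i; j] n5 isT; rewrite !inE negb_or => /andP[]; exists k.
have fresh3 i j j' : exists k, [/\ k != i, k != j & k != j'].
  by have [k] := @exists_fresh 4 n [:: i; j; j'] n5 isT; rewrite !inE !negb_or => /and3P[]; exists k.
have h0 i j k : i != j -> k != i -> k != j ->
    (h i j)`_0`_0 = (jet i j (r i k))`_0`_1 /\ (h i j)`_0`_1 = (jet i j (r i k))`_0`_2.
  by move=> ij ki kj; have [-> _] := hE i j k ij ki kj; rewrite !coefCM !coefXM.
have h1 i j k : i != j -> k != i -> k != j ->
    (h i j)`_0`_0 = (jet i j (r j k))`_1`_0 /\ (h i j)`_1`_0 = (jet i j (r j k))`_2`_0.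
  by move=> ij ki kj; have [_ ->] := hE i j k ij ki kj; rewrite !coefXM.
have hax i j j' : i != j -> i != j' -> (h i j)`_0`_0 = (h i j')`_0`_0 /\ (h i j)`_0`_1 = (h i j')`_0`_1.
  move=> ij ij'; have [k [ki kj kj']] := fresh3 i j j'.
  have [c [A [B [M [[_ f1 _ f3 _ _] _ _]]]]] := jet_jets (r i k).
  have [-> ->] := h0 i j k ij ki kj; have [-> ->] := h0 i j' k ij' ki kj'.
  by rewrite (f1 _ _ ij) (f1 _ _ ij') (f3 _ _ ij) (f3 _ _ ij').
have hsw i j : i != j -> (h i j)`_0`_0 = (h j i)`_0`_0 /\ (h i j)`_1`_0 = (h j i)`_0`_1.
  move=> ij; have [k [ki kj]] := fresh2 i j; have ji : j != i by rewrite eq_sym.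
  have [c [A [B [M [[_ f1 f2 f3 f4 _] _ _]]]]] := jet_jets (r j k).
  have [-> ->] := h1 i j k ij ki kj; have [-> ->] := h0 j i k ji kj ki.
  by rewrite (f1 _ _ ji) (f2 _ _ ij) (f3 _ _ ji) (f4 _ _ ij).
have /choice[d dP] : forall i, exists j, i != j.
  by move=> i; have [j [ji _]] := fresh2 i i; exists j; rewrite eq_sym.
pose s i := (h i (d i))`_0`_1; pose c0 := (h o (d o))`_0`_0.
have hs i j : i != j -> (h i j)`_0`_1 = s i by move=> ij; have [_ ->] := hax i j (d i) ij (dP i).
have hs' i j : i != j -> (h i j)`_1`_0 = s j.
  by move=> ij; have [_ ->] := hsw i j ij; apply: hs; rewrite eq_sym.
have hc i j : i != j -> (h i j)`_0`_0 = c0.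
  move=> ij; have [io|io] := eqVneq i o.
    by subst i; have [-> _] := hax o j (d o) ij (dP o).
  have oi : o != i by rewrite eq_sym.
  have [-> _] := hax i j o ij io; have [-> _] := hsw i o io.
  by have [-> _] := hax o i (d o) oi (dP o).
pose q' := q + in_o a1 * 'X_o ^+ 2.
have [c [A [B [M [[f0 f1 f2 f3 f4 f5] [A0 B0] cE]]]]] := jet_jets a.
have [c' [A' [B' [M' [[g0 g1 g2 g3 g4 g5] [A0' B0'] cE']]]]] := jet_jets q'.
have D2 : 2%:R = 0 :> D by rewrite -(rmorph_nat cst3) K2 rmorph0.
have key i j : i != j -> a1%:P%:P * offset i j o ^+ 2 + jet i j q' = jet i j a * h i j.
  move=> ij; have [k [ki kj]] := fresh2 i j.
  have [xa _] := jet_diff ij ki kj; have [ra _] := hE i j k ij ki kj.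
  have X0 : 'X%:P != 0 :> D by rewrite polyC_eq0 polyX_eq0.
  have := jet_I ij (wI i k); rewrite jetB jetD !jetM (jet_square ij (wE i k)) xa ra jet_in_o => e0.
  apply: (mulfI X0).
  have -> : jet i j q' = jet i j q + a1%:P%:P * base ^+ 2.
    rewrite jetD jetM jet_in_o expr2 jetM jetX -expr2; congr (_ + _ * _ ^+ 2).
    by rewrite /jet_pt subrr addr0.
  move: e0; move: (jet i j q) (jet i j a) (h i j) (offset i j o) (a1%:P%:P : D) (base) ('X%:P : D) => Q F H e A1 z X e0.
  apply/eqP; rewrite -subr_eq0.
  rewrite (_ : _ - _ = (A1 * (X * (z - e) ^+ 2) + Q * X - F * (X * H)) + 2%:R * (X * A1 * z * e)); last by ring.
  by rewrite D2 mul0r addr0 e0.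
have o0 i j (x y : nat) : (offset i j o)`_x`_y =
      ((o == i) && (x == 0%N) && (y == 1%N))%:R + ((o == j) && (x == 1%N) && (y == 0%N))%:R.
  rewrite /offset coefD coefD; congr (_ + _); case: eqP => _ /=; rewrite ?coef0 //.
    by rewrite coefC; case: x => [|x] /=; rewrite ?coefX ?coef0.
  by rewrite coefX; case: (x == 1%N); rewrite ?coef1 ?coef0.
have e20 i j : i != j -> ((offset i j o) ^+ 2)`_0`_2 = (o == i)%:R.
  by move=> _; rewrite expr2 coefM02 !o0 /= ?andbF ?andbT; case: (o == i) => /=; ring.
have e11 i j : i != j -> ((offset i j o) ^+ 2)`_1`_1 = 0.
  move=> ij; rewrite expr2 coefM11 !o0 /= ?andbF ?andbT.
  have : ~~ ((o == i) && (o == j)) by case: eqP => [->|//]; rewrite ij.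
  by case: (o == i); case: (o == j) => //= _; ring.
have key20 i : a1 * (o == i)%:R + B' i = c * (h i (d i))`_0`_2 + A i * s i + B i * c0.
  have := congr1 (fun u : D => u`_0`_2) (key i (d i) (dP i)).
  rewrite coefD coefD coefCM coefCM (e20 _ _ (dP i)) (g3 _ _ (dP i)) coefM02 => ->.
  by rewrite (f0 _ _ (dP i)) (f1 _ _ (dP i)) (f3 _ _ (dP i)) (hs _ _ (dP i)) (hc _ _ (dP i)).
have key11 i j : i != j -> M' i j = c * (h i j)`_1`_1 + (A i * s j + A j * s i) + M i j * c0.
  move=> ij; have := congr1 (fun u : D => u`_1`_1) (key i j ij).
  rewrite coefD coefD coefCM coefCM (e11 _ _ ij) (g5 _ _ ij) mulr0 add0r coefM11 => ->.
  rewrite (f0 _ _ ij) (f1 _ _ ij) (f2 _ _ ij) (f5 _ _ ij) (hs _ _ ij) (hs' _ _ ij) (hc _ _ ij).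
  by ring.
pose T := \sum_i (h i (d i))`_0`_2 + \sum_(i < n) \sum_(j < n | (i < j)%N) (h i j)`_1`_1.
have : \sum_i (a1 * (o == i)%:R + B' i) + \sum_(i < n) \sum_(j < n | (i < j)%N) M' i j = c * T.
  rewrite (eq_bigr _ (fun i _ => key20 i)).
  rewrite [X in _ + X = _](eq_bigr (fun i => \sum_(j < n | (i < j)%N) (c * (h i j)`_1`_1 + (A i * s j + A j * s i) + M i j * c0))).
    by rewrite (jets_sum _ _) A0 B0 !mul0r !addr0.
  move=> i _; apply: eq_bigr => j ij; apply: key11.
  by apply: contraTneq ij => ->; rewrite ltnn.
rewrite big_split /= -addrA B0' addr0 -mulr_sumr (bigD1 o) //= eqxx big1 ?addr0 ?mulr1.
  rewrite cE da => a1E; apply/eqP; rewrite -[_ == _]negbK; apply/negP => a10.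
  have : a1 * (1 - 'X * T) == 0 by rewrite mulrBr mulr1 {1}a1E; apply/eqP; ring.
  rewrite mulf_eq0 (negbTE a10) subr_eq0 => /eqP /(congr1 (fun u : C => u`_0)).
  by rewrite coef1 coefXM => /eqP; rewrite oner_eq0.
by move=> i; rewrite eq_sym => /negbTE ->.
Qed.

Section RegularTriple.
Variables a b c : R.
Hypotheses (a0 : (diag a)`_0 = 0) (b0 : (diag b)`_0 = 0) (c0 : (diag c)`_0 = 0).
Hypothesis reg_a : forall r, r * a \in I -> r \in I.
Hypothesis reg_b : forall r p, r * b - p * a \in I -> exists v, r - v * a \in I.
Hypothesis reg_c : forall r p q, r * c - (p * a + q * b) \in I ->
  exists v w, r - (v * a + w * b) \in I.

Lemma diag_factor p : (diag p)`_0 = 0 -> exists p1 : C, diag p = 'X * p1.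
Proof.
move=> p0; exists (drop_poly 1 (diag p)); apply/polyP => -[|t]; rewrite coefXM //=.
by rewrite coef_drop_poly addn1.
Qed.

(** On the diagonal a and b are t a1 and t b1, so that z = (b1 a - a1 b) s is
    in A.  The parameter c maps z into the ideal (a, b), hence z = v a + v' b.  Then
    (a1 s + v') (x_k - x_l) is divisible by a for all k and l, and a1 = 0 by
    [square_not_divisible]; likewise b1 = 0.  Now s a and s b are in A, and
    since (s a) b = (s b) a the function s a is a multiple u a of a.  Then s and u coincide,
    contradicting [square_not_divisible] with a replaced by x_o. *)
Lemma regular_triple_false : False.
Proof.
have idI := I_ideal_ideal.
have [a1 da] := diag_factor a0; have [b1 db] := diag_factor b0; have [c1 dc] := diag_factor c0.
have dX k : diag 'X_k = 'X by rewrite /diag mmapXU.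
have dM p q : diag (p * q) = diag p * diag q by exact: rmorphM.
have dB p q : diag (p - q) = diag p - diag q by exact: rmorphB.
have [w wE] : exists w : 'I_n -> 'I_n -> R, forall k l, square_mul ('X_k - 'X_l) (w k l).
  have /choice[w wE] : forall t : 'I_n * 'I_n, exists w, square_mul ('X_t.1 - 'X_t.2) w.
    by move=> t; apply: square_mul_exists; rewrite dB !dX subrr.
  by exists (fun k l => w (k, l)) => k l; apply: (wE (k, l)).
have [z zE] : exists z, square_mul (in_o b1 * a - in_o a1 * b) z.
  apply: square_mul_exists; rewrite dB !dM !diag_in_o da db.
  by ring.
have [wa waE] : exists w, square_mul (a - 'X_o * in_o a1) w.
  by apply: square_mul_exists; rewrite dB dM diag_in_o dX da subrr.
have [wb wbE] : exists w, square_mul (b - 'X_o * in_o b1) w.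
  by apply: square_mul_exists; rewrite dB dM diag_in_o dX db subrr.
have [wc wcE] : exists w, square_mul (c - 'X_o * in_o c1) w.
  by apply: square_mul_exists; rewrite dB dM diag_in_o dX dc subrr.
(* the maximal ideal sends z into the ideal generated by a and b *)
have xz : 'X_o * z - (wa * b - wb * a) \in I.
  apply: (square_mul_uniq (y := 'X_o * (in_o b1 * a - in_o a1 * b))); first exact: square_mulM.
  have := square_mulB (square_mulM b waE) (square_mulM a wbE).
  by congr square_mul; ring.
have yz y w' : square_mul y w' -> y * z - (in_o b1 * w' * a - in_o a1 * w' * b) \in I.
  move=> yw; have := square_mul_cross yw zE; congr (_ \in I); ring.
have [v [v' vE]] : exists v v', z - (v * a + v' * b) \in I.
  apply: (reg_c (p := in_o b1 * wc - in_o c1 * wb) (q := in_o c1 * wa - in_o a1 * wc)).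
  have := idealD idI (yz _ _ wcE) (idealM idI (in_o c1) xz).
  congr (_ \in I); ring.
have rex (t : 'I_n * 'I_n) : exists r, in_o a1 * w t.1 t.2 + v' * ('X_t.1 - 'X_t.2) - r * a \in I.
  apply: (reg_b (p := in_o b1 * w t.1 t.2 - ('X_t.1 - 'X_t.2) * v)).
  have := idealB idI (idealM idI (- ('X_t.1 - 'X_t.2)) vE) (idealN idI (yz _ _ (wE t.1 t.2))).
  by congr (_ \in I); ring.
have /choice[r' rE'] := rex; pose r k l := r' (k, l).
have rE k l : in_o a1 * w k l + v' * ('X_k - 'X_l) - a * r k l \in I.
  by have := rE' (k, l); rewrite /= [_ * a]mulrC.
have rcross k l k' l' : ('X_k' - 'X_l') * r k l - ('X_k - 'X_l) * r k' l' \in I.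
  apply: reg_a.
  have h1 := idealM idI ('X_k - 'X_l) (rE k' l'); have h2 := idealM idI ('X_k' - 'X_l') (rE k l).
  have h3 := idealM idI (in_o a1) (square_mul_cross (wE k' l') (wE k l)).
  have := idealD idI (idealB idI h1 h2) h3; congr (_ \in I); ring.
have a10 : a1 = 0 := square_not_divisible da wE rE rcross.
have b10 : b1 = 0.
  apply: (square_not_divisible (q := - v) db wE _ rcross) => k l; apply: reg_a.
  have := idealD idI (idealB idI (idealM idI ('X_k - 'X_l) vE) (yz _ _ (wE k l))) (idealM idI b (rE k l)).
  by congr (_ \in I); ring.
have waE' : square_mul a wa by move: waE; rewrite a10 rmorph0 mulr0 subr0.
have wbE' : square_mul b wb by move: wbE; rewrite b10 rmorph0 mulr0 subr0.
have [u uE] : exists u, wa - u * a \in I.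
  apply: (reg_b (p := wb)); have := square_mul_cross wbE' waE'; congr (_ \in I); ring.
have wu k l : w k l - ('X_k - 'X_l) * u \in I.
  apply: reg_a; have := idealD idI (square_mul_cross waE' (wE k l)) (idealM idI ('X_k - 'X_l) uE).
  by congr (_ \in I); ring.
have /eqP : (1 : C) = 0.
  apply: (square_not_divisible (a := 'X_o) (q := - u) (r := fun _ _ => 0) _ wE) => [|k l|k l k' l'].
  - by rewrite dX mulr1.
  - by have := wu k l; congr (_ \in I); rewrite rmorph1; ring.
  - by rewrite !mulr0 subrr ideal0.
by rewrite oner_eq0.
Qed.
End RegularTriple.

Variable hI : idealr_closed I.
Local Notation A := (quotient_ring hI).

Definition origin : {pred A} := fun x => (diag (coset_rep x))`_0 == 0.

Lemma diag_I p : p \in I -> diag p = 0.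
Proof.
have [j] := @exists_fresh 4 n [:: o] n5 isT; rewrite inE => jo.
exact: (@I_ideal_eval _ _ _ (@polyC K) (fun _ => 'X) j o p jo).
Qed.

Lemma origin_proj p : (proj hI p \in origin) = ((diag p)`_0 == 0).
Proof.
have pE : diag (coset_rep (proj hI p)) = diag p.
  apply/eqP; rewrite -subr_eq0 -rmorphB; apply/eqP/diag_I.
  by rewrite -(proj_eq0 hI) rmorphB /= coset_repK subrr.
by rewrite unfold_in pE.
Qed.

Lemma origin_maximal : maximal_ideal origin.
Proof.
split; first split.
- by rewrite -(rmorph0 (proj hI)) origin_proj rmorph0 coef0.
- by rewrite -(rmorph1 (proj hI)) origin_proj rmorph1 coef1 oner_eq0.
- move=> a u v; rewrite -(coset_repK a) -(coset_repK u) -(coset_repK v).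
  rewrite -rmorphM -rmorphD !origin_proj rmorphD rmorphM /= coefD coef0M => /eqP -> /eqP ->.
  by rewrite mulr0 addr0.
move=> J /[dup] idJ' /is_ideal_closed idJ PJ x xJ; rewrite -(coset_repK x) origin_proj; apply: contraT => x0.
set c := (diag _)`_0 in x0.
have : proj hI (coset_rep x - c%:MP) \in J.
  by apply: PJ; rewrite origin_proj rmorphB /= {2}/diag mmapC coefB coefC subrr.
rewrite rmorphB /= coset_repK => xc.
have cJ : proj hI c%:MP \in J by rewrite -(subKr x (proj _ _)); apply: idealB.
case: idJ' => _ /negP []; rewrite -(rmorph1 (proj hI)) -mpolyC1 -(mulVf x0) mpolyCM rmorphM.
exact: idealM.
Qed.

Theorem not_cohen_macaulay_char2 : ~ cohen_macaulay A.
Proof.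
move/(regular_of_cohen_macaulay n2)/(_ origin_maximal) => [s [[_ sreg] sP szs]].
case: s szs sreg sP => [|a [|b [|c s]]] // _ sreg sP.
have aP : a \in origin by apply: sP; rewrite inE eqxx.
have bP : b \in origin by apply: sP; rewrite !inE eqxx orbT.
have cP : c \in origin by apply: sP; rewrite !inE eqxx !orbT.
have ra := sreg 0%N isT; have rb := sreg 1%N isT; have rc := sreg 2%N isT.
rewrite /= in ra rb rc.
apply: (@regular_triple_false (coset_rep a) (coset_rep b) (coset_rep c)) => [||||r p|r p q].
- by apply/eqP; rewrite -origin_proj coset_repK.
- by apply/eqP; rewrite -origin_proj coset_repK.
- by apply/eqP; rewrite -origin_proj coset_repK.
- move=> r; rewrite -!(proj_eq0 hI) rmorphM /= coset_repK => r0.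
  by have := ra (proj hI r); rewrite !span_ideal_nil; apply.
- rewrite -(proj_eq0 hI) rmorphB !rmorphM /= !coset_repK subr_eq0 => /eqP rE.
  have /span_ideal1[v vE] : proj hI r \in span_ideal [:: a] by apply: rb; apply/span_ideal1; exists (proj hI p).
  by exists (coset_rep v); rewrite -(proj_eq0 hI) rmorphB rmorphM /= !coset_repK vE subrr.
rewrite -(proj_eq0 hI) rmorphB rmorphD !rmorphM /= !coset_repK subr_eq0 => /eqP rE.
have /span_ideal2[v [w vE]] : proj hI r \in span_ideal [:: a; b].
  by apply: rc; apply/span_ideal2; exists (proj hI p), (proj hI q).
by exists (coset_rep v), (coset_rep w); rewrite -(proj_eq0 hI) rmorphB rmorphD !rmorphM /= !coset_repK vE subrr.
Qed.
End CharTwo.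

(** * A filtration of the ideal of the diagonal *)

Section Filtration.
Variables (K : fieldType) (n : nat) (o u : 'I_n).
Hypotheses (n5 : (5 <= n)%N) (uo : u != o).
Local Notation R := {mpoly K[n]}.
Local Notation I := (I_ideal K n (n - 2)).
Local Notation psub i j l := (@piece_sub K n i j l).
Implicit Types (i j k l a b c d e : 'I_n) (p q r F : R).

(** The ideal generated by G and the members of a finite family, written with one
    coefficient for each of them. *)
Definition span_mod (T : finType) (B : pred T) (gen : T -> R) (G : {pred R}) : {pred R} :=
  [pred p | `[< exists P : T -> R, p - \sum_(t | B t) P t * gen t \in G >]].

Lemma span_modP (T : finType) (B : pred T) (gen : T -> R) (G : {pred R}) p :
  reflect (exists P : T -> R, p - \sum_(t | B t) P t * gen t \in G) (p \in @span_mod T B gen G).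
Proof. exact: asboolP. Qed.

Lemma span_mod_ideal (T : finType) (B : pred T) (gen : T -> R) (G : {pred R}) : is_ideal G -> is_ideal (@span_mod T B gen G).
Proof.
move=> idG; split=> [|p q /span_modP[P pP] /span_modP[Q qQ]|r p /span_modP[P pP]]; apply/span_modP.
- by exists (fun _ => 0); rewrite big1 ?subr0 ?ideal0 // => t _; rewrite mul0r.
- exists (fun t => P t + Q t); under eq_bigr => t _ do rewrite mulrDl.
  by rewrite big_split /= opprD addrACA idealD.
exists (fun t => r * P t); under eq_bigr => t _ do rewrite -mulrA.
by rewrite -mulr_sumr -mulrBr idealM.
Qed.

Lemma span_mod_sub (T : finType) (B : pred T) (gen : T -> R) (G : {pred R}) : {subset G <= @span_mod T B gen G}.
Proof.
move=> p pG; apply/span_modP; exists (fun _ => 0); rewrite big1 ?subr0 // => t _.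
by rewrite mul0r.
Qed.

Lemma span_mod_gen (T : finType) (B : pred T) (gen : T -> R) (G : {pred R}) (t : T) : is_ideal G -> B t -> gen t \in @span_mod T B gen G.
Proof.
move=> idG Bt; apply/span_modP; exists (fun s => (s == t)%:R).
rewrite (bigD1 t) //= eqxx mul1r big1 ?addr0 ?subrr ?ideal0 // => s /andP[_ /negbTE ->].
by rewrite mul0r.
Qed.

Lemma span_mod_least (T : finType) (B : pred T) (gen : T -> R) (G H : {pred R}) : is_ideal H ->
  {subset G <= H} -> (forall t, B t -> gen t \in H) -> {subset span_mod B gen G <= H}.
Proof.
move=> idH GH genH p /span_modP[P /GH pP]; rewrite -(subrK (\sum_(t | B t) P t * gen t) p).
by apply: idealD => //; apply: ideal_sum => // t Bt; apply: idealM => //; apply: genH.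
Qed.

(** If the variables act on the generator t modulo H in the same way as the [pt t k],
    its coefficient can be replaced by the substitution at [pt t]. *)
Lemma span_mod_reduce (T : finType) (B : pred T) (gen : T -> R) (G H : {pred R}) (pt : T -> 'I_n -> R) F : is_ideal H ->
  {subset G <= H} ->
  (forall t k, B t -> ('X_k - pt t k) * gen t \in H) -> F \in @span_mod T B gen G ->
  exists P : T -> R, F - \sum_(t | B t) mmap (@mpolyC n K) (pt t) (P t) * gen t \in H.
Proof.
move=> idH GH ptH /span_modP[P FP]; exists P.
have := idealD idH (GH _ FP) (ideal_sum idH (index_enum T) (P := B)
  (F := fun t => (P t - mmap (@mpolyC n K) (pt t) (P t)) * gen t) _).
have -> : \sum_(t | B t) (P t - mmap (@mpolyC n K) (pt t) (P t)) * gen t =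
    \sum_(t | B t) P t * gen t - \sum_(t | B t) mmap (@mpolyC n K) (pt t) (P t) * gen t.
  by rewrite -sumrB; apply: eq_bigr => t _; rewrite mulrBl.
rewrite addrA subrK; apply => t Bt.
have := @mmap_subst K n R (@mpolyC n K) (fun i => 'X_i) (pt t) H (gen t) idH (fun k => ptH t k Bt) (P t).
by rewrite mmap_id mulrBl.
Qed.

(** Once the coefficients are reduced, the substitution psi t isolates the generator t,
    and the coefficient of t has to vanish because psi t F = 0. *)
Lemma span_mod_step (T : finType) (B : pred T) (gen : T -> R) (G H : {pred R})
    (pt : T -> 'I_n -> R) (psi : T -> {rmorphism R -> R}) F : is_ideal H ->
  {subset G <= H} ->
  (forall t k, B t -> ('X_k - pt t k) * gen t \in H) ->
  (forall t s, B t -> B s -> s != t -> psi t (gen s) = 0) ->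
  (forall t q h, B t -> h \in H ->
     psi t (mmap (@mpolyC n K) (pt t) q * gen t) = psi t h -> mmap (@mpolyC n K) (pt t) q = 0) ->
  (forall t, B t -> psi t F = 0) -> F \in span_mod B gen G -> F \in H.
Proof.
move=> idH GH ptH off cancel F0 /(span_mod_reduce idH GH ptH)[P FP].
have P0 t : B t -> mmap (@mpolyC n K) (pt t) (P t) = 0; last first.
  by move: FP; rewrite big1 ?subr0 // => t /P0 ->; rewrite mul0r.
move=> Bt; apply: (cancel _ _ _ Bt (idealN idH FP)).
rewrite rmorphN rmorphB /= F0 // sub0r opprK rmorph_sum /= (bigD1 t) //= [X in _ + X]big1 ?addr0 //.
by move=> s /andP[Bs st]; rewrite rmorphM /= (off t s) ?mulr0.
Qed.

Lemma psub_I i j l p : l != i -> l != j -> p \in I -> psub i j l p = 0.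
Proof.
move=> li lj pI; have [ij|ij] := eqVneq i j; last first.
  by apply: (@I_ideal_eval _ _ _ _ (piece_pt K i j l) i j p ij) => //; apply: piece_pt_const.
rewrite -{j}ij in lj *; apply: (@I_ideal_eval _ _ _ _ (piece_pt K i i l) i l p _) => //.
  by rewrite eq_sym.
by move=> k k' ki kl k'i k'l; rewrite /piece_pt !orbb (negbTE ki) (negbTE k'i).
Qed.

Lemma psubX i j l k : psub i j l 'X_k = if (k == i) || (k == j) then 'X_k else 'X_l.
Proof. by rewrite /piece_sub mmapXU. Qed.

Lemma psubK i j l p : l != i -> l != j -> psub i j l (psub i j l p) = psub i j l p.
Proof.
move=> /negbTE li /negbTE lj; move: p.
apply: (@mpoly_rmorph_eq K n R (psub i j l \o psub i j l) (psub i j l)) => [c|k] /=.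
  by rewrite /piece_sub !mmapC.
rewrite psubX; case: ifP => kij; first by rewrite psubX kij.
by rewrite psubX li lj.
Qed.

Lemma psub_twice i j l p : l != i -> l != j -> psub i j l (psub i i l p) = psub i i l p.
Proof.
move=> /negbTE li /negbTE lj; move: p.
apply: (@mpoly_rmorph_eq K n R (psub i j l \o psub i i l) (psub i i l)) => [c|k] /=.
  by rewrite /piece_sub !mmapC.
rewrite psubX orbb; case: ifP => ki; first by rewrite psubX ki.
by rewrite psubX li lj.
Qed.

Definition dx k : R := 'X_k - 'X_o.

Lemma dx_neq0 k : k != o -> dx k != 0.
Proof.
move=> ko; rewrite subr_eq0; apply: contra_neq ko => /(congr1 (meval (fun l => (l == k)%:R : K))).
rewrite !mevalXU eqxx; case: eqP => // _ /eqP; by rewrite oner_eq0.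
Qed.

Lemma dxB_neq0 k l : k != l -> dx k - dx l != 0.
Proof.
move=> kl; rewrite (_ : _ - _ = 'X_k - 'X_l); last by rewrite /dx; ring.
rewrite subr_eq0; apply: contra_neq kl => /(congr1 (meval (fun j => (j == k)%:R : K))).
rewrite !mevalXU eqxx; case: eqP => // _ /eqP; by rewrite oner_eq0.
Qed.

Lemma psub_dx_o i j k : psub i j o (dx k) = if (k == i) || (k == j) then dx k else 0.
Proof.
rewrite /dx rmorphB /= !psubX; have -> : (if (o == i) || (o == j) then 'X_o else 'X_o) = 'X_o :> R by case: ifP.
by case: ifP => // _; rewrite subrr.
Qed.

Lemma psub_dx e l k : l != o -> psub o e l (dx k) = if (k == o) || (k == e) then dx k else dx l.
Proof. by move=> lo; rewrite /dx rmorphB /= !psubX eqxx /=; case: ifP. Qed.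

Lemma psub_dx3 i j k l m : uniq [:: o; k; l; m] -> psub i j o (dx k * dx l * dx m) = 0.
Proof.
rewrite /= !inE !rmorphM /= !psub_dx_o => H.
case: ifP => [hk|]; last by rewrite !mul0r.
case: ifP => [hl|]; last by rewrite mulr0 mul0r.
case: ifP => [hm|]; last by rewrite mulr0.
move: hk hl hm H => /orP[]/eqP-> /orP[]/eqP-> /orP[]/eqP->; by rewrite ?eqxx ?orbT ?andbF.
Qed.

(** The first three layers of the filtration are generated by the products of one,
    two and three of the dx k with distinct k. *)
Definition span1 := span_mod (fun a => a != o) dx (pred1 0).
Definition pair_index (t : 'I_n * 'I_n) := [&& t.1 != o, t.2 != o & (t.1 < t.2)%N].
Definition span2 := span_mod pair_index (fun t => dx t.1 * dx t.2) (pred1 0).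
Definition triple_index (t : 'I_n * 'I_n * 'I_n) := uniq [:: o; t.1.1; t.1.2; t.2].
Definition span3 := span_mod triple_index (fun t => dx t.1.1 * dx t.1.2 * dx t.2) (pred1 0).
Let id0 : is_ideal (pred1 (0 : R)) := is_ideal0 _.

Lemma sub0_ideal (H : {pred R}) : is_ideal H -> {subset pred1 0 <= H}.
Proof. by move=> idH p; rewrite inE => /eqP ->; apply: ideal0. Qed.

Lemma in_span1 F : F \in I -> F \in span1.
Proof.
move=> FI; have idJ := span_mod_ideal (fun a => a != o) dx id0.
have := @mmap_subst K n R (@mpolyC n K) (fun i => 'X_i) (fun _ => 'X_o) span1 1 idJ _ F.
rewrite mmap_id mulr1 (@I_ideal_eval _ _ _ _ _ o u) ?subr0 1?eq_sym // ?[u == o]eq_sym //; apply=> k.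
rewrite mulr1; have [->|ko] := eqVneq k o; first by rewrite subrr ideal0.
exact: (span_mod_gen dx id0 ko).
Qed.

Lemma span2_gen k l : k != o -> l != o -> k != l -> dx k * dx l \in span2.
Proof.
move=> ko lo kl; case: (ltngtP k l) => [lt|lt|/val_inj/eqP]; last by rewrite (negbTE kl).
  by apply: (span_mod_gen (t := (k, l)) _ id0); rewrite /pair_index /= ko lo.
by rewrite mulrC; apply: (span_mod_gen (t := (l, k)) _ id0); rewrite /pair_index /= ko lo.
Qed.

Lemma span3_gen k l m : uniq [:: o; k; l; m] -> dx k * dx l * dx m \in span3.
Proof. by move=> U; apply: (span_mod_gen (t := (k, l, m)) _ id0). Qed.

Lemma psub_kill (T : finType) (B : pred T) (gen : T -> R) (G : {pred R}) (f : {rmorphism R -> R}) :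
  (forall p, p \in G -> f p = 0) -> (forall t, B t -> f (gen t) = 0) ->
  forall p, p \in span_mod B gen G -> f p = 0.
Proof.
move=> fG fgen p /span_modP[P pP]; rewrite -(subrK (\sum_(t | B t) P t * gen t) p) rmorphD /= fG //.
by rewrite rmorph_sum /= big1 ?addr0 // => t Bt; rewrite rmorphM /= fgen ?mulr0.
Qed.

(** Collapsing all the variables but x_t onto x_o isolates the generator dx t, and
    modulo [span2] all the other dx k act on it as zero. *)
Lemma in_span2 F : F \in I -> F \in span2.
Proof.
move=> FI; have idJ : is_ideal span2 by apply: span_mod_ideal.
apply: (span_mod_step (pt := fun t => piece_pt K t t o) (psi := fun t => piece_sub t t o) idJ _ _ _ _ _ (in_span1 FI)).
- exact: sub0_ideal.
- move=> t k to; rewrite /piece_pt orbb; have [->|kt] := eqVneq k t; first by rewrite subrr mul0r ideal0.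
  have [->|ko] := eqVneq k o; first by rewrite subrr mul0r ideal0.
  exact: span2_gen.
- by move=> t s to so /negbTE st; rewrite /= psub_dx_o orbb st.
- move=> t q h to hJ; rewrite /= -/(psub t t o q).
  rewrite (psub_kill _ _ hJ) => [|p /eqP -> | s]; rewrite ?rmorph0 //; last first.
    rewrite /pair_index => /and3P[_ _]; rewrite rmorphM /= !psub_dx_o !orbb.
    case: (eqVneq s.1 t) => [->|]; last by rewrite mul0r.
    by case: (eqVneq s.2 t) => [->|]; rewrite ?ltnn // mulr0.
  rewrite rmorphM /= psub_dx_o eqxx psubK 1?eq_sym // => /eqP; rewrite mulf_eq0 (negbTE (dx_neq0 to)) orbF.
  by move/eqP.
by move=> t to; rewrite /= psub_I // eq_sym.
Qed.

(** The same with two variables x_a and x_b that are not collapsed. *)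
Lemma in_span3 F : F \in I -> F \in span3.
Proof.
move=> FI; have idJ : is_ideal span3 by apply: span_mod_ideal.
apply: (span_mod_step (pt := fun t => piece_pt K t.1 t.2 o) (psi := fun t => piece_sub t.1 t.2 o) idJ _ _ _ _ _ (in_span2 FI)).
- exact: sub0_ideal.
- move=> [a b] k /and3P[/= ao bo ab]; rewrite /piece_pt; case: ifPn; first by rewrite subrr mul0r ideal0.
  rewrite negb_or => /andP[ka kb]; have [->|ko] := eqVneq k o; first by rewrite subrr mul0r ideal0.
  rewrite -/(dx k) mulrA; apply: span3_gen; rewrite /= !inE ![o == _]eq_sym !negb_or ko ao bo ka kb /= andbT.
  by apply: contraTneq ab => ->; rewrite ltnn.
- move=> [a b] [c d] /and3P[/= ao bo ab] /and3P[/= co do_ cd] ne; rewrite rmorphM /= !psub_dx_o.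
  case: ifP => [/orP[]/eqP E0|]; rewrite ?mul0r //; case: ifP => [/orP[]/eqP E'|]; rewrite ?mulr0 //.
  + by rewrite E0 E' ltnn in cd.
  + by rewrite E0 E' eqxx in ne.
  + by rewrite E0 E' ltnNge ltnW in cd.
  + by rewrite E0 E' ltnn in cd.
- move=> [a b] q h /and3P[/= ao bo ab] hJ; rewrite /= -/(psub a b o q).
  rewrite (psub_kill _ _ hJ) => [|p /eqP -> | [[k l] m]]; rewrite ?rmorph0 //; last exact: psub_dx3.
  rewrite !rmorphM /= !psub_dx_o !eqxx orbT /= psubK 1?eq_sym // 1?eq_sym // => /eqP.
  rewrite !mulf_eq0 (negbTE (dx_neq0 ao)) (negbTE (dx_neq0 bo)) !orbF.
  by move/eqP.
by move=> [a b] /and3P[/= ao bo _]; rewrite psub_I // eq_sym.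
Qed.

Lemma span3_least (H : {pred R}) : is_ideal H ->
  (forall k l m, uniq [:: o; k; l; m] -> dx k * dx l * dx m \in H) -> {subset span3 <= H}.
Proof. by move=> idH H3; apply: span_mod_least => //; [exact: sub0_ideal | move=> t; apply: H3]. Qed.

(** The differences of two triple products that share two indices. *)
Definition delta a b c d : R := dx a * dx b * (dx c - dx d).

Lemma psub_delta e l a b c d : l != o -> psub o e l (delta a b c d) =
  let z k := if (k == o) || (k == e) then dx k else dx l in z a * z b * (z c - z d).
Proof. by move=> lo; rewrite /delta 2!rmorphM /= (psub_dx e a) // (psub_dx e b) // (rmorphB _ (dx c)) /= !psub_dx. Qed.

Section Top.
Variables (G : {pred R}) (w eps : 'I_n -> R).
Hypotheses (idG : is_ideal G) (GI : {subset G <= I}).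

(** The last two layers.  The second differences (dx c - dx k) * delta a b c d depend only
    on c modulo G; eps c is one of them, and w c is a delta a b c u for a fixed u. *)
Definition span_eps := span_mod (fun c => c != o) eps G.
Definition span_delta := span_mod (fun c => (c != o) && (c != u)) w span_eps.
Hypothesis R1 : forall a b c d k l, uniq [:: o; a; b; c; d] -> k \notin [:: o; c; d] ->
  l \notin [:: o; c; d] -> (dx k - dx l) * delta a b c d \in G.
Hypothesis R3 : forall a b c d k, uniq [:: o; a; b; c; d] -> k \notin [:: o; c; d] ->
  (dx c - dx k) * delta a b c d - eps c \in G.
Hypothesis epsE : forall c, c != o -> exists a b d k, [/\ uniq [:: o; a; b; c; d], k \notin [:: o; c; d]
  & eps c = (dx c - dx k) * delta a b c d].
Hypothesis V : forall a b c d, uniq [:: o; a; b; c; d] -> delta a b c d - (w c - w d) \in span_eps.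
Hypothesis wu : w u = 0.
Hypothesis wE : forall c, c != o -> c != u -> exists a b, uniq [:: o; a; b; c; u] /\ w c = delta a b c u.

Lemma exists_fresh_pair c d : c != o -> d != o -> c != d -> exists a b, uniq [:: o; a; b; c; d].
Proof.
move=> co do_ cd; have [//|a] := @exists_fresh 4 n [:: o; c; d] n5; rewrite !inE !negb_or => /and3P[ao ac ad].
have [//|b] := @exists_fresh 4 n [:: o; c; d; a] n5; rewrite !inE !negb_or => /and4P[bo bc bd ba]; exists a, b.
by rewrite /= !inE !negb_or ![o == _]eq_sym ao bo co do_ ac ad bc bd cd eq_sym ba.
Qed.

Lemma span_eps_ideal : is_ideal span_eps. Proof. exact: span_mod_ideal. Qed.
Lemma span_delta_ideal : is_ideal span_delta. Proof. exact: span_mod_ideal span_eps_ideal. Qed.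
Lemma sub_span_eps : {subset G <= span_eps}. Proof. exact: span_mod_sub. Qed.
Lemma sub_span_delta : {subset span_eps <= span_delta}. Proof. exact: span_mod_sub. Qed.

(** Choose a representative of eps c whose index d differs from k and l. *)
Lemma eps_slide c k l : c != o -> k != c -> l != c -> k != o -> l != o -> (dx k - dx l) * eps c \in G.
Proof.
move=> co kc lc ko lo; have [->|kl] := eqVneq k l; first by rewrite subrr mul0r ideal0.
have [//|d] := @exists_fresh 4 n [:: o; c; k; l] n5; rewrite !inE !negb_or => /and4P[do_ dc dk dl].
have [|a [b U]] := @exists_fresh_pair c d co do_; first by rewrite eq_sym.
have nk : k \notin [:: o; c; d] by rewrite !inE !negb_or ko kc eq_sym.
have nl : l \notin [:: o; c; d] by rewrite !inE !negb_or lo lc eq_sym.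
have := idealB idG (idealM idG (dx c - dx k) (R1 U nk nl)) (idealM idG (dx k - dx l) (R3 U nk)).
by congr (_ \in G); ring.
Qed.

Lemma eps_in a b c d k : uniq [:: o; a; b; c; d] -> k \notin [:: o; c; d] ->
  (dx c - dx k) * delta a b c d \in span_eps.
Proof.
move=> U nk; have co : c != o by distinct.
by rewrite -(subrK (eps c) (_ * _)); apply: (idealD span_eps_ideal); [apply: sub_span_eps (R3 U nk) | apply: span_mod_gen].
Qed.

Lemma delta_slide1 a b c d k : uniq [:: o; a; b; c; d] -> k != o -> (dx k - dx a) * delta a b c d \in span_eps.
Proof.
move=> U ko; have na : a \notin [:: o; c; d] by distinct.
have [kc|kc] := eqVneq k c; first by rewrite kc; apply: eps_in.
have [kd|kd] := eqVneq k d; last by apply/sub_span_eps/R1 => //; rewrite !inE !negb_or ko kc kd.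
have U' : uniq [:: o; a; b; d; c] by distinct.
have na' : a \notin [:: o; d; c] by distinct.
rewrite kd; have := idealN span_eps_ideal (eps_in U' na'); congr (_ \in span_eps); rewrite /delta; ring.
Qed.

Lemma delta_slide a b c d k l : uniq [:: o; a; b; c; d] -> k != o -> l != o ->
  (dx k - dx l) * delta a b c d \in span_eps.
Proof.
move=> U ko lo; have := idealB span_eps_ideal (delta_slide1 U ko) (delta_slide1 U lo).
by congr (_ \in span_eps); ring.
Qed.

Lemma delta_in a b c d : uniq [:: o; a; b; c; d] -> delta a b c d \in span_delta.
Proof.
move=> U; have [co do_] : c != o /\ d != o by split; distinct.
have wD e : e != o -> w e \in span_delta.
  move=> eo; have [->|eu] := eqVneq e u; first by rewrite wu ideal0 //; apply: span_delta_ideal.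
  by apply: span_mod_gen span_eps_ideal _; rewrite eo eu.
rewrite -(subrK (w c - w d) (delta _ _ _ _)); apply: (idealD span_delta_ideal); first by apply/sub_span_delta/V.
by apply: (idealB span_delta_ideal); apply: wD.
Qed.

Lemma mu_exchange k l m m' : uniq [:: o; k; l; m] -> uniq [:: o; k; l; m'] ->
  dx k * dx l * dx m - dx k * dx l * dx m' \in span_delta.
Proof.
move=> U U'; have [->|mm'] := eqVneq m m'; first by rewrite subrr ideal0 //; apply: span_delta_ideal.
rewrite -mulrBr; apply: delta_in; distinct.
Qed.

(** Any two triples are joined by exchanging one index at a time. *)
Lemma mu_all k l m k' l' m' : uniq [:: o; k; l; m] -> uniq [:: o; k'; l'; m'] ->
  dx k * dx l * dx m - dx k' * dx l' * dx m' \in span_delta.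
Proof.
pose D p q := p - q \in span_delta.
have Dt p q r : D p q -> D q r -> D p r.
  by move=> pq qr; have := idealD span_delta_ideal pq qr; rewrite addrA subrK.
pose mu k l m := dx k * dx l * dx m.
have rot a b c : mu a b c = mu b c a by rewrite /mu; ring.
have exch a b c d : uniq [:: o; a; b; c] -> uniq [:: o; a; b; d] -> D (mu a b c) (mu a b d).
  exact: mu_exchange.
move=> U U'; have [k'o [l'o m'o]] : k' != o /\ l' != o /\ m' != o by split; [|split]; distinct.
have [b [c [U1 D1]]] : exists b c, uniq [:: o; k'; b; c] /\ D (mu k l m) (mu k' b c).
  have [->|k'k] := eqVneq k' k; first by exists l, m; rewrite /D subrr ideal0 //; apply: span_delta_ideal.
  have [->|k'l] := eqVneq k' l.
    by exists m, k; rewrite rot; split; [distinct | rewrite /D subrr ideal0 //; apply: span_delta_ideal].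
  have [->|k'm] := eqVneq k' m.
    by exists k, l; rewrite -rot; split; [distinct | rewrite /D subrr ideal0 //; apply: span_delta_ideal].
  by exists k, l; rewrite [mu k' k l]rot; split; [distinct | apply: exch; distinct].
have [c' [U2 D2]] : exists c', uniq [:: o; k'; l'; c'] /\ D (mu k l m) (mu k' l' c').
  have [l'b|l'b] := eqVneq l' b; first by exists c; rewrite l'b.
  have [l'c|l'c] := eqVneq l' c.
    by exists b; rewrite l'c; split; [distinct | move: D1; congr D; rewrite /mu; ring].
  exists c; split; first by distinct.
  apply: Dt D1 _; rewrite -[mu k' b c]rot -[mu k' l' c]rot; apply: exch; distinct.
by apply: Dt D2 _; apply: exch.
Qed.

(** The triple product can be replaced by one whose third factor is dx k, where (dx k - dx l) *
    dx a * dx b is a [delta]. *)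
Lemma mu_slide k l a b c : uniq [:: o; a; b; c] -> k != o -> l != o ->
  (dx k - dx l) * (dx a * dx b * dx c) \in span_delta.
Proof.
move=> U ko lo; have [->|kl] := eqVneq k l; first by rewrite subrr mul0r ideal0 //; apply: span_delta_ideal.
have [a' [b' U']] := exists_fresh_pair ko lo kl; have U2 : uniq [:: o; a'; b'; k] by distinct.
have := idealD span_delta_ideal (idealM span_delta_ideal (dx k - dx l) (mu_all U U2)) (idealM span_delta_ideal (dx k) (delta_in U')).
by congr (_ \in span_delta); rewrite /delta; ring.
Qed.

Lemma psub_eps c e l : c != o -> e != o -> l != o ->
  psub o c l (eps e) = (e == c)%:R * ((dx c - dx l) ^+ 2 * dx l ^+ 2).
Proof.
move=> co eo lo; have [a [b [d [k [U nk ->]]]]] := epsE eo.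
rewrite rmorphM (rmorphB _ (dx e)) /= !psub_dx // psub_delta // /=.
have [-> ->] : (a == o) = false /\ (b == o) = false by split; apply/negbTE; distinct.
have [-> ->] : (d == o) = false /\ (k == o) = false by split; apply/negbTE; distinct.
rewrite (negbTE eo) /=; have [<-|ec] := eqVneq e c; last first.
  rewrite mul0r; case: (eqVneq d c) nk => [<-|dc] nk; last by rewrite /= subrr !mulr0.
  have -> : (k == d) = false by apply/negbTE; distinct.
  by rewrite subrr mul0r.
have [-> ->] : (a == e) = false /\ (b == e) = false by split; apply/negbTE; distinct.
have [-> ->] : (d == e) = false /\ (k == e) = false by split; apply/negbTE; distinct.
by rewrite mul1r; ring.
Qed.

Lemma psub_span_eps c l h : c != o -> l != o -> l != c -> h \in span_eps ->
  exists r, psub o c l h = r * ((dx c - dx l) ^+ 2 * dx l ^+ 2).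
Proof.
move=> co lo lc /span_modP[P /GI/(psub_I lo lc)]; rewrite rmorphB /= => /eqP; rewrite subr_eq0 => /eqP ->.
exists (psub o c l (P c)); rewrite rmorph_sum /= (bigD1 c) //= big1 => [|e /andP[eo /negbTE ec]].
  by rewrite rmorphM /= psub_eps // eqxx mul1r addr0.
by rewrite rmorphM /= psub_eps // ec mul0r mulr0.
Qed.

(** Modulo [span_delta] all the triple products agree, and all the variables but x_o act
    on them in the same way.  The substitution of x_u for all of these maps a triple
    product to dx u ^+ 3 and all the [delta] to 0. *)
Lemma in_span_delta F : F \in I -> F \in span_delta.
Proof.
have uo' : uniq [:: o; u] by rewrite /= inE eq_sym uo.
have [//|a na] := @exists_fresh 4 n [:: o; u] n5; have [//|b nb] := @exists_fresh 4 n [:: o; u; a] n5.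
have U : uniq [:: o; u; a; b] by distinct.
move=> FI.
pose M := span_mod (fun _ : unit => true) (fun _ => dx u * dx a * dx b) span_delta.
have FM : F \in M.
  move: (in_span3 FI); apply: span3_least; first exact: span_mod_ideal span_delta_ideal.
  move=> k l m U'; rewrite -(subrK (dx u * dx a * dx b) (_ * dx m)).
  apply: (idealD (span_mod_ideal _ _ span_delta_ideal)); first by apply/span_mod_sub/mu_all.
  exact: (span_mod_gen (t := tt) _ span_delta_ideal).
have killG : forall p, p \in G -> psub o o u p = 0 by move=> p /GI; apply: psub_I.
have kill_delta a' b' c' d' : uniq [:: o; a'; b'; c'; d'] -> psub o o u (delta a' b' c' d') = 0.
  move=> U'; rewrite psub_delta //= !orbb.
  have [-> ->] : (c' == o) = false /\ (d' == o) = false by split; apply/negbTE; distinct.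
  by rewrite /= subrr mulr0.
apply: (span_mod_step (pt := fun _ => piece_pt K o o u) (psi := fun _ => piece_sub o o u) span_delta_ideal _ _ _ _ _ FM).
- by [].
- move=> _ k _; rewrite /piece_pt orbb; have [->|ko] := eqVneq k o; first by rewrite subrr mul0r ideal0 //; apply: span_delta_ideal.
  by have := mu_slide U ko uo; rewrite /dx opprB addrA subrK.
- by move=> [] [].
- move=> _ q h _ hD; rewrite /= -/(psub o o u q).
  rewrite (psub_kill _ _ hD) => [|p pE|c /andP[co cu]].
  + rewrite !rmorphM /= !psub_dx // !orbb (negbTE uo) psubK //.
    have [-> ->] : (a == o) = false /\ (b == o) = false by split; apply/negbTE; distinct.
    by move/eqP; rewrite !mulf_eq0 (negbTE (dx_neq0 uo)) !orbF => /eqP.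
  + move: pE; apply: (psub_kill (f := piece_sub o o u)) => // c co.
    have [a' [b' [d [k [U' nk ->]]]]] := epsE co.
    by rewrite rmorphM /= kill_delta ?mulr0.
  by have [a' [b' [U' ->]]] := wE co cu; apply: kill_delta.
by move=> _ _; rewrite /= psub_I.
Qed.

(** The substitution onto V_oc isolates w c, but maps the [eps] to multiples of
    (dx c - dx u)^2.  Since w c becomes a multiple of dx c - dx u only, its coefficient is
    divisible by dx c - dx u, while it does not involve x_c. *)
Lemma in_span_eps F : F \in I -> F \in span_eps.
Proof.
move=> FI.
apply: (span_mod_step (pt := fun _ => piece_pt K o o u) (psi := fun c => piece_sub o c u) span_eps_ideal _ _ _ _ _ (in_span_delta FI)).
- by [].
- move=> c k /andP[co cu]; rewrite /piece_pt orbb; have [->|ko] := eqVneq k o; first by rewrite subrr mul0r ideal0 //; apply: span_eps_ideal.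
  have [a [b [U ->]]] := wE co cu.
  by have := delta_slide U ko uo; rewrite /dx opprB addrA subrK.
- move=> c d /andP[co cu] /andP[do_ du] /negbTE dc.
  have [a [b [U ->]]] := wE do_ du.
  rewrite /= psub_delta //= (negbTE do_) (negbTE uo) dc /= if_same subrr mulr0 //.
- move=> c q h /andP[co cu] hE; rewrite /= -/(psub o o u q).
  have [a [b [U ->]]] := wE co cu.
  have uc : u != c by rewrite eq_sym.
  have [r ->] := psub_span_eps co uo uc hE; rewrite rmorphM /= psub_delta //= eqxx orbT (negbTE uo) (negbTE uc).
  have [-> ->] : (a == o) = false /\ (b == o) = false by split; apply/negbTE; distinct.
  have [-> ->] : (a == c) = false /\ (b == c) = false by split; apply/negbTE; distinct.
  set p := psub o o u q => /= Eq.
  have pK : psub o c u p = p.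
    exact: psub_twice.
  rewrite pK in Eq.
  have {}Eq : p = r * (dx c - dx u).
    apply/eqP; rewrite -subr_eq0; apply/eqP.
    apply: (mulIf (mulf_neq0 (mulf_neq0 (dx_neq0 uo) (dx_neq0 uo)) (dxB_neq0 cu))).
    by rewrite mul0r mulrBl Eq; ring.
  rewrite -[p]psubK // -/p Eq rmorphM rmorphB /= !psub_dx // !orbb (negbTE co) (negbTE uo).
  by rewrite /= subrr mulr0.
by move=> c /andP[co cu]; rewrite /= psub_I // eq_sym.
Qed.

(** The substitution onto V_oc maps eps c to a nonzero square and the other [eps] to 0. *)
Lemma in_G F : F \in I -> F \in G.
Proof.
move=> FI; have [//|v nv] := @exists_fresh 4 n [:: o; u] n5; have [vo vu] : v != o /\ v != u by split; distinct.
pose l c := if c == u then v else u.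
have lo c : l c != o by rewrite /l; case: ifP.
have lc c : l c != c by rewrite /l; case: (eqVneq c u) => [->|] //; rewrite eq_sym.
apply: (span_mod_step (pt := fun c => piece_pt K o c (l c)) (psi := fun c => piece_sub o c (l c)) idG _ _ _ _ _ (in_span_eps FI)).
- by [].
- move=> c k co; rewrite /piece_pt; case: ifPn; first by rewrite subrr mul0r ideal0.
  rewrite negb_or => /andP[ko kc]; have := eps_slide co kc (lc c) ko (lo c).
  by rewrite /dx opprB addrA subrK.
- by move=> c d co do_ /negbTE dc; rewrite /= psub_eps // dc mul0r.
- move=> c q h co /GI hI; rewrite /= -/(psub o c (l c) q) (psub_I _ _ hI) // rmorphM /= psubK // psub_eps // eqxx mul1r.
  move/eqP; rewrite !mulf_eq0.
  have /dxB_neq0/negbTE -> : c != l c by rewrite eq_sym.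
  by rewrite (negbTE (dx_neq0 (lo c))) !orbF => /eqP.
by move=> c co; rewrite /= psub_I.
Qed.
End Top.

(** The four relations say, modulo G, that dx k * delta a b c d is the same for all k outside
    {o, c, d}, that delta a b c d does not depend on a and b, that it is the difference
    of a function of c and the same function of d, and that its second differences do not
    depend on d. *)
Theorem I_sub_of_exchange (G : {pred R}) : is_ideal G -> {subset G <= I} ->
  (forall a b c d k l, uniq [:: o; a; b; c; d] -> k \notin [:: o; c; d] ->
    l \notin [:: o; c; d] -> (dx k - dx l) * delta a b c d \in G) ->
  (forall a b a' b' c d, uniq [:: o; a; b; c; d] -> uniq [:: o; a'; b'; c; d] ->
    delta a b c d - delta a' b' c d \in G) ->
  (forall c d, uniq [:: o; u; c; d] -> exists a b a1 b1 a2 b2,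
    [/\ uniq [:: o; a; b; c; d], uniq [:: o; a1; b1; c; u], uniq [:: o; a2; b2; d; u]
      & delta a b c d = delta a1 b1 c u - delta a2 b2 d u]) ->
  (forall c d d', uniq [:: o; c; d; d'] -> exists a b k a' b' k',
    [/\ uniq [:: o; a; b; c; d] && (k \notin [:: o; c; d]),
        uniq [:: o; a'; b'; c; d'] && (k' \notin [:: o; c; d'])
      & (dx c - dx k) * delta a b c d - (dx c - dx k') * delta a' b' c d' \in G]) ->
  {subset I <= G}.
Proof.
move=> idG GI R1 R0 cocycle swap F.
have [w wP] : exists w : 'I_n -> R, forall c, (c == u -> w c = 0) /\
    (c != o -> c != u -> exists a b, uniq [:: o; a; b; c; u] /\ w c = delta a b c u).
  apply: (@fin_all_exists _ (fun _ => R) (fun c v => (c == u -> v = 0) /\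
    (c != o -> c != u -> exists a b, uniq [:: o; a; b; c; u] /\ v = delta a b c u))) => c.
  have [->|cu] := eqVneq c u; first by exists 0.
  have [->|co] := eqVneq c o; first by exists 0.
  by have [a [b U]] := exists_fresh_pair co uo cu; exists (delta a b c u); split=> // _ _; exists a, b.
have [eps epsP] : exists eps : 'I_n -> R, forall c, c != o -> exists a b d k,
    [/\ uniq [:: o; a; b; c; d], k \notin [:: o; c; d] & eps c = (dx c - dx k) * delta a b c d].
  apply: (@fin_all_exists _ (fun _ => R) (fun c v => c != o -> exists a b d k,
    [/\ uniq [:: o; a; b; c; d], k \notin [:: o; c; d] & v = (dx c - dx k) * delta a b c d])) => c.
  have [->|co] := eqVneq c o; first by exists 0.
  have [//|d nd] := @exists_fresh 4 n [:: o; c] n5.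
  have [|||a [b U]] := @exists_fresh_pair c d => //; try distinct.
  by exists ((dx c - dx a) * delta a b c d) => _; exists a, b, d, a; split=> //; distinct.
have D p q r : p - q \in G -> q - r \in G -> p - r \in G.
  by move=> pq qr; have := idealD idG pq qr; rewrite addrA subrK.
have wu : w u = 0 by apply: (wP u).1.
have wD a b c : c != o -> c != u -> uniq [:: o; a; b; c; u] -> delta a b c u - w c \in G.
  by move=> co cu U; have [a' [b' [U' ->]]] := (wP c).2 co cu; apply: R0.
apply: (@in_G G w eps idG GI R1) => // [a b c d k U nk|a b c d U|c]; last exact: (wP c).2.
  have co : c != o by distinct.
  have [a' [b' [d' [k' [U' nk' ->]]]]] := epsP c co.
  have same d1 a1 b1 k1 a2 b2 k2 : uniq [:: o; a1; b1; c; d1] -> uniq [:: o; a2; b2; c; d1] ->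
      k1 \notin [:: o; c; d1] -> k2 \notin [:: o; c; d1] ->
      (dx c - dx k1) * delta a1 b1 c d1 - (dx c - dx k2) * delta a2 b2 c d1 \in G.
    move=> U1 U2 n1 n2; have := idealB idG (idealM idG (dx c - dx k2) (R0 _ _ _ _ _ _ U1 U2)) (R1 _ _ _ _ _ _ U1 n1 n2).
    by congr (_ \in G); ring.
  have [dd'|dd'] := eqVneq d' d; first by rewrite dd' in U' nk' *; apply: (same d).
  have [|a1 [b1 [k1 [a2 [b2 [k2 [/andP[U1 n1] /andP[U2 n2] S]]]]]]] := swap c d d'; first by distinct.
  exact: D (same _ _ _ _ _ _ _ U U1 nk n1) (D _ _ _ S (same _ _ _ _ _ _ _ U2 U' n2 nk')).
apply: sub_span_eps => //; have [cu|cu] := eqVneq c u; [|have [du|du] := eqVneq d u].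
- rewrite cu wu sub0r in U *; have [do_ du] : d != o /\ d != u by split; distinct.
  have U' : uniq [:: o; a; b; d; u] by distinct.
  by have := idealN idG (wD _ _ _ do_ du U'); congr (_ \in G); rewrite /delta; ring.
- by rewrite du wu subr0 in U *; apply: wD => //; distinct.
have [|a1 [b1 [a2 [b2 [a3 [b3 [U1 U2 U3 E1]]]]]]] := cocycle c d; first by distinct.
have [co do_] : c != o /\ d != o by split; distinct.
apply: D (R0 _ _ _ _ _ _ U U1) _; rewrite E1.
have := idealB idG (wD _ _ c co cu U2) (wD _ _ d do_ du U3).
by congr (_ \in G); ring.
Qed.
End Filtration.

(** * Products of differences that generate I *)

Section Cubics.
Variables (K : fieldType) (n : nat).
Hypothesis n6 : (6 <= n)%N.
Local Notation R := {mpoly K[n]}.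
Local Notation I := (I_ideal K n (n - 2)).
Variables (G : {pred R}).
Hypotheses (idG : is_ideal G) (GI : {subset G <= I}).
Hypothesis G3 : forall a b c d e f : 'I_n, uniq [:: a; b; c; d; e; f] ->
  ('X_a - 'X_b) * ('X_c - 'X_d) * ('X_e - 'X_f) \in G.

(** The index o plays the role of one of the six in a product dx a * (dx k - dx l) *
    (dx c - dx d), which gives each relation; a sixth index makes up for the
    missing relation between dx a and dx b. *)
Lemma I_sub_cubics : {subset I <= G}.
Proof.
have n5 : (5 <= n)%N by apply: ltnW.
pose o : 'I_n := Ordinal (ltnW (ltnW (ltnW (ltnW (ltnW n6))))).
have [//|u uo] := @exists_fresh 5 n [:: o] n6.
have Q a k l c d : uniq [:: o; a; k; l; c; d] ->
    dx K o a * (dx K o k - dx K o l) * (dx K o c - dx K o d) \in G.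
  move=> U; have := G3 (a := a) (b := o) (c := k) (d := l) (e := c) (f := d).
  by rewrite /dx (_ : uniq _); [move/(_ isT); congr (_ \in G); ring | distinct].
have D (p q r : R) : p - q \in G -> q - r \in G -> p - r \in G.
  by move=> pq qr; have := idealD idG pq qr; rewrite addrA subrK.
have R0a a b a' c d : uniq [:: o; a; b; c; d] -> uniq [:: o; a'; b; c; d] ->
    delta K o a b c d - delta K o a' b c d \in G.
  move=> U U'; have [->|aa'] := eqVneq a a'; first by rewrite subrr ideal0.
  have : uniq [:: o; b; a; a'; c; d] by distinct.
  by move/Q; congr (_ \in G); rewrite /delta; ring.
have dC a b c d : delta K o a b c d = delta K o b a c d by rewrite /delta; ring.
have R0 a b a' b' c d : uniq [:: o; a; b; c; d] -> uniq [:: o; a'; b'; c; d] ->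
    delta K o a b c d - delta K o a' b' c d \in G.
  move=> U U'; have [a'b|a'b] := eqVneq a' b.
    by rewrite a'b in U' *; rewrite [delta K o b _ _ _]dC; apply: R0a => //; distinct.
  apply: D (R0a _ _ a' _ _ U _) _; first by distinct.
  by rewrite ![delta K o a' _ _ _]dC; apply: R0a => //; distinct.
apply: (@I_sub_of_exchange K n o u n5 _ G idG GI _ R0).
- by distinct.
- move=> a b c d k l U nk nl; have [->|kl] := eqVneq k l; first by rewrite subrr mul0r ideal0.
  have Qa x : x \notin [:: o; c; d; k; l] -> dx K o x * (dx K o k - dx K o l) * (dx K o c - dx K o d) \in G.
    by move=> nx; apply: Q; distinct.
  have [akl|akl] := boolP (a \in [:: k; l]); last first.
    have : a \notin [:: o; c; d; k; l] by distinct.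
    by move/Qa/(idealM idG (dx K o b)); congr (_ \in G); rewrite /delta; ring.
  have [bkl|bkl] := boolP (b \in [:: k; l]); last first.
    have : b \notin [:: o; c; d; k; l] by distinct.
    by move/Qa/(idealM idG (dx K o a)); congr (_ \in G); rewrite /delta; ring.
  have [//|e ne] := @exists_fresh 5 n [:: o; a; b; c; d] n6.
  have [U1 U2] : uniq [:: o; b; a; e; c; d] /\ uniq [:: o; a; b; e; c; d] by split; distinct.
  have H : (dx K o a - dx K o b) * delta K o a b c d \in G.
    have := idealB idG (idealM idG (dx K o a) (Q _ _ _ _ _ U1)) (idealM idG (dx K o b) (Q _ _ _ _ _ U2)).
    by congr (_ \in G); rewrite /delta; ring.
  have ab : a != b by distinct.
  move: H akl bkl ab; rewrite !inE => H /orP[]/eqP akl /orP[]/eqP bkl; rewrite {}akl {}bkl ?eqxx // in H * => _.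
  by have := idealN idG H; congr (_ \in G); ring.
- move=> c d U; have [//|a na] := @exists_fresh 5 n [:: o; u; c; d] n6; have [//|b nb] := @exists_fresh 5 n [:: o; u; c; d; a] n6.
  exists a, b, a, b, a, b; split; try distinct.
  by rewrite /delta; ring.
move=> c d d' U; have [//|k nk] := @exists_fresh 5 n [:: o; c; d; d'] n6; have [//|a na] := @exists_fresh 5 n [:: o; c; d; d'; k] n6.
exists a, k, k, a, k, k; split; try distinct.
have : uniq [:: o; a; c; k; d'; d] by distinct.
by move/Q/(idealM idG (dx K o k)); congr (_ \in G); rewrite /delta; ring.
Qed.
End Cubics.

Section Quartics.
Variables (K : fieldType).
Local Notation R := {mpoly K[5]}.
Local Notation I := (I_ideal K 5 3).
Variables (G : {pred R}).
Hypotheses (idG : is_ideal G) (GI : {subset G <= I}).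
Hypothesis G4 : forall a b c d e : 'I_5, uniq [:: a; b; c; d; e] ->
  ('X_a - 'X_b) * ('X_a - 'X_c) * ('X_b - 'X_c) * ('X_d - 'X_e) \in G.

Lemma uniq5_all (s : seq 'I_5) x : uniq s -> size s = 5%N -> x \in s.
Proof.
move=> us ss; have [|| _ sE] := uniq_min_size us (s2 := enum 'I_5); last by rewrite sE mem_enum.
  by move=> z _; rewrite mem_enum.
by rewrite size_enum_ord ss.
Qed.

(** There are only four indices other than o, so that a and b are determined by c and d
    up to their order. *)
Lemma I_sub_quartics : {subset I <= G}.
Proof.
have n5 : (5 <= 5)%N by [].
have [o _] : exists o : 'I_5, true by exists ord0.
have [|u uo] := @exists_fresh 4 5 [:: o] isT => //.
pose dz := dx K o.
have R0 a b a' b' c d : uniq [:: o; a; b; c; d] -> uniq [:: o; a'; b'; c; d] ->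
    delta K o a b c d - delta K o a' b' c d \in G.
  move=> U U'; have := uniq5_all a' U erefl; have := uniq5_all b' U erefl; rewrite !inE.
  have [-> ->] : (a' == o) = false /\ (b' == o) = false by split; apply/negbTE; distinct.
  have [-> ->] : (a' == c) = false /\ (b' == c) = false by split; apply/negbTE; distinct.
  have [-> ->] : (a' == d) = false /\ (b' == d) = false by split; apply/negbTE; distinct.
  have ab' : a' != b' by distinct.
  rewrite !orbF /= => /orP[]/eqP E1 /orP[]/eqP E2; move: ab'; rewrite E1 E2 ?eqxx //= => _.
    by have -> : delta K o a b c d - delta K o b a c d = 0; [rewrite /delta; ring | rewrite ideal0].
  by rewrite subrr ideal0.
have Q3 c d e f : uniq [:: o; c; d; e; f] -> (dz c - dz d) * (dz c - dz e) * (dz d - dz e) * dz f \in G.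
  move=> U; have := G4 (a := c) (b := d) (c := e) (d := f) (e := o).
  by rewrite /dz /dx (_ : uniq _); [move/(_ isT); congr (_ \in G); ring | distinct].
have Q2 a b c d : uniq [:: o; a; b; c; d] -> dz a * dz b * (dz a - dz b) * (dz c - dz d) \in G.
  move=> U; have := G4 (a := a) (b := b) (c := o) (d := c) (e := d).
  by rewrite /dz /dx (_ : uniq _); [move/(_ isT); congr (_ \in G); ring | distinct].
apply: (@I_sub_of_exchange K 5 o u n5 _ G idG GI _ R0).
- by distinct.
- move=> a b c d k l U nk nl; have := uniq5_all k U erefl; have := uniq5_all l U erefl; rewrite !inE.
  have [-> ->] : (k == o) = false /\ (l == o) = false by split; apply/negbTE; distinct.
  have [-> ->] : (k == c) = false /\ (l == c) = false by split; apply/negbTE; distinct.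
  have [-> ->] : (k == d) = false /\ (l == d) = false by split; apply/negbTE; distinct.
  have := Q2 _ _ _ _ U; rewrite !orbF /= => H /orP[]/eqP-> /orP[]/eqP->; rewrite ?subrr ?mul0r ?ideal0 //.
    by have := idealN idG H; congr (_ \in G); rewrite /delta /dz; ring.
  by have := H; congr (_ \in G); rewrite /delta /dz; ring.
- move=> c d U; have [//|a na] := @exists_fresh 4 5 [:: o; u; c; d] isT.
  exists a, u, a, d, a, c; split; try distinct.
  by rewrite /delta; ring.
move=> c d d' U; have [//|a na] := @exists_fresh 4 5 [:: o; c; d; d'] isT.
exists d', a, d', d, a, d; split; try distinct.
have : uniq [:: o; c; d'; d; a] by distinct.
by move/Q3; congr (_ \in G); rewrite /delta /dz; ring.
Qed.
End Quartics.

(** * Tableaux *)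

Section Boxes.
Variable la : seq nat.
Implicit Types p q : box la.

Lemma row_lt p : (row_of p < size la)%N. Proof. exact: ltn_ord. Qed.
Lemma col_lt p : (col_of p < nth 0%N la (row_of p))%N. Proof. exact: ltn_ord. Qed.

Lemma box_eq p q : (p == q) = (row_of p == row_of q) && (col_of p == col_of q).
Proof.
apply/eqP/andP => [->|]; first by rewrite !eqxx.
case: p q => [i c] [i' c'] [/eqP]; rewrite /row_of /col_of /= => /val_inj E.
by case: _ / E c' => c' /eqP/val_inj ->.
Qed.

Lemma ex_box r c : (r < size la)%N -> (c < nth 0%N la r)%N ->
  exists p, row_of p = r /\ col_of p = c.
Proof.
move=> hr hc; exists (@Tagged _ (Ordinal hr) (fun i => 'I_(nth 0%N la i)) (Ordinal hc)).
by [].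
Qed.

Lemma card_box : #|{: box la}| = sumn la.
Proof.
rewrite card_tagged sumnE big_map big_enum /= [in RHS](sumnE la) (big_nth 0%N) big_mkord.
by apply: eq_bigr => i _; rewrite card_ord.
Qed.
End Boxes.

Lemma extend_bij (X Y : finType) (xs : seq X) (ys : seq Y) : #|X| = #|Y| ->
  uniq xs -> uniq ys -> size xs = size ys -> (0 < size ys)%N ->
  exists T : X -> Y, bijective T /\ map T xs = ys.
Proof.
move=> cXY uxs uys sz; case: ys => // y0 ys' in uys sz *; set ys := y0 :: ys' => _.
have cat_full (Z : finType) (zs : seq Z) : uniq zs ->
    let zs' := zs ++ [seq z <- enum Z | z \notin zs] in
    [/\ uniq zs', zs' =i Z & size zs' = #|Z|].
  move=> uz zs'; have uz' : uniq zs'.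
    rewrite cat_uniq uz filter_uniq ?enum_uniq // andbT; apply/hasPn => z.
    by rewrite mem_filter => /andP[].
  have zE : zs' =i Z by move=> z; rewrite mem_cat mem_filter mem_enum andbT orbN.
  by split=> //; rewrite -(card_uniqP uz'); apply: eq_card.
have [uX memX szX] := cat_full X xs uxs; have [uY memY szY] := cat_full Y ys uys.
set xs' := xs ++ _ in uX memX szX; set yy := ys ++ _ in uY memY szY.
pose T x := nth y0 yy (index x xs').
exists T; split.
  apply: inj_card_bij; last by rewrite cXY.
  move=> x x' /eqP; rewrite nth_uniq // ?szY -?cXY -?szX ?index_mem ?memX //.
  by move/eqP/index_inj; apply; rewrite ?memX.
apply: (@eq_from_nth _ y0); rewrite size_map // => k kx.
have x0 : X by case: xs kx {sz uxs uX memX szX xs' T} => // x.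
rewrite (nth_map x0) // /T index_cat mem_nth // index_uniq // nth_cat.
by rewrite -sz kx.
Qed.

Section Specht.
Variables (K : fieldType) (n : nat) (la : seq nat).
Local Notation R := {mpoly K[n]}.
Implicit Types T : 'I_n -> box la.

Lemma specht_poly_eq0 T (f : {rmorphism R -> R}) a b : injective T -> a != b ->
  col_of (T a) = col_of (T b) -> (col_of (T a) < nth 0%N la 0)%N -> f 'X_a = f 'X_b ->
  f (specht_poly K T) = 0.
Proof.
move=> injT; wlog ab : a b / (row_of (T a) < row_of (T b))%N => [IH ne cab clt fab|].
  case: (ltngtP (row_of (T a)) (row_of (T b))) => [lt|lt|rab]; first exact: (IH a b).
    by apply: (IH b a); rewrite 1?eq_sym -?cab.
  by case/eqP: ne; apply: injT; apply/eqP; rewrite box_eq rab cab !eqxx.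
move=> _ cab clt fab; rewrite /specht_poly (bigD1 (Ordinal clt)) //= /specht_col.
rewrite (bigD1 a) //= (bigD1 b) ?cab ?eqxx ?ab //= !rmorphM rmorphB /= fab subrr !mul0r //.
Qed.

Lemma specht_colE T (j : nat) (s : seq 'I_n) : injective T -> uniq s ->
  (forall p, (p \in map T s) = (col_of p == j)) ->
  specht_col K T j =
    \prod_(a <- s) \prod_(b <- s | (row_of (T a) < row_of (T b))%N) ('X_a - 'X_b).
Proof.
move=> injT us sE; have colE a : (col_of (T a) == j) = (a \in s) by rewrite -sE mem_map.
rewrite /specht_col big_uniq //=; apply: eq_big => // a _.
rewrite [RHS]big_mkcond big_uniq //= -big_mkcondr; apply: eq_bigl => b.
by rewrite colE.
Qed.

Lemma specht_in T : bijective T -> specht_poly K T \in specht_ideal K n la.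
Proof. by move=> bT; apply: ideal_gen_in; exists T. Qed.
End Specht.

Section TwoRows.
Variables (K : fieldType) (n : nat).
Hypothesis n6 : (6 <= n)%N.
Local Notation la := [:: (n - 3)%N; 3%N].
Local Notation R := {mpoly K[n]}.

Lemma box2P (p : box la) : (row_of p = 0%N /\ (col_of p < n - 3)%N) \/ (row_of p = 1%N /\ (col_of p < 3)%N).
Proof. by have := row_lt p; have := col_lt p; case: (row_of p) => [|[|r]] //=; [left|right]. Qed.

Lemma ex_box2 r c : (r < 2)%N -> (c < 3)%N -> exists p : box la, row_of p = r /\ col_of p = c.
Proof. by move=> r2 c3; apply: ex_box; case: r r2 => [|[|]] //= _; lia. Qed.

(** One of the first three columns contains neither i nor j, and both of its entries are
    replaced by x_l. *)
Lemma two_rows_sub : {subset specht_ideal K n la <= I_ideal K n (n - 2)}.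
Proof.
have n5 : (5 <= n)%N by apply: ltnW.
apply: ideal_gen_sub; first exact: is_ideal_closed (I_sub2_proper K n n5).
move=> _ [T [T' TK T'K] ->]; apply: I_idealP => [|i j l ij li lj]; first exact: leq_trans n6.
have [c [c3 ci cj]] : exists c, [/\ (c < 3)%N, col_of (T i) != c & col_of (T j) != c].
  case: (eqVneq (col_of (T i)) 0%N) => i0; case: (eqVneq (col_of (T j)) 0%N) => j0;
  case: (eqVneq (col_of (T i)) 1%N) => i1; case: (eqVneq (col_of (T j)) 1%N) => j1;
  by [exists 0%N | exists 1%N | exists 2%N; split => //; lia].
have [p [p0 pc]] := @ex_box2 0 c isT c3; have [q [q1 qc]] := @ex_box2 1 c isT c3.
have E k r : (r == p) || (r == q) -> col_of (T k) != c -> (T' r == k) = false.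
  move=> rpq kc; apply: contraNF kc => /eqP <-; rewrite T'K.
  by case/orP: rpq => /eqP ->; rewrite ?pc ?qc.
apply: (@specht_poly_eq0 K n la T (piece_sub i j l) (T' p) (T' q) (can_inj TK)).
- by rewrite (can_eq T'K) box_eq p0 q1.
- by rewrite !T'K pc qc.
- by rewrite T'K pc /=; lia.
by rewrite /= !psubX !E ?eqxx ?orbT.
Qed.

Lemma cubic_in_specht (a b c d e f : 'I_n) : uniq [:: a; b; c; d; e; f] ->
  ('X_a - 'X_b) * ('X_c - 'X_d) * ('X_e - 'X_f) \in specht_ideal K n la.
Proof.
move=> U.
have [p0 [p00 p01]] := @ex_box2 0 0 isT isT; have [q0 [q00 q01]] := @ex_box2 1 0 isT isT.
have [p1 [p10 p11]] := @ex_box2 0 1 isT isT; have [q1 [q10 q11]] := @ex_box2 1 1 isT isT.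
have [p2 [p20 p21]] := @ex_box2 0 2 isT isT; have [q2 [q20 q21]] := @ex_box2 1 2 isT isT.
have [|||||T [bT]] := @extend_bij _ (box la) [:: a; b; c; d; e; f] [:: p0; q0; p1; q1; p2; q2] => //.
- by rewrite card_ord card_box /=; lia.
- by rewrite !cons_uniq !inE !box_eq p00 p01 p10 p11 p20 p21 q00 q01 q10 q11 q20 q21.
have injT := bij_inj bT.
case=> Ta Tb Tc Td Te Tf.
have := specht_in K bT; congr (_ \in specht_ideal K n la); rewrite /specht_poly.
have pair (j : nat) (x z : 'I_n) : (j < 3)%N -> x != z -> row_of (T x) = 0%N -> col_of (T x) = j ->
    row_of (T z) = 1%N -> col_of (T z) = j -> specht_col K T j = 'X_x - 'X_z.
  move=> j3 xz x0 xj z1 zj; rewrite (@specht_colE K n la T j [:: x; z]) //.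
  - by rewrite !big_cons !big_nil x0 z1 /= !mulr1.
  - by rewrite /= inE xz.
  move=> p; rewrite !map_cons !inE !box_eq x0 xj z1 zj; case: (box2P p) => -[-> _] /=; by rewrite ?orbF.
rewrite -(big_mkord xpredT (fun j => specht_col K T j)) /= (@big_cat_nat _ _ _ 3) //=; last by lia.
rewrite [X in _ * X]big1_seq ?mulr1 => [|j].
  rewrite 3?big_nat_recl //= big_geq // mulr1 mulrA.
  rewrite (pair 0%N a b) ?(pair 1%N c d) ?(pair 2%N e f) ?Ta ?Tb ?Tc ?Td ?Te ?Tf //; distinct.
rewrite /= mem_index_iota => /andP[j3 jn].
have [p [pr pc]] := @ex_box la 0 j isT jn; have [T' TK T'K] := bT.
rewrite (@specht_colE K n la T j [:: T' p]) // => [|p']; first by rewrite !big_cons !big_nil T'K ltnn mulr1.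
rewrite map_cons T'K inE box_eq pr pc; case: (box2P p') => -[-> cp] //=.
by symmetry; apply/negbTE; lia.
Qed.

Lemma specht_two_rows : specht_ideal K n la = I_ideal K n (n - 2) :> {pred R}.
Proof.
apply/funext => p; apply/idP/idP; first exact: two_rows_sub.
by apply: (@I_sub_cubics K n n6 (specht_ideal K n la)); [exact: ideal_gen_ideal | exact: two_rows_sub | exact: cubic_in_specht].
Qed.
End TwoRows.

Section Shape221.
Variable K : fieldType.
Local Notation la := [:: 2%N; 2%N; 1%N].
Local Notation R := {mpoly K[5]}.

Lemma box221P (p : box la) : ((row_of p < 3)%N /\ col_of p = 0%N) \/ ((row_of p < 2)%N /\ col_of p = 1%N).
Proof.
by have := row_lt p; have := col_lt p; case: (row_of p) => [|[|[|r]]] //=; case: (col_of p) => [|[|c]] //; auto.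
Qed.

(** If i and j are both in the first column, the second column avoids them; otherwise at
    most one of the three entries of the first column is in {i, j}. *)
Lemma shape221_sub : {subset specht_ideal K 5 la <= I_ideal K 5 3}.
Proof.
apply: ideal_gen_sub; first exact: is_ideal_closed (I_sub2_proper K 5 isT).
move=> _ [T [T' TK T'K] ->]; apply: (@I_idealP K 5) => // i j l ij li lj.
suff [p [q [pq cpq [pi pj] [qi qj]]]] : exists p q : box la, [/\ p != q, col_of p = col_of q,
    p != T i /\ p != T j & q != T i /\ q != T j].
  apply: (@specht_poly_eq0 K 5 la T (piece_sub i j l) (T' p) (T' q) (can_inj TK)).
  - by rewrite (can_eq T'K).
  - by rewrite !T'K.
  - by rewrite T'K; case: (box221P p) => -[_ ->].
  by rewrite /= !psubX !(can2_eq T'K TK) (negbTE pi) (negbTE pj) (negbTE qi) (negbTE qj).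
have [p0 [p00 p01]] := @ex_box la 0 0 isT isT; have [q0 [q00 q01]] := @ex_box la 0 1 isT isT.
have [p1 [p10 p11]] := @ex_box la 1 0 isT isT; have [q1 [q10 q11]] := @ex_box la 1 1 isT isT.
have [p2 [p20 p21]] := @ex_box la 2 0 isT isT.
have D : [/\ p0 != p1, p0 != p2, p1 != p2 & q0 != q1] by rewrite !box_eq p00 p01 p10 p11 p20 q00 q10.
case: D => D01 D02 D12 Dq.
have [/andP[i0 j0]|] := boolP ((col_of (T i) == 0%N) && (col_of (T j) == 0%N)).
  exists q0, q1; split; rewrite ?q01 ?q11 // !box_eq ?q01 ?q11 (eqP i0) (eqP j0) !andbF; by [].
have col0 r c1 c2 : col_of (T c1) != 0%N -> col_of r = 0%N -> r != T c2 -> (r != T c1) && (r != T c2).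
  by move=> nc r0 ->; rewrite box_eq r0 negb_and [0%N == _]eq_sym nc orbT.
have two k : exists p q : box la, [/\ p != q, col_of p = 0%N, col_of q = 0%N, p != T k & q != T k].
  have [e0|ne0] := eqVneq p0 (T k); first by exists p1, p2; rewrite -e0 ![_ == p0]eq_sym.
  have [e1|ne1] := eqVneq p1 (T k); first by exists p0, p2; rewrite -e1 ![_ == p1]eq_sym D12; split=> //; rewrite eq_sym.
  by exists p0, p1.
rewrite negb_and => /orP[i0|j0].
  have [p [q [pq pc qc pj qj]]] := two j; exists p, q; split; rewrite ?pc ?qc //; apply/andP; exact: col0.
have [p [q [pq pc qc pi qi]]] := two i; exists p, q; split; rewrite ?pc ?qc //; apply/andP; rewrite andbC; exact: col0.
Qed.

Lemma quartic_in_specht (a b c d e : 'I_5) : uniq [:: a; b; c; d; e] ->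
  ('X_a - 'X_b) * ('X_a - 'X_c) * ('X_b - 'X_c) * ('X_d - 'X_e) \in specht_ideal K 5 la.
Proof.
move=> U.
have [p0 [p00 p01]] := @ex_box la 0 0 isT isT; have [q0 [q00 q01]] := @ex_box la 0 1 isT isT.
have [p1 [p10 p11]] := @ex_box la 1 0 isT isT; have [q1 [q10 q11]] := @ex_box la 1 1 isT isT.
have [p2 [p20 p21]] := @ex_box la 2 0 isT isT.
have [|||||T [bT]] := @extend_bij _ (box la) [:: a; b; c; d; e] [:: p0; p1; p2; q0; q1] => //.
- by rewrite card_ord card_box.
- by rewrite !cons_uniq !inE !box_eq p00 p01 p10 p11 p20 p21 q00 q01 q10 q11.
have injT := bij_inj bT.
case=> Ta Tb Tc Td Te.
have := specht_in K bT; congr (_ \in specht_ideal K 5 la); rewrite /specht_poly !big_ord_recl big_ord0 /= mulr1.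
rewrite (@specht_colE K 5 la T 0 [:: a; b; c]) //; first last.
- move=> p; rewrite !map_cons Ta Tb Tc !inE !box_eq p00 p01 p10 p11 p20 p21.
  by case: (box221P p) => -[+ ->]; rewrite ?andbF //; case: (row_of p) => [|[|[|]]].
- distinct.
rewrite (@specht_colE K 5 la T 1 [:: d; e]) //; first last.
- move=> p; rewrite !map_cons Td Te !inE !box_eq q00 q01 q10 q11.
  by case: (box221P p) => -[+ ->]; rewrite ?andbF //; case: (row_of p) => [|[|[|]]].
- distinct.
rewrite !big_cons !big_nil Ta Tb Tc Td Te p00 p10 p20 q00 q10 /=; ring.
Qed.

Lemma specht_shape221 : specht_ideal K 5 la = I_ideal K 5 3 :> {pred R}.
Proof.
apply/funext => p; apply/idP/idP; first exact: shape221_sub.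
by apply: (@I_sub_quartics K (specht_ideal K 5 la)); [exact: ideal_gen_ideal | exact: shape221_sub | exact: quartic_in_specht].
Qed.
End Shape221.

Lemma cohen_macaulay_I (K : fieldType) (n : nat) (hn : (5 <= n)%N) (J : {pred {mpoly K[n]}})
    (hJ : idealr_closed J) : J = I_ideal K n (n - 2) ->
  cohen_macaulay (quotient_ring hJ) <-> 2%N \notin [pchar K].
Proof.
move=> JE; move: hJ; rewrite {J}JE => hJ.
have char2 : (2%N \in [pchar K]) = (2%:R == 0 :> K) by [].
rewrite char2; split=> [cm|K2]; last exact: cohen_macaulay_char_neq2.
apply/negP => /eqP K2; have n0 : (0 < n)%N by apply: leq_trans hn.
exact: (not_cohen_macaulay_char2 (Ordinal n0) hn K2 cm).
Qed.

Theorem theorem5p3 (K : fieldType) :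
  [/\ forall (n : nat) (hn : (5 <= n)%N),
        cohen_macaulay (quotient_ring (I_sub2_proper K n hn))
          <-> 2%N \notin [pchar K],
      forall (n : nat) (hn : (6 <= n)%N),
        cohen_macaulay (quotient_ring (specht_sub3_3_proper K n hn))
          <-> 2%N \notin [pchar K]
    & cohen_macaulay (quotient_ring (specht_221_proper K))
        <-> 2%N \notin [pchar K]].
Proof.
split=> [n hn|n hn|]; first exact: cohen_macaulay_I.
  by apply: (cohen_macaulay_I (ltnW hn)); apply: specht_two_rows.
by apply: (@cohen_macaulay_I K 5) => //; apply: specht_shape221.
Qed.
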